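(* Let $a,b,c\in\mathbb{R}$, $\alpha>-1$, and suppose $1<p\le\infty$. Then the following conditions are equivalent. (i) The operator $S_{a,b,c}$ is bounded from $L^p_\alpha$ to $L^\infty$. (ii) The operator $T_{a,b,c}$ is bounded from $L^p_\alpha$ to $L^\infty$. (iii) The parameters satisfy either $$a=0,\qquad \alpha+1<p(b+1),\qquad c<n+1+b-\frac{n+1+\alpha}{p},$$ or $$a>0,\qquad \alpha+1<p(b+1),\qquad c\le n+1+a+b-\frac{n+1+\alpha}{p}.$$ When $p=\infty$, these conditions in (iii) are to be interpreted as: either $a=0$, $b>-1$, $c<n+1+b$; or $a>0$, $b>-1$, $c\le n+1+a+b$.
   Context: Let $n\ge 1$ be an integer, $\mathbb{B}_n$ the open unit ball of $\mathbb{C}^n$, $\langle z,w\rangle=\sum_{j=1}^n z_j\overline{w_j}$, and $dv$ the normalized volume measure on $\mathbb{B}_n$, so $v(\mathbb{B}_n)=1$. For $\alpha>-1$ let $dv_\alpha(z)=c_\alpha(1-|z|^2)^\alpha\,dv(z)$ with $c_\alpha=\Gamma(n+\alpha+1)/[n!\,\Gamma(\alpha+1)]$, so that $v_\alpha(\mathbb{B}_n)=1$. For $1\le p<\infty$, $L^p_\alpha=L^p(\mathbb{B}_n,dv_\alpha)$ with norm $\|f\|_{p,\alpha}=\left(\int_{\mathbb{B}_n}|f|^p\,dv_\alpha\right)^{1/p}$; $L^\infty$ is the space of essentially bounded measurable functions on $\mathbb{B}_n$ with the essential supremum norm, and $L^\infty_\alpha=L^\infty$ for every $\alpha>-1$.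 For $a,b,c\in\mathbb{R}$ the Forelli-Rudin type operators are $$T_{a,b,c}f(z)=(1-|z|^2)^a\int_{\mathbb{B}_n}\frac{(1-|w|^2)^b}{(1-\langle z,w\rangle)^c}f(w)\,dv(w),\qquad S_{a,b,c}f(z)=(1-|z|^2)^a\int_{\mathbb{B}_n}\frac{(1-|w|^2)^b}{|1-\langle z,w\rangle|^c}f(w)\,dv(w),$$ where the power is the principal branch ($\operatorname{Re}(1-\langle z,w\rangle)>0$). Such an operator is bounded from $L^p_\alpha$ to $L^\infty$ if for every $f\in L^p_\alpha$ the defining integral converges (absolutely, for $z\in\mathbb{B}_n$) and there is a constant $C$, independent of $f$, with the $L^\infty$ norm of the image at most $C$ times the $L^p_\alpha$ norm of $f$. *)

(* Defs.v *)
From HB Require Import structures.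
From mathcomp Require Import all_boot all_order all_algebra.
From mathcomp Require Import complex.
From mathcomp Require Import all_classical all_reals all_analysis.
From mathcomp Require Import measurable_realfun.

Set Implicit Arguments.
Unset Strict Implicit.
Unset Printing Implicit Defensive.
Import Order.TTheory GRing.Theory Num.Theory.
Import numFieldNormedType.Exports.
Import ComplexField.Normc.

Local Open Scope classical_set_scope.
Local Open Scope ring_scope.

(* R[i] carries the Borel sigma-algebra of the plane, transported from R * R;
   n.-tuple R[i] then carries the library's product sigma-algebra. *)
Section complex_measurable.
Context {R : realType}.

HB.instance Definition _ := isPointed.Build R[i] 0.

Definition pair_of_complex (z : R[i]) : R * R := (complex.Re z, complex.Im z).
Definition complex_of_pair (x : R * R) : R[i] := (x.1 +i* x.2)%C.

Let measurable_complex : set (set R[i]) :=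
  g_sigma_algebra_preimage pair_of_complex.

Let measurable_complex0 : measurable_complex set0.
Proof. exact: (@measurable0 _ (g_sigma_algebra_preimageType pair_of_complex)). Qed.

Let measurable_complexC A : measurable_complex A -> measurable_complex (~` A).
Proof. exact: (@measurableC _ (g_sigma_algebra_preimageType pair_of_complex)). Qed.

Let measurable_complex_bigcup (F : (set R[i])^nat) :
  (forall i, measurable_complex (F i)) -> measurable_complex (\bigcup_i F i).
Proof.
exact: (@bigcupT_measurable _ (g_sigma_algebra_preimageType pair_of_complex)).
Qed.

HB.instance Definition _ := @isMeasurable.Build
  (preimage_display pair_of_complex) R[i] measurable_complex
  measurable_complex0 measurable_complexC measurable_complex_bigcup.

Lemma measurable_complex_of_pair : measurable_fun [set: R * R] complex_of_pair.
Proof.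
move=> _ _ [B mB <-]; rewrite !setTI.
rewrite (_ : _ @^-1` _ = B)//.
by apply/seteqP; split => -[x y].
Qed.

Lemma measurable_pair_of_complex :
  measurable_fun [set: R[i]] pair_of_complex.
Proof. by move=> _ B mB; exists B. Qed.

Lemma measurable_Re : measurable_fun [set: R[i]] (@complex.Re R).
Proof.
exact: (measurableT_comp measurable_fst measurable_pair_of_complex).
Qed.

Lemma measurable_Im : measurable_fun [set: R[i]] (@complex.Im R).
Proof.
exact: (measurableT_comp measurable_snd measurable_pair_of_complex).
Qed.

Lemma measurable_sqr_normc :
  measurable_fun [set: R[i]] (fun z : R[i] => normc z ^+ 2).
Proof.
rewrite (_ : (fun z => _) =
  (fun z : R[i] => complex.Re z ^+ 2 + complex.Im z ^+ 2)); last first.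
  by apply/funext => -[x y] /=; rewrite sqr_sqrtr// addr_ge0 ?sqr_ge0.
by apply: measurable_funD; apply: measurable_funX;
  [exact: measurable_Re|exact: measurable_Im].
Qed.

End complex_measurable.

Lemma sigma_finite_pushforward d1 d2 (T1 : measurableType d1)
    (T2 : measurableType d2) (R : realType) (mu : {measure set T1 -> \bar R})
    (f : T1 -> T2) (g : T2 -> T1) :
  measurable_fun [set: T2] g -> cancel f g ->
  sigma_finite [set: T1] mu -> sigma_finite [set: T2] (pushforward mu f).
Proof.
move=> mg fK [F UF mF]; exists (fun i => g @^-1` F i).
  by rewrite -preimage_bigcup -UF preimage_setT.
move=> i; have [mFi Fioo] := mF i; split.
  by rewrite -[X in measurable X]setTI; exact: mg.
rewrite /pushforward (_ : _ @^-1` _ = F i)//.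
by apply/seteqP; split => x /=; rewrite fK.
Qed.


Lemma sigma_finite_product d1 d2 (T1 : measurableType d1)
    (T2 : measurableType d2) (R : realType)
    (m1 : {sigma_finite_measure set T1 -> \bar R})
    (m2 : {sigma_finite_measure set T2 -> \bar R}) :
  sigma_finite setT (m1 \x m2)%E.
Proof.
have /sigma_finiteP[F [TF ndF Foo]] := sigma_finiteT m1.
have /sigma_finiteP[G [TG ndG Goo]] := sigma_finiteT m2.
exists (fun n => F n `*` G n).
  rewrite -setXTT TF TG predeqE => -[x y]; split.
    move=> [/= [n _ Fnx] [k _ Gky]]; exists (maxn n k) => //; split.
    - by move: x Fnx; exact/subsetPset/ndF/leq_maxl.
    - by move: y Gky; exact/subsetPset/ndG/leq_maxr.
  by move=> [n _ []/= ? ?]; split; exists n.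
move=> k; have [? ?] := Foo k; have [? ?] := Goo k.
split; first exact: measurableX.
by rewrite product_measure1E// lte_mul_pinfty// ge0_fin_numE.
Qed.

Section lebesgue_complex.
Context {R : realType}.
Local Open Scope ereal_scope.

Definition lebesgue_C : set R[i] -> \bar R :=
  pushforward (@lebesgue_measure R \x @lebesgue_measure R) complex_of_pair.

Let m : {measure set R[i] -> \bar R} :=
  measure_function_pushforward__canonical__measure_function_Measure
    (@lebesgue_measure R \x @lebesgue_measure R) measurable_complex_of_pair.
Let lebesgue_C0 : lebesgue_C set0 = 0. Proof. exact: (measure0 m). Qed.
Let lebesgue_C_ge0 A : 0 <= lebesgue_C A. Proof. exact: (measure_ge0 m). Qed.
Let lebesgue_C_sigma_additive : semi_sigma_additive lebesgue_C.
Proof. exact: (@measure_semi_sigma_additive _ _ _ m). Qed.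
HB.instance Definition _ := isMeasure.Build _ _ _ lebesgue_C
  lebesgue_C0 lebesgue_C_ge0 lebesgue_C_sigma_additive.

Let lebesgue_C_sigma_finite : sigma_finite setT lebesgue_C.
Proof.
apply: (@sigma_finite_pushforward _ _ _ _ _
  (@lebesgue_measure R \x @lebesgue_measure R) _ pair_of_complex).
- exact: measurable_pair_of_complex.
- by case.
- exact: sigma_finite_product.
Qed.
HB.instance Definition _ := Measure_isSigmaFinite.Build _ _ _ lebesgue_C
  lebesgue_C_sigma_finite.
End lebesgue_complex.

Notation Cn R n := (n.-tuple R[i]).

Section lebesgue_Cn.
Context {R : realType}.
Local Open Scope ereal_scope.

Definition cons_Cn n (x : R[i] * Cn R n) : Cn R n.+1 :=
  [the n.+1.-tuple R[i] of x.1 :: x.2].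

Definition uncons_Cn n (z : Cn R n.+1) : R[i] * Cn R n :=
  (thead z, [tuple of behead z]).

Lemma cons_CnK n : cancel (@cons_Cn n) (@uncons_Cn n).
Proof.
move=> [x z]; rewrite /uncons_Cn /cons_Cn /= theadE; congr (_, _).
exact: val_inj.
Qed.

Lemma measurable_cons_Cn n :
  measurable_fun [set: R[i] * Cn R n] (@cons_Cn n).
Proof. exact: measurable_cons. Qed.

Lemma measurable_uncons_Cn n : measurable_fun [set: Cn R n.+1] (@uncons_Cn n).
Proof.
apply: measurable_fun_pair.
- exact: (measurable_tnth ord0).
- exact: measurable_behead.
Qed.

Section step.
Context (n : nat) (mu : {sigma_finite_measure set (Cn R n) -> \bar R}).

Definition lebesgue_step : set (Cn R n.+1) -> \bar R :=
  pushforward (@lebesgue_C R \x mu) (@cons_Cn n).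

Let m : {measure set (Cn R n.+1) -> \bar R} :=
  measure_function_pushforward__canonical__measure_function_Measure
    (@lebesgue_C R \x mu) (@measurable_cons_Cn n).
Let lebesgue_step0 : lebesgue_step set0 = 0.
Proof. exact: (measure0 m). Qed.
Let lebesgue_step_ge0 A : 0 <= lebesgue_step A.
Proof. exact: (measure_ge0 m). Qed.
Let lebesgue_step_sigma_additive : semi_sigma_additive lebesgue_step.
Proof. exact: (@measure_semi_sigma_additive _ _ _ m). Qed.
HB.instance Definition _ := isMeasure.Build _ _ _ lebesgue_step
  lebesgue_step0 lebesgue_step_ge0 lebesgue_step_sigma_additive.

Let lebesgue_step_sigma_finite : sigma_finite setT lebesgue_step.
Proof.
apply: (@sigma_finite_pushforward _ _ _ _ _ (@lebesgue_C R \x mu) _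
  (@uncons_Cn n)).
- exact: measurable_uncons_Cn.
- exact: cons_CnK.
- exact: sigma_finite_product.
Qed.
HB.instance Definition _ := Measure_isSigmaFinite.Build _ _ _ lebesgue_step
  lebesgue_step_sigma_finite.
End step.

(* Lebesgue measure on C^n = R^(2n), as an iterated product of planar Lebesgue
   measures. *)
Fixpoint lebesgue_Cn n : {sigma_finite_measure set (Cn R n) -> \bar R} :=
  match n with
  | 0 => \d_ ([tuple] : Cn R 0)
  | n'.+1 => lebesgue_step (lebesgue_Cn n')
  end.

End lebesgue_Cn.

Section unit_ball.
Context {R : realType} {n : nat}.
Implicit Types z w : Cn R n.

Definition inner z w : R[i] := \sum_(j < n) tnth z j * (tnth w j)^*%C.

Definition sqnorm z : R := \sum_(j < n) normc (tnth z j) ^+ 2.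

Definition unit_ball : set (Cn R n) := [set z | sqnorm z < 1].

Lemma measurable_sqnorm : measurable_fun [set: Cn R n] sqnorm.
Proof.
apply: measurable_sum => j.
exact: (measurableT_comp measurable_sqr_normc (measurable_tnth j)).
Qed.

Lemma measurable_unit_ball : measurable unit_ball.
Proof.
rewrite (_ : unit_ball = [set: Cn R n] `&` sqnorm @^-1` `]-oo, 1[%classic).
  exact: measurable_sqnorm.
by rewrite setTI; apply/seteqP; split => z /=; rewrite in_itv.
Qed.

End unit_ball.
Arguments unit_ball R n : clear implicits.
Arguments measurable_unit_ball R n : clear implicits.

Section volume.
Context (R : realType) (n : nat).
Local Open Scope ereal_scope.

Lemma inv_volume_unit_ball_ge0 :
  (0 <= (fine (@lebesgue_Cn R n (unit_ball R n)))^-1)%R.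
Proof. by rewrite invr_ge0 fine_ge0. Qed.

(* dv: zero outside the ball, with total mass 1 *)
Definition volume : {measure set (Cn R n) -> \bar R} :=
  mscale (NngNum inv_volume_unit_ball_ge0)
    (mrestr (@lebesgue_Cn R n) (measurable_unit_ball R n)).

End volume.

Section weighted_volume.
Context {R : realType}.

Definition Gamma (x : R) : R :=
  \int[@lebesgue_measure R]_(t in `]0, +oo[) (t `^ (x - 1) * expR (- t)).

Definition c_ (n : nat) (alpha : R) : R :=
  Gamma (n%:R + alpha + 1) / (n`!%:R * Gamma (alpha + 1)).

Lemma Gamma_ge0 x : 0 <= Gamma x.
Proof.
rewrite /Gamma /Rintegral fine_ge0//; apply: integral_ge0 => t _.
by rewrite lee_fin mulr_ge0 ?powR_ge0 ?expR_ge0.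
Qed.

Lemma c_ge0 n alpha : 0 <= c_ n alpha.
Proof. by rewrite divr_ge0 ?mulr_ge0 ?Gamma_ge0. Qed.

Context (n : nat) (alpha : R).
Local Open Scope ereal_scope.

Definition weight (z : Cn R n) : \bar R :=
  (c_ n alpha * (1 - sqnorm z) `^ alpha)%:E.

Lemma weight_ge0 z : 0 <= weight z.
Proof. by rewrite lee_fin mulr_ge0 ?c_ge0 ?powR_ge0. Qed.

Lemma measurable_weight : measurable_fun [set: Cn R n] weight.
Proof.
apply/measurable_EFinP; apply: measurable_funM => //.
apply: (measurableT_comp (measurable_powR alpha)).
by apply: measurable_funB => //; exact: measurable_sqnorm.
Qed.

(* dv_alpha *)
Definition weighted_volume (A : set (Cn R n)) : \bar R :=
  \int[volume R n]_(z in A) weight z.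

Let weighted_volume0 : weighted_volume set0 = 0.
Proof. exact: integral_set0. Qed.

Let weighted_volume_ge0 A : 0 <= weighted_volume A.
Proof. by apply: integral_ge0 => z _; exact: weight_ge0. Qed.

Let weighted_volume_sigma_additive : semi_sigma_additive weighted_volume.
Proof.
move=> F mF tF mUF; rewrite /weighted_volume ge0_integral_bigcup//=.
- by apply: is_cvg_nneseries => k _ _; exact: weighted_volume_ge0.
- exact: measurable_funTS measurable_weight.
- by move=> z _; exact: weight_ge0.
Qed.

HB.instance Definition _ := isMeasure.Build _ _ _ weighted_volume
  weighted_volume0 weighted_volume_ge0 weighted_volume_sigma_additive.

End weighted_volume.

Section complex_power.
Context {R : realType}.

(* principal argument, in ]-pi, pi] for z != 0 *)
Definition Arg (z : R[i]) : R :=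
  if 0 <= complex.Im z then acos (complex.Re z / normc z)
  else - acos (complex.Re z / normc z).

(* z^c = |z|^c e^(i c Arg z), for z != 0 *)
Definition cpowr (z : R[i]) (c : R) : R[i] :=
  (normc z `^ c * cos (c * Arg z) +i* (normc z `^ c * sin (c * Arg z)))%C.

End complex_power.

Section complex_integral.
Context d (T : measurableType d) (R : realType).
Variable mu : {measure set T -> \bar R}.

Definition cintegrable (D : set T) (f : T -> R[i]) : Prop :=
  measurable_fun D f /\ (\int[mu]_(x in D) (normc (f x))%:E < +oo)%E.

Definition cintegral (D : set T) (f : T -> R[i]) : R[i] :=
  (\int[mu]_(x in D) complex.Re (f x) +i* \int[mu]_(x in D) complex.Im (f x))%C.

End complex_integral.

Section Lebesgue_spaces.
Context {R : realType} {n : nat}.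
Local Open Scope ereal_scope.
Implicit Types f : Cn R n -> R[i].

(* Functions on the ball are represented by functions on C^n whose values
   outside the ball are ignored. *)
Definition ball_Lnorm (mu : {measure set (Cn R n) -> \bar R}) (p : \bar R) f :
    \bar R :=
  Lnorm mu p ((fun z => (normc (f z))%:E) \_ (unit_ball R n)).

Definition Linfty_norm f : \bar R := ball_Lnorm (volume R n) +oo f.

(* L^oo_alpha is L^oo of the unweighted volume, for every alpha *)
Definition Lp_norm (alpha : R) (p : \bar R) f : \bar R :=
  match p with
  | +oo => Linfty_norm f
  | _ => ball_Lnorm (weighted_volume alpha) p f
  end.

Definition in_Lp (alpha : R) (p : \bar R) f : Prop :=
  measurable_fun (unit_ball R n) f /\ Lp_norm alpha p f < +oo.

Definition in_Linfty f : Prop :=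
  measurable_fun (unit_ball R n) f /\ Linfty_norm f < +oo.

End Lebesgue_spaces.

Section Forelli_Rudin.
Context {R : realType} {n : nat}.
Implicit Types (f : Cn R n -> R[i]) (z w : Cn R n).

Definition T_kernel (b c : R) z w : R[i] :=
  ((1 - sqnorm w) `^ b)%:C%C / cpowr (1 - inner z w) c.

Definition S_kernel (b c : R) z w : R[i] :=
  ((1 - sqnorm w) `^ b / normc (1 - inner z w) `^ c)%:C%C.

Definition weighted_integral_op (a : R) (K : Cn R n -> Cn R n -> R[i]) f z :
    R[i] :=
  ((1 - sqnorm z) `^ a)%:C%C *
  cintegral (volume R n) (unit_ball R n) (fun w => K z w * f w).

Definition T_op (a b c : R) := weighted_integral_op a (T_kernel b c).

Definition S_op (a b c : R) := weighted_integral_op a (S_kernel b c).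

(* For an operator Op given by integration against the kernel K: absolute
   convergence at every point of the ball, and the norm estimate. *)
Definition bounded_Lp_Linfty (alpha : R) (p : \bar R)
    (K : Cn R n -> Cn R n -> R[i]) (Op : (Cn R n -> R[i]) -> Cn R n -> R[i]) :
    Prop :=
  (forall f, in_Lp alpha p f -> forall z, unit_ball R n z ->
     cintegrable (volume R n) (unit_ball R n) (fun w => K z w * f w)) /\
  (exists C : R, forall f, in_Lp alpha p f ->
     in_Linfty (Op f) /\
     (Linfty_norm (Op f) <= C%:E * Lp_norm alpha p f)%E).

End Forelli_Rudin.

(* Main.v *)
(* Put u = 1 - <z,w> and r = 1/p.  Both kernels have modulus (1 - |w|^2)^b |u|^-c,
   and their real part is at least half of it when u lies in a narrow sector
   around the positive axis; only these two facts matter, so S and T are bounded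
   under the same condition.
   Sufficiency: by Hoelder's inequality it is enough that the integral over w of
   (1 - |w|^2)^s |u|^-t be O((1 - |z|^2)^-A), with s = (b - r alpha)/(1 - r),
   t = c/(1 - r) and A = a/(1 - r).  This follows by summing over dyadic values of
   |u| and of 1 - |w|^2, as the set where |u| <= d and 1 - |w|^2 <= h has volume
   O(d^n h).
   Necessity: test on the extremal functions of Hoelder's inequality supported
   in sets where the kernel has positive real part.  A small ball near 0 for w
   and boundary points z give a >= 0; boundary shells for w and a small ball for z
   give r (alpha + 1) < b + 1; a box of size d near the boundary point e_1 for both
   gives the bound on c as d -> 0, and the union of the boxes at dyadic scales
   makes it strict when a = 0. *)
Require Import Defs.
From mathcomp Require Import all_boot all_order all_algebra.
From mathcomp Require Import complex.
From mathcomp Require Import all_classical all_reals all_analysis.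
From mathcomp Require Import measurable_realfun ring lra.

Set Implicit Arguments.
Unset Strict Implicit.
Unset Printing Implicit Defensive.
Import Order.TTheory GRing.Theory Num.Theory.
Import numFieldNormedType.Exports.
Import ComplexField.Normc.
Local Open Scope classical_set_scope.
Local Open Scope ring_scope.

(** * Dyadic sums and product measures *)

(** The volume bound is proved without rotating z to e_1. If |u| <= d, each coordinate of w is
    within sqrt(2d) of that of z, which costs O(d) per coordinate. A coordinate j where |z_j| is
    bounded below does better: the others being fixed, <z,w> confines w_j to diameter O(d), and the
    bound on 1 - |w|^2 confines it to an annulus of area density O(h), hence area O(d h). When a >
    0, equality in the bound on c is allowed: as |u| < 2, the exponent t may be raised until the
    dyadic sum is governed by its smallest scale |u| ~ 1 - |z|^2. In the converse, an essential
    bound says nothing about a single z, so z always ranges over a set of positive volume. The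
    supports in w stay away from the sphere: then the integral I of the extremal function is finite,
    and an estimate of I by a multiple of I^r can be divided by I^r to bound I^(1-r). Divergence is
    thus seen only through finite unions of m pieces, with m arbitrary. Working with 1 - r instead
    of the conjugate exponent keeps p = oo in the same formulas. *)

Lemma powR_exprn (R : realType) (x s : R) k : 0 <= x -> (x ^+ k) `^ s = (x `^ s) ^+ k.
Proof.
by move=> x0; rewrite -(powR_mulrn k x0) -(powR_mulrn k (powR_ge0 x s)) -!powRrM mulrC.
Qed.

Lemma powRD_gt0 (R : realType) (x r s : R) : 0 < x -> x `^ (r + s) = x `^ r * x `^ s.
Proof. by move=> x0; rewrite powRD// (gt_eqF x0) implybT. Qed.

(** In logarithms the hypotheses read |ln x - ln y| <= ln K, and multiplication by [s] costs a
    factor |s|. The absolute value spares any discussion of the sign of the exponent. *)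
Lemma powR_comparable (R : realType) (K x y s : R) : 0 < x -> 0 < y -> 1 <= K ->
  x <= K * y -> y <= K * x -> y `^ s <= K `^ `|s| * x `^ s.
Proof.
move=> x0 y0 K1 xKy yKx; have K0 : 0 < K by rewrite (lt_le_trans _ K1).
rewrite /powR !gt_eqF// -expRD ler_expR.
have h1 : ln x <= ln K + ln y by rewrite -lnM ?posrE// ler_ln ?posrE ?mulr_gt0.
have h2 : ln y <= ln K + ln x by rewrite -lnM ?posrE// ler_ln ?posrE ?mulr_gt0.
rewrite -lerBlDr -mulrBr (le_trans (ler_norm _))// normrM ler_wpM2l//.
by rewrite ler_norml; apply/andP; split; lra.
Qed.

Section measure_tools.
Context d (T : measurableType d) (R : realType).
Local Open Scope ereal_scope.
Import HBNNSimple.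

(** Monotone convergence along simple functions increasing to [f] reduces both sides to indicators,
    where the equality is the hypothesis on [nu]. *)
Lemma ge0_integral_density (mu nu : {measure set T -> \bar R}) (g : T -> R) :
  measurable_fun setT g -> (forall x, (0 <= g x)%R) ->
  (forall A, measurable A -> nu A = \int[mu]_(x in A) (g x)%:E) ->
  forall f : T -> \bar R, measurable_fun setT f -> (forall x, 0 <= f x) ->
  \int[nu]_x f x = \int[mu]_x (f x * (g x)%:E).
Proof.
move=> mg g0 nuE f mf f0.
pose h := nnsfun_approx measurableT mf.
have hf x : EFin \o h^~ x @ \oo --> f x by exact: cvg_nnsfun_approx.
have nd x : {homo h^~ x : a b / (a <= b)%N >-> (a <= b)%R}.
  by move=> a b ab; exact/lefP/nd_nnsfun_approx.
have mh n : measurable_fun setT (EFin \o h n) by exact/measurable_EFinP.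
have mgE : measurable_fun setT (EFin \o g) by exact/measurable_EFinP.
have -> : \int[nu]_x f x = limn (fun n => \int[nu]_x (EFin \o h n) x).
  rewrite -monotone_convergence//.
  - by apply: eq_integral => x _; apply/esym/cvg_lim => //; exact: hf.
  - by move=> n x _; rewrite lee_fin.
  - by move=> x _ a b ab; rewrite lee_fin; exact: nd.
have -> : \int[mu]_x (f x * (g x)%:E) =
    limn (fun n => \int[mu]_x ((EFin \o h n) x * (g x)%:E)).
  rewrite -monotone_convergence//.
  - apply: eq_integral => x _; apply/esym/cvg_lim => //.
    by apply: cvgeZr => //; exact: hf.
  - by move=> n; exact: emeasurable_funM.
  - by move=> n x _; rewrite -EFinM lee_fin mulr_ge0.
  - by move=> x _ a b ab; rewrite -!EFinM lee_fin ler_wpM2r//; exact: nd.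
congr (limn _); apply/funext => n.
have hE x : (h n x)%:E =
    \sum_(y \in range (h n)) (y * \1_(h n @^-1` [set y]) x)%:E.
  by rewrite fsumEFin// -(fimfunE _ x).
have mind (y : R) : measurable_fun [set: T] (fun x => (y * \1_(h n @^-1` [set y]) x)%:E).
  by apply/measurable_EFinP; exact: measurable_funM.
under eq_integral do rewrite /= hE.
rewrite ge0_integral_fsum//; last by move=> y x _; exact: nnfun_muleindic_ge0.
under [RHS]eq_integral => x _.
  rewrite /= hE ge0_mule_fsuml; last by move=> y; exact: nnfun_muleindic_ge0.
  over.
rewrite ge0_integral_fsum//; last 2 first.
- by move=> y; exact: emeasurable_funM.
- by move=> y x _; rewrite mule_ge0 ?lee_fin//; exact: nnfun_muleindic_ge0.
apply: eq_fsbigr => y yh.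
have y0 : (0 <= y)%R by have [x _ <-] := set_mem yh; exact: fun_ge0.
rewrite integralZl_indic_nnsfun// integral_indic// setIT nuE//.
under [RHS]eq_integral => x _ do rewrite EFinM -muleA.
rewrite ge0_integralZl//; first last.
- by move=> x _; rewrite mule_ge0 ?lee_fin.
- by apply: emeasurable_funM => //; exact/measurable_EFinP.
congr (_ * _); rewrite [LHS]integral_mkcond; apply: eq_integral => x _.
rewrite patchE indicE; case: ifPn => _; by rewrite ?mul1e ?mul0e.
Qed.

(** On the layer where u is within a factor 2 of m_k = m0 lam^k, the integrand is at most 2^|t|
    m_k^(-t). Bounding the layer by the whole sublevel set gives terms in m_k^(q-t), a geometric
    series of ratio lam^(q-t). It serves with lam = 1/2 and with lam = 2. *)
Lemma integral_powR_dyadic (mu : {measure set T -> \bar R}) (D : set T)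
    (u : T -> R) (M q t lam m0 : R) :
  measurable D -> measurable_fun D u -> (0 < lam)%R -> (0 < m0)%R -> (0 <= M)%R ->
  (forall x, D x -> exists k, (m0 * lam ^+ k / 2 <= u x <= m0 * lam ^+ k)%R) ->
  (forall k, mu (D `&` [set x | (u x <= m0 * lam ^+ k)%R]) <=
     (M * (m0 * lam ^+ k) `^ q)%:E) ->
  (lam `^ (q - t) < 1)%R ->
  \int[mu]_(x in D) (u x `^ (- t))%:E <=
    (2 `^ `|t| * M * m0 `^ (q - t) / (1 - lam `^ (q - t)))%:E.
Proof.
move=> mD mu_ lam0 m00 M0 cov muD lam1.
pose m k := (m0 * lam ^+ k)%R.
have mk0 k : (0 < m k)%R by rewrite mulr_gt0// exprn_gt0.
pose c k := (2 `^ `|t| * m k `^ (- t))%R.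
have c0 k : (0 <= c k)%R by rewrite mulr_ge0// powR_ge0.
pose Dk k := D `&` [set x | (u x <= m k)%R].
have mDk k : measurable (Dk k).
  rewrite (_ : Dk k = D `&` u @^-1` `]-oo, m k]%classic); first exact: mu_.
  by apply/seteqP; split => x /=; rewrite in_itv.
(* The sum is nonnegative, so the single term [k] of a layer containing [x] already dominates. *)
have pt x : D x -> (u x `^ (- t))%:E <= \sum_(k <oo) (c k * \1_(Dk k) x)%:E.
  move=> Dx; have [k /andP[uk1 uk2]] := cov x Dx.
  have ux0 : (0 < u x)%R by rewrite (lt_le_trans _ uk1)// divr_gt0// mk0.
  apply: le_trans (nneseries_lim_ge (P := xpredT) (m := 0%N) k.+1 _); last first.
    by move=> i _ _; rewrite lee_fin mulr_ge0.
  rewrite big_nat_recr//= lee_paddl//; last first.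
    rewrite lee_fin indicE mem_set// mulr1 /c -(normrN t).
    apply: powR_comparable => //; first by rewrite ler1n.
      by rewrite /m; lra.
    by have := mk0 k; rewrite /m in uk2 *; lra.
  by apply: sume_ge0 => i _; rewrite lee_fin mulr_ge0.
apply: (@le_trans _ _ (\int[mu]_(x in D) \sum_(k <oo) (c k * \1_(Dk k) x)%:E)).
  apply: ge0_le_integral => //.
  - by move=> x _; rewrite lee_fin powR_ge0.
  - by apply/measurable_EFinP; apply: (measurableT_comp (measurable_powR (- t))).
  - apply: ge0_emeasurable_sum => [k x _ _|k _]; first by rewrite lee_fin mulr_ge0.
    by apply/measurable_EFinP; apply: measurable_funM => //; exact: measurable_indic.
rewrite integral_nneseries//; last 2 first.
  - by move=> k; apply/measurable_EFinP; apply: measurable_funM => //; exact: measurable_indic.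
  - by move=> k x _; rewrite lee_fin mulr_ge0.
have r0 : (0 <= lam `^ (q - t))%R by exact: powR_ge0.
have intE k : \int[mu]_(x in D) (c k * \1_(Dk k) x)%:E <=
    (2 `^ `|t| * M * m0 `^ (q - t) * (lam `^ (q - t)) ^+ k)%:E.
  under eq_integral do rewrite EFinM.
  rewrite ge0_integralZl//; last 2 first.
  - by apply/measurable_EFinP; exact: measurable_indic.
  - by rewrite lee_fin.
  rewrite integral_indic// setIidl; last by move=> x [].
  apply: (@le_trans _ _ ((c k)%:E * (M * m k `^ q)%:E)).
    by rewrite lee_wpmul2l ?lee_fin//; exact: muD.
  rewrite -EFinM lee_fin /c.
  have -> : (m k `^ q = m k `^ t * m k `^ (q - t))%R.
    by rewrite -powRD_gt0// subrKC.
  have -> : (m k `^ (q - t) = m0 `^ (q - t) * lam `^ (q - t) ^+ k)%R.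
    rewrite /m powRM// ?ltW// ?exprn_gt0//; congr (_ * _)%R.
    by rewrite powR_exprn// ltW.
  rewrite powRN le_eqVlt; apply/orP; left; apply/eqP.
  have : (m k `^ t != 0)%R by rewrite gt_eqF// powR_gt0.
  move: (m k `^ t)%R (2 `^ `|t|)%R (m0 `^ (q - t))%R (lam `^ (q - t) ^+ k)%R => X Y Z W X0.
  by field.
apply: le_trans (lee_nneseries _ (fun k _ => intE k)) _.
  by move=> k _ _; apply: integral_ge0 => x _; rewrite lee_fin mulr_ge0.
apply: lime_le.
  apply: is_cvg_nneseries => k _ _; rewrite lee_fin.
  by rewrite !mulr_ge0 ?powR_ge0 ?exprn_ge0.
apply: nearW => k; rewrite sumEFin lee_fin.
have := @geometric_le_lim R k (2 `^ `|t| * M * m0 `^ (q - t)) (lam `^ (q - t)).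
rewrite seriesEnat /=; apply; rewrite ?powR_gt0 ?mulr_ge0 ?powR_ge0//.
by rewrite ger0_norm.
Qed.

Lemma integral_powR_small (mu : {measure set T -> \bar R}) (D : set T)
    (u : T -> R) (M q t d0 : R) :
  measurable D -> measurable_fun D u -> (0 < d0)%R -> (0 <= M)%R ->
  (forall x, D x -> (0 < u x <= d0)%R) ->
  (forall r : R, (0 < r <= d0)%R ->
    mu (D `&` [set x | (u x <= r)%R]) <= (M * r `^ q)%:E) ->
  (t < q)%R ->
  \int[mu]_(x in D) (u x `^ (- t))%:E <=
    (2 `^ `|t| * M * d0 `^ (q - t) / (1 - 2^-1 `^ (q - t)))%:E.
Proof.
move=> mD mu_ d00 M0 uD muD tq.
apply: integral_powR_dyadic => //.
- move=> x /uD /andP[u0 ud].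
  have ex : exists k, (d0 * 2^-1 ^+ k / 2 < u x)%R.
    exists (Num.bound (d0 / u x)); rewrite exprVn.
    have := @upper_nthrootP _ (d0 / u x) _ (leqnn _).
    set k := Num.bound _ => h.
    rewrite -mulrA -invfM ltr_pdivrMr ?mulr_gt0 ?exprn_gt0//.
    move: h; rewrite ltr_pdivrMr// => /lt_le_trans; apply.
    rewrite [leRHS]mulrC ler_wpM2r ?(ltW u0)// ler_peMr ?exprn_ge0//.
    by rewrite ler1n.
  (* For the least such k, failure at k - 1 is the upper bound on [u x]; for k = 0 that bound is the
     hypothesis u <= d0. *)
  exists (ex_minn ex); case: ex_minnP => k ku kmin; rewrite (ltW ku)/=.
  case: k ku kmin => [|k] ku kmin; first by rewrite expr0 mulr1.
  rewrite leNgt; apply/negP; rewrite exprSr mulrA => uk.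
  by have := kmin k uk; rewrite ltnn.
- move=> k; apply: muD; apply/andP; split; first by rewrite mulr_gt0 ?exprn_gt0.
  by rewrite ler_piMr ?(ltW d00)// exprn_ile1// invf_le1 ?ler1n.
- by rewrite /powR gt_eqF// lnV ?posrE// expR_lt1 mulrN oppr_lt0 mulr_gt0 ?subr_gt0// ln_gt0 ?ltr1n.
Qed.

(** The scales start at 2e, so that the layer k = 0 is the interval from e to 2e and no point of D
    is missed. *)
Lemma integral_powR_large (mu : {measure set T -> \bar R}) (D : set T)
    (u : T -> R) (M q t e : R) :
  measurable D -> measurable_fun D u -> (0 < e)%R -> (0 <= M)%R ->
  (forall x, D x -> (e <= u x)%R) ->
  (forall r : R, (0 < r)%R ->
    mu (D `&` [set x | (u x <= r)%R]) <= (M * r `^ q)%:E) ->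
  (q < t)%R ->
  \int[mu]_(x in D) (u x `^ (- t))%:E <=
    (2 `^ `|t| * M * (2 * e) `^ (q - t) / (1 - 2 `^ (q - t)))%:E.
Proof.
move=> mD mu_ e0 M0 uD muD qt.
apply: integral_powR_dyadic => //.
- by rewrite mulr_gt0.
- move=> x /uD eu; have u0 := lt_le_trans e0 eu.
  have ex : exists k, (u x <= 2 * e * 2 ^+ k)%R.
    exists (Num.bound (u x / e)).
    have := @upper_nthrootP _ (u x / e) _ (leqnn _).
    set k := Num.bound _; rewrite ltr_pdivrMr// => /ltW /le_trans; apply.
    by rewrite -mulrA mulrC ler_peMl ?mulr_ge0 ?exprn_ge0 ?ltW// ltr1n.
  exists (ex_minn ex); case: ex_minnP => k ku kmin; rewrite ku andbT.
  case: k ku kmin => [|k] ku kmin; first by rewrite expr0 mulr1 mulrC mulKf.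
  rewrite leNgt; apply/negP; rewrite exprSr mulrA mulfK// => /ltW uk.
  by have := kmin k uk; rewrite ltnn.
- by move=> k; apply: muD; rewrite !mulr_gt0 ?exprn_gt0.
- by rewrite /powR gt_eqF// expR_lt1 nmulr_rlt0 ?subr_lt0// ln_gt0 ?ltr1n.
Qed.

End measure_tools.

(** * Measures of sets bounded through their sections *)

Section product_bounds.
Context d1 d2 (T1 : measurableType d1) (T2 : measurableType d2) (R : realType).
Local Open Scope ereal_scope.

Lemma product_measure1_le (m1 : {measure set T1 -> \bar R})
    (m2 : {sigma_finite_measure set T2 -> \bar R}) (E : set (T1 * T2)) (A : set T1) (c : R) :
  measurable E -> measurable A -> (0 <= c)%R ->
  (forall p, E p -> A p.1) ->
  (forall x, A x -> m2 (xsection E x) <= c%:E) ->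
  (m1 \x m2) E <= c%:E * m1 A.
Proof.
move=> mE mA c0 EA Ec; rewrite /product_measure1.
have -> : m1 A = \int[m1]_x (\1_A x)%:E by rewrite integral_indic// setIT.
rewrite -ge0_integralZl//; last by apply/measurable_EFinP; exact: measurable_indic.
apply: ge0_le_integral => //.
- exact: measurable_fun_xsection.
- by apply/measurable_EFinP; apply: measurable_funM => //; exact: measurable_indic.
- move=> x _ /=; rewrite indicE; case: (boolP (x \in A)) => [/set_mem Ax|/negP xA].
    by rewrite mule1 Ec.
  rewrite mule0 (_ : xsection E x = set0) ?measure0//.
  apply/seteqP; split => y //; rewrite /xsection /= inE => /EA /= Ax.
  by apply: xA; exact: mem_set.
Qed.

Context (m1 : {sigma_finite_measure set T1 -> \bar R})
        (m2 : {sigma_finite_measure set T2 -> \bar R}).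

(** The product measure is defined by integrating over the first factor; its uniqueness allows
    integrating over the second one instead. *)
Lemma product_measureE2 (E : set (T1 * T2)) : measurable E ->
  (m1 \x m2) E = \int[m2]_y m1 (ysection E y).
Proof.
move=> mE; rewrite (product_measure_unique (m' := m1 \x^ m2))//.
by move=> A B mA mB; exact: product_measure2E.
Qed.

Lemma product_measure2_le (E : set (T1 * T2)) (A : set T2) (c : R) :
  measurable E -> measurable A -> (0 <= c)%R ->
  (forall p, E p -> A p.2) ->
  (forall y, A y -> m1 (ysection E y) <= c%:E) ->
  (m1 \x m2) E <= c%:E * m2 A.
Proof.
move=> mE mA c0 EA Ec; rewrite product_measureE2//.
have -> : m2 A = \int[m2]_x (\1_A x)%:E by rewrite integral_indic// setIT.
rewrite -ge0_integralZl//; last by apply/measurable_EFinP; exact: measurable_indic.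
apply: ge0_le_integral => //.
- exact: measurable_fun_ysection.
- by apply/measurable_EFinP; apply: measurable_funM => //; exact: measurable_indic.
- move=> y _ /=; rewrite indicE; case: (boolP (y \in A)) => [/set_mem Ay|/negP yA].
    by rewrite mule1 Ec.
  rewrite mule0 (_ : ysection E y = set0) ?measure0//.
  apply/seteqP; split => x //; rewrite /ysection /= inE => /EA /= Ay.
  by apply: yA; exact: mem_set.
Qed.

Lemma product_measure2_ge (E : set (T1 * T2)) (A : set T2) (c : R) :
  measurable E -> measurable A -> (0 <= c)%R ->
  (forall y, A y -> c%:E <= m1 (ysection E y)) ->
  c%:E * m2 A <= (m1 \x m2) E.
Proof.
move=> mE mA c0 Ec; rewrite product_measureE2//.
have -> : m2 A = \int[m2]_x (\1_A x)%:E by rewrite integral_indic// setIT.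
rewrite -ge0_integralZl//; last by apply/measurable_EFinP; exact: measurable_indic.
apply: ge0_le_integral => //.
- by move=> x _; rewrite -EFinM lee_fin mulr_ge0.
- by apply/measurable_EFinP; apply: measurable_funM => //; exact: measurable_indic.
- exact: measurable_fun_ysection.
- move=> y _ /=; rewrite indicE; case: (boolP (y \in A)) => [/set_mem Ay|yA].
    by rewrite mule1 Ec.
  by rewrite mule0.
Qed.

End product_bounds.

Section lebesgue_C_bounds.
Context (R : realType).
Local Notation leb := (@lebesgue_measure R).
Local Notation mkC := (@complex_of_pair R).
Implicit Types E : set R[i].

Lemma measurable_preimage_pair E : measurable E -> measurable (mkC @^-1` E).
Proof. by move=> mE; rewrite -[X in measurable X]setTI; exact: measurable_complex_of_pair. Qed.

Lemma lebesgue_C_le E (J : set R) (c : R) : measurable E -> measurable J -> 0 <= c ->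
  (forall z, E z -> J (complex.Im z)) ->
  (forall y, J y -> leb [set x | E (x +i* y)%C] <= c%:E)%E ->
  (lebesgue_C E <= c%:E * leb J)%E.
Proof.
move=> mE mJ c0 EJ Ec; rewrite /lebesgue_C /pushforward.
apply: (@product_measure2_le _ _ _ _ _ leb leb _ J c (measurable_preimage_pair mE) mJ c0).
- by move=> [x y] /= /EJ.
- move=> y /Ec h; rewrite (_ : ysection _ _ = [set x | E (x +i* y)%C])//.
  by apply/seteqP; split => x; rewrite /ysection /= inE.
Qed.

Lemma lebesgue_C_le2 E (J : set R) (c : R) : measurable E -> measurable J -> 0 <= c ->
  (forall z, E z -> J (complex.Re z)) ->
  (forall x, J x -> leb [set y | E (x +i* y)%C] <= c%:E)%E ->
  (lebesgue_C E <= c%:E * leb J)%E.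
Proof.
move=> mE mJ c0 EJ Ec; rewrite /lebesgue_C /pushforward.
apply: (@product_measure1_le _ _ _ _ _ leb leb _ J c (measurable_preimage_pair mE) mJ c0).
- by move=> [x y] /= /EJ.
- move=> x /Ec h; rewrite (_ : xsection _ _ = [set y | E (x +i* y)%C])//.
  by apply/seteqP; split => y; rewrite /xsection /= inE.
Qed.

Lemma lebesgue_C_ge E (J : set R) (c : R) : measurable E -> measurable J -> 0 <= c ->
  (forall y, J y -> c%:E <= leb [set x | E (x +i* y)%C])%E ->
  (c%:E * leb J <= lebesgue_C E)%E.
Proof.
move=> mE mJ c0 Ec; rewrite /lebesgue_C /pushforward.
apply: (@product_measure2_ge _ _ _ _ _ leb leb _ J c (measurable_preimage_pair mE) mJ c0).
move=> y /Ec h; rewrite (_ : ysection _ _ = [set x | E (x +i* y)%C])//.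
by apply/seteqP; split => x; rewrite /ysection /= inE.
Qed.

Lemma measurable_C_rect (I J : set R) : measurable I -> measurable J ->
  measurable [set z : R[i] | I (complex.Re z) /\ J (complex.Im z)].
Proof.
move=> mI mJ; rewrite (_ : mkset _ = (@complex.Re R @^-1` I) `&` (@complex.Im R @^-1` J))//.
apply: measurableI; rewrite -[X in measurable X]setTI.
  exact: measurable_Re.
exact: measurable_Im.
Qed.

Lemma lebesgue_C_rect (I J : set R) : measurable I -> measurable J ->
  (lebesgue_C [set z : R[i] | I (complex.Re z) /\ J (complex.Im z)] = leb I * leb J)%E.
Proof.
by move=> mI mJ; rewrite /lebesgue_C /pushforward -product_measure1E.
Qed.

End lebesgue_C_bounds.

Section lebesgue_Cn_bounds.
Context (R : realType) (n : nat).
Local Notation leb := (@lebesgue_Cn R).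
Implicit Types E : set (Cn R n.+1).

Lemma measurable_preimage_cons E : measurable E -> measurable (@cons_Cn R n @^-1` E).
Proof. by move=> mE; rewrite -[X in measurable X]setTI; exact: measurable_cons_Cn. Qed.

Lemma lebesgue_Cn_le_head E (A : set (Cn R n)) (c : R) :
  measurable E -> measurable A -> 0 <= c ->
  (forall x w, E (cons_Cn (x, w)) -> A w) ->
  (forall w, A w -> lebesgue_C [set x | E (cons_Cn (x, w))] <= c%:E)%E ->
  (leb n.+1 E <= c%:E * leb n A)%E.
Proof.
move=> mE mA c0 EA Ec /=; rewrite /lebesgue_step /pushforward.
apply: (@product_measure2_le _ _ _ _ _ (@lebesgue_C R) (leb n) _ A c (measurable_preimage_cons mE) mA c0).
- by move=> [x w] /= /EA.
- move=> w /Ec h; rewrite (_ : ysection _ _ = [set x | E (cons_Cn (x, w))])//.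
  by apply/seteqP; split => x; rewrite /ysection /= inE.
Qed.

Lemma lebesgue_Cn_le_tail E (A : set R[i]) (c : R) :
  measurable E -> measurable A -> 0 <= c ->
  (forall x w, E (cons_Cn (x, w)) -> A x) ->
  (forall x, A x -> leb n [set w | E (cons_Cn (x, w))] <= c%:E)%E ->
  (leb n.+1 E <= c%:E * lebesgue_C A)%E.
Proof.
move=> mE mA c0 EA Ec /=; rewrite /lebesgue_step /pushforward.
apply: (@product_measure1_le _ _ _ _ _ (@lebesgue_C R) (leb n) _ A c (measurable_preimage_cons mE) mA c0).
- by move=> [x w] /= /EA.
- move=> x /Ec h; rewrite (_ : xsection _ _ = [set w | E (cons_Cn (x, w))])//.
  by apply/seteqP; split => w; rewrite /xsection /= inE.
Qed.

Lemma lebesgue_Cn_ge_head E (A : set (Cn R n)) (c : R) :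
  measurable E -> measurable A -> 0 <= c ->
  (forall w, A w -> c%:E <= lebesgue_C [set x | E (cons_Cn (x, w))])%E ->
  (c%:E * leb n A <= leb n.+1 E)%E.
Proof.
move=> mE mA c0 Ec /=; rewrite /lebesgue_step /pushforward.
apply: (@product_measure2_ge _ _ _ _ _ (@lebesgue_C R) (leb n) _ A c (measurable_preimage_cons mE) mA c0).
move=> w /Ec h; rewrite (_ : ysection _ _ = [set x | E (cons_Cn (x, w))])//.
by apply/seteqP; split => x; rewrite /ysection /= inE.
Qed.

Lemma measurable_Cn_prod (I : set R[i]) (A : set (Cn R n)) :
  measurable I -> measurable A ->
  measurable [set w | I (uncons_Cn w).1 /\ A (uncons_Cn w).2].
Proof.
move=> mI mA; rewrite (_ : mkset _ = setT `&` (@uncons_Cn R n) @^-1` (I `*` A)).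
  by apply: measurable_uncons_Cn => //; exact: measurableX.
by rewrite setTI.
Qed.

Lemma lebesgue_Cn_prod (I : set R[i]) (A : set (Cn R n)) :
  measurable I -> measurable A ->
  (leb n.+1 [set w | I (uncons_Cn w).1 /\ A (uncons_Cn w).2] =
   lebesgue_C I * leb n A)%E.
Proof.
move=> mI mA /=; rewrite /lebesgue_step /pushforward -product_measure1E//.
congr (_ _); apply/funext => p.
have h1 : thead (cons_Cn p) = p.1 := congr1 fst (cons_CnK p).
have h2 : [tuple of behead (cons_Cn p)] = p.2 := congr1 snd (cons_CnK p).
by rewrite /preimage /mkset h1 h2.
Qed.

Lemma tnth_cons_Cn0 (x : R[i]) (w : Cn R n) : tnth (cons_Cn (x, w)) ord0 = x.
Proof. by []. Qed.

Lemma tnth_cons_CnS (x : R[i]) (w : Cn R n) j :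
  tnth (cons_Cn (x, w)) (lift ord0 j) = tnth w j.
Proof. by rewrite !(tnth_nth 0). Qed.

Lemma sqnorm_cons (x : R[i]) (w : Cn R n) :
  sqnorm (cons_Cn (x, w)) = normc x ^+ 2 + sqnorm w.
Proof.
rewrite /sqnorm big_ord_recl tnth_cons_Cn0; congr (_ + _).
by apply: eq_bigr => j _; rewrite tnth_cons_CnS.
Qed.

Lemma inner_cons (x y : R[i]) (z w : Cn R n) :
  inner (cons_Cn (x, z)) (cons_Cn (y, w)) = x * y^*%C + inner z w.
Proof.
rewrite /inner big_ord_recl !tnth_cons_Cn0; congr (_ + _).
by apply: eq_bigr => j _; rewrite !tnth_cons_CnS.
Qed.

Lemma cons_uncons_Cn (w : Cn R n.+1) : w = cons_Cn (uncons_Cn w).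
Proof.
case/tupleP: w => x w; rewrite /uncons_Cn /cons_Cn /=; apply: val_inj => /=.
by rewrite theadE.
Qed.

End lebesgue_Cn_bounds.

(** * Geometry of the ball *)

Section complex_norm.
Context {R : realType}.
Implicit Types z : R[i].

Lemma sqr_normcE z : normc z ^+ 2 = complex.Re z ^+ 2 + complex.Im z ^+ 2.
Proof. by case: z => x y /=; rewrite sqr_sqrtr// addr_ge0// sqr_ge0. Qed.

Lemma normc_ge0 z : 0 <= normc z.
Proof. by case: z => x y; exact: sqrtr_ge0. Qed.

Lemma normr_Re_le z : `|complex.Re z| <= normc z.
Proof.
rewrite -(ler_pXn2r (n := 2))// ?nnegrE ?normc_ge0// sqr_normcE real_normK ?num_real//.
by rewrite lerDl sqr_ge0.
Qed.

Lemma normr_Im_le z : `|complex.Im z| <= normc z.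
Proof.
rewrite -(ler_pXn2r (n := 2))// ?nnegrE ?normc_ge0// sqr_normcE real_normK ?num_real//.
by rewrite lerDr sqr_ge0.
Qed.

Lemma normc_le_ReIm z : normc z <= `|complex.Re z| + `|complex.Im z|.
Proof.
rewrite -(ler_pXn2r (n := 2))// ?nnegrE ?normc_ge0 ?addr_ge0// sqr_normcE sqrrD.
rewrite !real_normK ?num_real// lerD2r lerDl.
by rewrite mulrn_wge0// mulr_ge0.
Qed.

Lemma normcJ z : normc z^*%C = normc z.
Proof. by case: z => x y /=; rewrite sqrrN. Qed.

Lemma le_normc_sum (I : Type) (r : seq I) (F : I -> R[i]) :
  normc (\sum_(i <- r) F i) <= \sum_(i <- r) normc (F i).
Proof.
elim: r => [|i r IH]; first by rewrite !big_nil normc0.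
by rewrite !big_cons (le_trans (le_normcD _ _))// lerD2l.
Qed.

End complex_norm.

Section ball_geometry.
Context {R : realType} {n : nat}.
Implicit Types z w : Cn R n.

Lemma sqnorm_ge0 z : 0 <= sqnorm z.
Proof. by apply: sumr_ge0 => j _; rewrite sqr_ge0. Qed.

Lemma sqr_normc_tnth_le z j : normc (tnth z j) ^+ 2 <= sqnorm z.
Proof.
rewrite /sqnorm (bigD1 j)//= lerDl.
by apply: sumr_ge0 => k _; rewrite sqr_ge0.
Qed.

(* Cauchy-Schwarz in its weighted arithmetic-geometric form *)
Lemma normc_inner_le (l : R) z w : 0 < l ->
  normc (inner z w) <= (l * sqnorm z + sqnorm w / l) / 2.
Proof.
move=> l0; rewrite (le_trans (le_normc_sum _ _))//.
rewrite /sqnorm mulr_sumr mulr_suml -big_split/= mulr_suml.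
apply: ler_sum => j _; rewrite normcM normcJ.
set a := normc _; set b := normc _.
have := sqr_ge0 (l * a - b); have l1 : l != 0 by rewrite gt_eqF.
rewrite -(pmulr_rge0 _ (_ : 0 < l^-1 / 2)) ?mulr_gt0 ?invr_gt0// => h.
rewrite -subr_ge0; congr (0 <= _) : h; by field.
Qed.

Lemma sum_sqr_normcB z w :
  \sum_(j < n) normc (tnth w j - tnth z j) ^+ 2 =
  sqnorm z + sqnorm w - 2 * complex.Re (inner z w).
Proof.
have -> : complex.Re (inner z w) =
    \sum_(j < n) complex.Re (tnth z j * (tnth w j)^*%C).
  by rewrite /inner; elim/big_rec2 : _ => // j x y _ <-; case: (_ * _) => ? ?; case: y.
rewrite mulr_sumr /sqnorm -big_split/= -sumrB; apply: eq_bigr => j _.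
by case: (tnth z j) => a b; case: (tnth w j) => x y; rewrite !sqr_normcE/=; ring.
Qed.

(** In the ball, |w - z|^2 = |z|^2 + |w|^2 - 2 Re <z,w> is at most 2 Re (1 - <z,w>). This is where
    the scale sqrt(2d) for the individual coordinates comes from. *)
Lemma sqr_normcB_le z w (k : 'I_n) : unit_ball R n z -> unit_ball R n w ->
  normc (tnth w k - tnth z k) ^+ 2 <= 2 * normc (1 - inner z w).
Proof.
rewrite /unit_ball /= => z1 w1.
apply: (@le_trans _ _ (\sum_(j < n) normc (tnth w j - tnth z j) ^+ 2)).
  by rewrite (bigD1 k)//= lerDl; apply: sumr_ge0 => j _; rewrite sqr_ge0.
rewrite sum_sqr_normcB; have := normr_Re_le (1 - inner z w).
have -> : complex.Re (1 - inner z w) = 1 - complex.Re (inner z w).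
  by case: (inner z w).
by move/(le_trans (ler_norm _)); lra.
Qed.

Lemma ge_normc_1Binner z w : 1 - normc (inner z w) <= normc (1 - inner z w).
Proof.
have := le_normcD (1 - inner z w) (inner z w).
by rewrite subrK normc1; lra.
Qed.

Lemma normc_1Binner_lt2 z w : unit_ball R n z -> unit_ball R n w ->
  normc (1 - inner z w) < 2.
Proof.
rewrite /unit_ball /= => z1 w1.
have := le_normcD 1 (- inner z w); rewrite normc1 normcN.
by have := @normc_inner_le 1 z w ltr01; lra.
Qed.

Lemma Re_1Binner z w : complex.Re (1 - inner z w) = 1 - complex.Re (inner z w).
Proof. by case: (inner z w). Qed.

Lemma Im_1Binner z w : complex.Im (1 - inner z w) = - complex.Im (inner z w).
Proof. by case: (inner z w) => a b /=; rewrite sub0r. Qed.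

Lemma Re_1Binner_gt0 z w : unit_ball R n z -> unit_ball R n w ->
  0 < complex.Re (1 - inner z w).
Proof.
rewrite /unit_ball /= => z1 w1; rewrite Re_1Binner.
have := @normc_inner_le 1 z w ltr01; have := normr_Re_le (inner z w).
by move=> /(le_trans (ler_norm _)); lra.
Qed.

(** |1 - <z,w>| >= 1 - |<z,w>| >= 1 - (|z|^2 + |w|^2) / 2, and |w| < 1. *)
Lemma defect_le_z z w : unit_ball R n z -> unit_ball R n w ->
  (1 - sqnorm z) / 2 <= normc (1 - inner z w).
Proof.
rewrite /unit_ball /= => z1 w1; apply: le_trans (ge_normc_1Binner _ _).
by have := @normc_inner_le 1 z w ltr01; lra.
Qed.

Lemma defect_le_w z w : unit_ball R n z -> unit_ball R n w ->
  (1 - sqnorm w) / 2 <= normc (1 - inner z w).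
Proof.
rewrite /unit_ball /= => z1 w1; apply: le_trans (ge_normc_1Binner _ _).
by have := @normc_inner_le 1 z w ltr01; lra.
Qed.

Lemma normc_1Binner_gt0 z w : unit_ball R n z -> unit_ball R n w ->
  0 < normc (1 - inner z w).
Proof.
move=> z1 w1; apply: lt_le_trans (defect_le_z z1 w1).
by move: z1; rewrite /unit_ball /=; lra.
Qed.

End ball_geometry.

(** * Areas of small pieces of thin annuli *)

Section planar_areas.
Context {R : realType}.
Local Notation leb := (@lebesgue_measure R).
Implicit Types (X : set R) (E : set R[i]).

Lemma lebesgue_measure_centered_itv (x l : R) : 0 <= l ->
  leb `[x - l, x + l]%classic = (2 * l)%:E.
Proof.
move=> l0; rewrite lebesgue_measure_itv/= lte_fin; case: ifPn => [_|].
  by rewrite -EFinB; congr EFin; lra.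
by rewrite -leNgt => h; congr EFin; lra.
Qed.

(** The factor 2 comes from enclosing [X] in the interval of radius [l] about one of its points. *)
Lemma lebesgue_diam_le X (l : R) : measurable X -> 0 <= l ->
  (forall x y, X x -> X y -> x - y <= l) -> (leb X <= (2 * l)%:E)%E.
Proof.
move=> mX l0 Xl; have [->|/set0P[x Xx]] := eqVneq X set0.
  by rewrite measure0 lee_fin mulr_ge0.
rewrite -(lebesgue_measure_centered_itv x l0).
apply: le_measure; rewrite ?inE// => y Xy /=; rewrite in_itv/=.
by have := Xl _ _ Xx Xy; have := Xl _ _ Xy Xx; lra.
Qed.

Lemma measurable_Re_ge (a : R) : measurable [set z : R[i] | a <= complex.Re z].
Proof.
rewrite (_ : mkset _ = setT `&` (@complex.Re R) @^-1` `[a, +oo[%classic).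
  exact: measurable_Re.
by rewrite setTI; apply/seteqP; split => z /=; rewrite in_itv/= andbT.
Qed.

Lemma measurable_Im_ge (a : R) : measurable [set z : R[i] | a <= complex.Im z].
Proof.
rewrite (_ : mkset _ = setT `&` (@complex.Im R) @^-1` `[a, +oo[%classic).
  exact: measurable_Im.
by rewrite setTI; apply/seteqP; split => z /=; rewrite in_itv/= andbT.
Qed.

Lemma measurable_section_Im E (y : R) : measurable E -> measurable [set x : R | E (x +i* y)%C].
Proof.
move=> mE; have := measurable_ysection y (measurable_preimage_pair mE).
by congr measurable; apply/seteqP; split => x; rewrite /ysection /= inE.
Qed.

Lemma measurable_section_Re E (x : R) : measurable E -> measurable [set y : R | E (x +i* y)%C].
Proof.
move=> mE; have := measurable_xsection x (measurable_preimage_pair mE).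
by congr measurable; apply/seteqP; split => y; rewrite /xsection /= inE.
Qed.

(** x^2 - x'^2 = (x - x')(x + x'), where the second factor is at least h. *)
Lemma sqr_window (M r h x x' : R) : 0 < h -> h / 2 <= x -> h / 2 <= x' ->
  M - r <= x ^+ 2 < M -> M - r <= x' ^+ 2 < M -> x - x' <= r / h.
Proof.
move=> h0 hx hx' /andP[a1 a2] /andP[b1 b2].
rewrite ler_pdivlMr//; have [|xx'] := leP x x'.
  by move=> xx'; apply: (@le_trans _ _ 0); [nra|lra].
nra.
Qed.

(** As |z| >= h, one of Re z, -Re z, Im z, -Im z is at least h/2. Where Re z >= h/2, a horizontal
    section has diameter at most r/h by [sqr_window], while Im z stays in an interval of length 2l:
    area at most 4 l r / h. The four cases together give the constant 16. *)
Lemma lebesgue_C_annulus_le E (M r h l : R) : measurable E -> 0 < h -> 0 <= r -> 0 <= l ->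
  (forall z, E z -> M - r <= normc z ^+ 2 < M) ->
  (forall z, E z -> h ^+ 2 <= normc z ^+ 2) ->
  (forall z z', E z -> E z' -> normc (z - z') <= l) ->
  (lebesgue_C E <= (16 * l * r / h)%:E)%E.
Proof.
move=> mE h0 r0 l0 EM Eh El.
have [->|/set0P[z0 Ez0]] := eqVneq E set0.
  by rewrite measure0 lee_fin divr_ge0 ?mulr_ge0 // ltW.
have rh0 : 0 <= 2 * (r / h) by rewrite mulr_ge0// divr_ge0// ltW.
have ElR z z' : E z -> E z' -> complex.Re z - complex.Re z' <= l.
  move=> Ez Ez'; apply: le_trans (El _ _ Ez Ez').
  by apply: le_trans (le_trans (ler_norm _) (normr_Re_le _)); case: z {Ez}; case: z' {Ez'}.
have ElI z z' : E z -> E z' -> complex.Im z - complex.Im z' <= l.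
  move=> Ez Ez'; apply: le_trans (El _ _ Ez Ez').
  by apply: le_trans (le_trans (ler_norm _) (normr_Im_le _)); case: z {Ez}; case: z' {Ez'}.
pose J (a : R) : set R := `[a - l, a + l]%classic.
have lJ a : (leb (J a) <= (2 * l)%:E)%E.
  by rewrite lebesgue_measure_centered_itv.
have mJ a : measurable (J a) by exact: measurable_itv.
have rh1 : 0 <= r / h by rewrite divr_ge0// ltW.
have bnd : ((2 * (r / h))%:E * (2 * l)%:E <= (4 * l * r / h)%:E)%E.
  by rewrite -EFinM lee_fin; lra.
have EC (P : set R[i]) : measurable P -> measurable (E `&` P).
  by move=> mP; exact: measurableI.
have E1 : (lebesgue_C (E `&` [set z | (h / 2 <= complex.Re z)%R]) <= (4 * l * r / h)%:E)%E.
  apply: le_trans (lebesgue_C_le (J := J (complex.Im z0)) (c := 2 * (r / h)) _ (mJ _) rh0 _ _) _.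
  - by apply: EC; exact: measurable_Re_ge.
  - move=> z [Ez _]; rewrite /J/= in_itv/=.
    by have := ElI _ _ Ez Ez0; have := ElI _ _ Ez0 Ez; lra.
  - move=> y _; apply: (lebesgue_diam_le _ rh1).
      by apply: measurable_section_Im; apply: EC; exact: measurable_Re_ge.
    move=> x x' /= [/EM + hx] [/EM + hx']; rewrite !sqr_normcE/= => a b.
    by apply: (@sqr_window (M - y ^+ 2)) => //; lra.
  - by apply: le_trans bnd; rewrite lee_wpmul2l.
have E2 : (lebesgue_C (E `&` [set z | (h / 2 <= complex.Im z)%R]) <= (4 * l * r / h)%:E)%E.
  apply: le_trans (lebesgue_C_le2 (J := J (complex.Re z0)) (c := 2 * (r / h)) _ (mJ _) rh0 _ _) _.
  - by apply: EC; exact: measurable_Im_ge.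
  - move=> z [Ez _]; rewrite /J/= in_itv/=.
    by have := ElR _ _ Ez Ez0; have := ElR _ _ Ez0 Ez; lra.
  - move=> x _; apply: (lebesgue_diam_le _ rh1).
      by apply: measurable_section_Re; apply: EC; exact: measurable_Im_ge.
    move=> y y' /= [/EM + hx] [/EM + hx']; rewrite !sqr_normcE/= => a b.
    by apply: (@sqr_window (M - x ^+ 2)) => //; lra.
  - by apply: le_trans bnd; rewrite lee_wpmul2l.
have mR : measurable [set z : R[i] | complex.Re z <= - (h / 2)].
  rewrite (_ : mkset _ = ((@complex.Re R) @^-1` `]-oo, - (h / 2)]%classic)).
    by rewrite -[X in measurable X]setTI; exact: measurable_Re.
  by apply/seteqP; split => z /=; rewrite in_itv.
have mI : measurable [set z : R[i] | complex.Im z <= - (h / 2)].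
  rewrite (_ : mkset _ = ((@complex.Im R) @^-1` `]-oo, - (h / 2)]%classic)).
    by rewrite -[X in measurable X]setTI; exact: measurable_Im.
  by apply/seteqP; split => z /=; rewrite in_itv.
have E3 : (lebesgue_C (E `&` [set z | (complex.Re z <= - (h / 2))%R]) <= (4 * l * r / h)%:E)%E.
  apply: le_trans (lebesgue_C_le (J := J (complex.Im z0)) (c := 2 * (r / h)) _ (mJ _) rh0 _ _) _.
  - exact: EC.
  - move=> z [Ez _]; rewrite /J/= in_itv/=.
    by have := ElI _ _ Ez Ez0; have := ElI _ _ Ez0 Ez; lra.
  - move=> y _; apply: (lebesgue_diam_le _ rh1).
      by apply: measurable_section_Im; exact: EC.
    move=> x x' /= [/EM + hx] [/EM + hx']; rewrite !sqr_normcE/= => a b.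
    suff : - x' - - x <= r / h by lra.
    by apply: (@sqr_window (M - y ^+ 2)) => //; rewrite ?sqrrN; lra.
  - by apply: le_trans bnd; rewrite lee_wpmul2l.
have E4 : (lebesgue_C (E `&` [set z | (complex.Im z <= - (h / 2))%R]) <= (4 * l * r / h)%:E)%E.
  apply: le_trans (lebesgue_C_le2 (J := J (complex.Re z0)) (c := 2 * (r / h)) _ (mJ _) rh0 _ _) _.
  - exact: EC.
  - move=> z [Ez _]; rewrite /J/= in_itv/=.
    by have := ElR _ _ Ez Ez0; have := ElR _ _ Ez0 Ez; lra.
  - move=> x _; apply: (lebesgue_diam_le _ rh1).
      by apply: measurable_section_Re; exact: EC.
    move=> x0 x' /= [/EM + hx] [/EM + hx']; rewrite !sqr_normcE/= => a b.
    suff : - x' - - x0 <= r / h by lra.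
    by apply: (@sqr_window (M - x ^+ 2)) => //; rewrite ?sqrrN; lra.
  - by apply: le_trans bnd; rewrite lee_wpmul2l.
(* If both |Re z| and |Im z| were below h/2, then |z|^2 would be below h^2 / 2. *)
have sub : E `<=` ((E `&` [set z | (h / 2 <= complex.Re z)%R]) `|`
     (E `&` [set z | (h / 2 <= complex.Im z)%R])) `|`
     ((E `&` [set z | (complex.Re z <= - (h / 2))%R]) `|`
      (E `&` [set z | (complex.Im z <= - (h / 2))%R])).
  move=> z Ez /=; have := Eh _ Ez; rewrite sqr_normcE.
  have [|a1] := leP (h / 2) (complex.Re z); first by left; left.
  have [|a2] := leP (h / 2) (complex.Im z); first by left; right.
  have [|a3] := leP (complex.Re z) (- (h / 2)); first by right; left.
  have [|a4] := leP (complex.Im z) (- (h / 2)); first by right; right.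
  by move=> abs; exfalso; nra.
apply: (@le_trans _ _ (lebesgue_C _)).
  apply: le_measure sub; rewrite ?inE//.
  by apply: measurableU; apply: measurableU; apply: EC => //;
    [exact: measurable_Re_ge|exact: measurable_Im_ge].
have -> : 16 * l * r / h = (4 * l * r / h + 4 * l * r / h) + (4 * l * r / h + 4 * l * r / h).
  by lra.
have mU1 : measurable (E `&` [set z | (h / 2 <= complex.Re z)%R]).
  by apply: EC; exact: measurable_Re_ge.
have mU2 : measurable (E `&` [set z | (h / 2 <= complex.Im z)%R]).
  by apply: EC; exact: measurable_Im_ge.
rewrite !EFinD; apply: le_trans (measureU2 _ _ _) _.
- exact: measurableU.
- by apply: measurableU; exact: EC.
apply: leeD; apply: le_trans (measureU2 _ _ _) _ => //; try exact: EC.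
- exact: leeD.
- exact: leeD.
Qed.

End planar_areas.

(** * Cubes in C^n *)

Section polybox.
Context {R : realType}.
Local Notation leb := (@lebesgue_Cn R).

(** Balls are replaced by products of squares because these have an explicit volume by induction on
    [n]; they are comparable up to constants depending on [n]. *)
Definition polybox n (z : Cn R n) (e : R) : set (Cn R n) :=
  [set w | forall j, `|complex.Re (tnth w j - tnth z j)| <= e /\
                     `|complex.Im (tnth w j - tnth z j)| <= e].

Lemma forall_tnth_cons n (P : 'I_n.+1 -> R[i] -> Prop) (x : R[i]) (w : Cn R n) :
  (forall j, P j (tnth (cons_Cn (x, w)) j)) <->
  P ord0 x /\ forall j, P (lift ord0 j) (tnth w j).
Proof.
split=> [h|[h0 h] j].
  by split=> [|j]; [exact: (h ord0)|have := h (lift ord0 j); rewrite tnth_cons_CnS].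
by case: (unliftP ord0 j) => [k|] ->; rewrite ?tnth_cons_CnS// tnth_cons_Cn0.
Qed.

Lemma polybox_cons n (x0 : R[i]) (z : Cn R n) e (x : R[i]) (w : Cn R n) :
  polybox (cons_Cn (x0, z)) e (cons_Cn (x, w)) <->
  (`|complex.Re x - complex.Re x0| <= e /\ `|complex.Im x - complex.Im x0| <= e) /\
  polybox z e w.
Proof.
rewrite /polybox /= (forall_tnth_cons (fun j y =>
  `|complex.Re (y - tnth (cons_Cn (x0, z)) j)| <= e /\
  `|complex.Im (y - tnth (cons_Cn (x0, z)) j)| <= e)) tnth_cons_Cn0.
have -> : complex.Re (x - x0) = complex.Re x - complex.Re x0 by case: x; case: x0.
have -> : complex.Im (x - x0) = complex.Im x - complex.Im x0 by case: x; case: x0.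
split=> -[h1 h2]; split=> // j; first by have := h2 j; rewrite tnth_cons_CnS.
by rewrite tnth_cons_CnS.
Qed.

Definition sqbox (x0 : R[i]) (e : R) : set R[i] :=
  [set x | `[complex.Re x0 - e, complex.Re x0 + e]%classic (complex.Re x) /\
           `[complex.Im x0 - e, complex.Im x0 + e]%classic (complex.Im x)].

Lemma sqboxE x0 e x : sqbox x0 e x <->
  `|complex.Re x - complex.Re x0| <= e /\ `|complex.Im x - complex.Im x0| <= e.
Proof. by rewrite /sqbox /= !in_itv/= !ler_distl. Qed.

Lemma measurable_sqbox x0 e : measurable (sqbox x0 e).
Proof. by apply: measurable_C_rect; exact: measurable_itv. Qed.

Lemma lebesgue_sqbox x0 e : 0 <= e -> lebesgue_C (sqbox x0 e) = (4 * e ^+ 2)%:E.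
Proof.
move=> e0; rewrite lebesgue_C_rect; [|exact: measurable_itv|exact: measurable_itv].
by rewrite !lebesgue_measure_centered_itv// -EFinM; congr EFin; ring.
Qed.

Lemma polyboxE n (x0 : R[i]) (z : Cn R n) e :
  polybox (cons_Cn (x0, z)) e =
  [set w | sqbox x0 e (uncons_Cn w).1 /\ polybox z e (uncons_Cn w).2].
Proof.
apply/seteqP; split=> w; rewrite [w]cons_uncons_Cn; case: (uncons_Cn w) => x w'.
  by move=> /polybox_cons[h1 h2]; rewrite /mkset cons_CnK sqboxE.
by rewrite /mkset cons_CnK sqboxE => h; apply/polybox_cons.
Qed.

Lemma measurable_polybox n (z : Cn R n) e : measurable (polybox z e).
Proof.
elim: n z => [|n IH] z.
  rewrite (_ : polybox z e = setT)//; apply/seteqP; split=> // w _ [] //.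
rewrite [z]cons_uncons_Cn; case: (uncons_Cn z) => x0 z'; rewrite polyboxE.
by apply: measurable_Cn_prod => //; exact: measurable_sqbox.
Qed.

Lemma lebesgue_polybox n (z : Cn R n) e : 0 <= e ->
  leb n (polybox z e) = ((4 * e ^+ 2) ^+ n)%:E.
Proof.
move=> e0; elim: n z => [|n IH] z.
  rewrite (_ : polybox z e = setT); last by apply/seteqP; split=> // w _ [].
  by rewrite /= diracT expr0.
rewrite [z]cons_uncons_Cn; case: (uncons_Cn z) => x0 z'; rewrite polyboxE.
rewrite lebesgue_Cn_prod; [|exact: measurable_sqbox|exact: measurable_polybox].
by rewrite IH lebesgue_sqbox// -EFinM -(exprS (4 * e ^+ 2)).
Qed.

Lemma polybox_sqnorm n (z w : Cn R n) e : 0 <= e -> polybox z e w ->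
  forall j, normc (tnth w j - tnth z j) <= 2 * e.
Proof.
move=> e0 h j; have [h1 h2] := h j.
by apply: le_trans (normc_le_ReIm _) _; lra.
Qed.

Lemma polybox_sqnormB n (z w : Cn R n) e : 0 <= e ->
  (forall j, normc (tnth w j - tnth z j) <= e) -> polybox z e w.
Proof.
move=> e0 h j; split; apply: le_trans (h j); [exact: normr_Re_le|exact: normr_Im_le].
Qed.

End polybox.

(** * Measurability of complex-valued functions *)

Section inner_measurable.
Context {R : realType}.

Lemma measurable_fun_complex d (T : measurableType d) (D : set T) (f : T -> R[i]) :
  measurable D ->
  measurable_fun D (fun x => complex.Re (f x)) ->
  measurable_fun D (fun x => complex.Im (f x)) -> measurable_fun D f.
Proof.
move=> mD /(measurable_restrictT _ mD) mR /(measurable_restrictT _ mD) mI.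
apply: eq_measurable_fun (measurable_funTS (measurableT_comp measurable_complex_of_pair
  (measurable_fun_pair mR mI))) => x xD /=.
by rewrite !patchE xD /complex_of_pair/=; case: (f x).
Qed.

Lemma measurable_fun_Re d (T : measurableType d) (D : set T) (f : T -> R[i]) :
  measurable_fun D f -> measurable_fun D (fun x => complex.Re (f x)).
Proof. exact: (measurableT_comp measurable_Re). Qed.

Lemma measurable_fun_Im d (T : measurableType d) (D : set T) (f : T -> R[i]) :
  measurable_fun D f -> measurable_fun D (fun x => complex.Im (f x)).
Proof. exact: (measurableT_comp measurable_Im). Qed.

Lemma measurable_fun_mulC d (T : measurableType d) (D : set T) (f g : T -> R[i]) :
  measurable D ->
  measurable_fun D f -> measurable_fun D g -> measurable_fun D (fun x => f x * g x).
Proof.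
move=> mD mf mg; apply: measurable_fun_complex => //.
  rewrite (_ : (fun _ => _) = (fun x => complex.Re (f x) * complex.Re (g x) -
      complex.Im (f x) * complex.Im (g x))); last first.
    by apply/funext => x; case: (f x) => ? ?; case: (g x).
  by apply: measurable_funB; apply: measurable_funM;
    do ?[exact: measurable_fun_Re|exact: measurable_fun_Im].
rewrite (_ : (fun _ => _) = (fun x => complex.Re (f x) * complex.Im (g x) +
    complex.Im (f x) * complex.Re (g x))); last first.
  by apply/funext => x; case: (f x) => ? ?; case: (g x) => ? ? /=; ring.
by apply: measurable_funD; apply: measurable_funM;
  do ?[exact: measurable_fun_Re|exact: measurable_fun_Im].
Qed.

Lemma measurable_fun_sumC d (T : measurableType d) (D : set T) (I : Type) (r : seq I)
    (f : I -> T -> R[i]) : measurable D ->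
  (forall i, measurable_fun D (f i)) -> measurable_fun D (fun x => \sum_(i <- r) f i x).
Proof.
move=> mD mf; elim: r => [|i r IH].
  rewrite (_ : (fun _ => _) = cst 0); first exact: measurable_cst.
  by apply/funext => x; rewrite big_nil.
rewrite (_ : (fun _ => _) = (fun x => f i x + \sum_(i <- r) f i x)); last first.
  by apply/funext => x; rewrite big_cons.
apply: measurable_fun_complex => //.
  rewrite (_ : (fun _ => _) = (fun x => complex.Re (f i x) +
      complex.Re (\sum_(i <- r) f i x))); last first.
    by apply/funext => x; case: (f i x) => ? ?; case: (\sum_(_ <- _) _).
  by apply: measurable_funD; exact: measurable_fun_Re.
rewrite (_ : (fun _ => _) = (fun x => complex.Im (f i x) +
    complex.Im (\sum_(i <- r) f i x))); last first.
  by apply/funext => x; case: (f i x) => ? ?; case: (\sum_(_ <- _) _).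
by apply: measurable_funD; exact: measurable_fun_Im.
Qed.

Lemma measurable_fun_conjc d (T : measurableType d) (D : set T) (f : T -> R[i]) :
  measurable D -> measurable_fun D f -> measurable_fun D (fun x => (f x)^*%C).
Proof.
move=> mD mf; apply: measurable_fun_complex => //.
  rewrite (_ : (fun _ => _) = (fun x => complex.Re (f x))).
    exact: measurable_fun_Re.
  by apply/funext => x; case: (f x).
rewrite (_ : (fun _ => _) = (fun x => - complex.Im (f x))); last first.
  by apply/funext => x; case: (f x).
by apply: measurable_funN; exact: measurable_fun_Im.
Qed.

Lemma measurable_normc : measurable_fun [set: R[i]] (@normc R).
Proof.
rewrite (_ : @normc R = (@powR R ^~ 2^-1) \o (fun z => normc z ^+ 2)).
  by apply: measurableT_comp; [exact: measurable_powR|exact: measurable_sqr_normc].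
by apply/funext => z /=; rewrite powR12_sqrt ?sqr_ge0// sqrtr_sqr ger0_norm// normc_ge0.
Qed.

Lemma measurable_inner n :
  measurable_fun [set: Cn R n * Cn R n] (fun x => inner x.1 x.2).
Proof.
apply: measurable_fun_sumC => // j; apply: measurable_fun_mulC => //.
  exact: (measurableT_comp (measurable_tnth j) measurable_fst).
apply: measurable_fun_conjc => //.
exact: (measurableT_comp (measurable_tnth j) measurable_snd).
Qed.

Lemma measurable_1Binner n :
  measurable_fun [set: Cn R n * Cn R n] (fun x => 1 - inner x.1 x.2).
Proof.
apply: measurable_fun_complex => //.
  rewrite (_ : (fun _ => _) = (fun x => 1 - complex.Re (inner x.1 x.2))).
    apply: measurable_funB => //; exact: measurable_fun_Re (@measurable_inner n).
  by apply/funext => x; rewrite Re_1Binner.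
rewrite (_ : (fun _ => _) = (fun x => - complex.Im (inner x.1 x.2))).
  apply: measurable_funN; exact: measurable_fun_Im (@measurable_inner n).
by apply/funext => x; rewrite Im_1Binner.
Qed.

Lemma measurable_innerr n (z : Cn R n) : measurable_fun [set: Cn R n] (inner z).
Proof.
exact: (measurableT_comp (@measurable_inner n) (pair1_measurable z)).
Qed.

End inner_measurable.

(** * Volumes of Carleson boxes, shells and tents *)

Section carleson_boxes.
Context {R : realType}.
Local Notation leb := (@lebesgue_Cn R).

Lemma measurable_section_head n (E : set (Cn R n.+1)) (w : Cn R n) :
  measurable E -> measurable [set x | E (cons_Cn (x, w))].
Proof.
move=> mE; have := measurable_ysection w (measurable_preimage_cons mE).
by congr measurable; apply/seteqP; split => x; rewrite /ysection /= inE.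
Qed.

Lemma measurable_sqnorm_window n (M r : R) :
  measurable [set w : Cn R n | M - r <= sqnorm w < M].
Proof.
rewrite (_ : mkset _ = setT `&` (@sqnorm R n) @^-1` `[M - r, M[%classic).
  exact: measurable_sqnorm.
by rewrite setTI; apply/seteqP; split => w /=; rewrite in_itv.
Qed.

(** The target [zeta] and the level [M] are free so that induction on the dimension is possible:
    fixing the first coordinate x replaces them by zeta - x0 conj(x) and M - |x|^2. The sets needed
    in the end have zeta = M = 1. *)
Definition core n (z : Cn R n) (zeta : R[i]) (e dl M r : R) : set (Cn R n) :=
  [set w | [/\ polybox z e w, normc (inner z w - zeta) <= dl & M - r <= sqnorm w < M]].

Lemma measurable_core n (z : Cn R n) zeta e dl M r : measurable (core z zeta e dl M r).
Proof.
rewrite (_ : core _ _ _ _ _ _ = polybox z e `&` ([set w | M - r <= sqnorm w < M] `&`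
    (setT `&` (fun w => normc (inner z w - zeta)) @^-1` `]-oo, dl]%classic))); last first.
  apply/seteqP; split => w; rewrite setTI /core /= in_itv/=; first by case.
  by case=> ? [].
apply: measurableI; first exact: measurable_polybox.
apply: measurableI; first exact: measurable_sqnorm_window.
have mf : measurable_fun setT (fun w => normc (inner z w - zeta)).
  apply: (measurableT_comp measurable_normc); apply: measurable_fun_complex => //.
    rewrite (_ : (fun _ => _) = (fun w => complex.Re (inner z w) - complex.Re zeta)).
      by apply: measurable_funB => //; exact: measurable_fun_Re (measurable_innerr z).
    by apply/funext => w; case: (inner z w); case: zeta.
  rewrite (_ : (fun _ => _) = (fun w => complex.Im (inner z w) - complex.Im zeta)).
    by apply: measurable_funB => //; exact: measurable_fun_Im (measurable_innerr z).
  by apply/funext => w; case: (inner z w); case: zeta.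
exact: mf.
Qed.

(** Fix the tail w. The head x lies in an annulus, with |x| >= h because |x0| >= 2h and |x - x0| <=
    2e <= h. Two admissible heads satisfy |x0| |x - y| <= 2 dl, hence are at distance at most dl/h,
    and [lebesgue_C_annulus_le] applies. *)
Lemma lebesgue_core_head n (x0 : R[i]) (z : Cn R n) zeta (e dl M r h : R) :
  0 < h -> 0 <= r -> 0 <= dl -> 0 <= e -> 2 * e <= h -> 2 * h <= normc x0 ->
  (leb n.+1 (core (cons_Cn (x0, z)) zeta e dl M r) <=
     (16 * (dl / h) * r / h)%:E * leb n (polybox z e))%E.
Proof.
move=> h0 r0 dl0 e0 eh hx0.
have dh0 : 0 <= dl / h by rewrite divr_ge0// ltW.
have c0 : 0 <= 16 * (dl / h) * r / h by rewrite !(mulr_ge0, invr_ge0)// ltW.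
apply: lebesgue_Cn_le_head => //.
- exact: measurable_core.
- exact: measurable_polybox.
- by move=> x w [/polybox_cons[]].
move=> w _; apply: (@lebesgue_C_annulus_le _ _ (M - sqnorm w)) => //.
- by apply: measurable_section_head; exact: measurable_core.
- by move=> x [_ _]; rewrite sqnorm_cons; lra.
- move=> x [/polybox_cons[[h1 h2] _] _ _].
  have xx0 : normc (x - x0) <= h.
    apply: le_trans (normc_le_ReIm _) _.
    by move: h1 h2; case: x => a b; case: x0 {hx0} => a' b' /=; lra.
  have : normc x0 <= normc x + normc (x - x0).
    by rewrite -(normcN (x - x0)) (le_trans _ (le_normcD _ _))// opprB addrC subrK.
  have := normc_ge0 x; nra.
- move=> x y [_ + _] [_ + _]; rewrite !inner_cons => h1 h2.
  have : normc (x0 * (x - y)^*%C) <= 2 * dl.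
    have -> : x0 * (x - y)^*%C = (x0 * x^*%C + inner z w - zeta) +
        - (x0 * y^*%C + inner z w - zeta) by rewrite rmorphB/=; ring.
    by rewrite (le_trans (le_normcD _ _))// normcN; lra.
  rewrite normcM normcJ ler_pdivlMr//.
  have := normc_ge0 (x - y); nra.
Qed.

(* All coordinates but one are confined to squares of side 2e; the remaining
   one, along which z is large, satisfies the two constraints of
   lebesgue_C_annulus_le. *)
Lemma lebesgue_core_le n (z : Cn R n.+1) zeta (e dl M r h : R) :
  0 < h -> 0 <= r -> 0 <= dl -> 0 <= e -> 2 * e <= h ->
  (exists j, 2 * h <= normc (tnth z j)) ->
  (leb n.+1 (core z zeta e dl M r) <= (16 * (dl / h) * r / h * (4 * e ^+ 2) ^+ n)%:E)%E.
Proof.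
move=> h0 r0 dl0 e0 eh.
have c0 : 0 <= 16 * (dl / h) * r / h by rewrite !(mulr_ge0, invr_ge0)// ltW.
elim: n z zeta M => [|n IH] z zeta M.
  rewrite [z]cons_uncons_Cn; case: (uncons_Cn z) => x0 z' [j].
  rewrite ord1 tnth_cons_Cn0 => hx0.
  by apply: le_trans (lebesgue_core_head _ _ _ _ _ _ _ eh hx0) _ => //;
    rewrite lebesgue_polybox// EFinM.
rewrite [z]cons_uncons_Cn; case: (uncons_Cn z) => x0 z' [j].
case: (unliftP ord0 j) => [k|] ->; last first.
  rewrite tnth_cons_Cn0 => hx0.
  by apply: le_trans (lebesgue_core_head _ _ _ _ _ _ _ eh hx0) _ => //;
    rewrite lebesgue_polybox// EFinM.
rewrite tnth_cons_CnS => hk.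
rewrite exprSr mulrA EFinM -(lebesgue_sqbox x0)//.
apply: lebesgue_Cn_le_tail.
- exact: measurable_core.
- exact: measurable_sqbox.
- by rewrite mulr_ge0// exprn_ge0// mulr_ge0// sqr_ge0.
- by move=> x w [/polybox_cons[? _] _ _]; apply/sqboxE.
(* The large coordinate is in the tail: the head only contributes the area of its square, and the
   tail is again a [core] with shifted parameters. *)
move=> x _; apply: le_trans (IH z' (zeta - x0 * x^*%C) (M - normc x ^+ 2) _).
  2: by exists k.
apply: le_measure.
- rewrite inE; have := measurable_xsection x (measurable_preimage_cons
    (measurable_core (cons_Cn (x0, z')) zeta e dl M r)).
  by congr measurable; apply/seteqP; split => w; rewrite /xsection /= inE.
- by rewrite inE; exact: measurable_core.
move=> w [/polybox_cons[_ h1]]; rewrite inner_cons sqnorm_cons => h2 h3.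
split => //; last by lra.
by apply: le_trans h2; rewrite le_eqVlt; apply/orP; left; apply/eqP; congr normc; ring.
Qed.

Lemma lebesgue_shell_le n (r : R) : 0 < r ->
  (leb n.+1 [set w | (1 - r <= sqnorm w < 1)%R] <= (64 * 4 ^+ n * r)%:E)%E.
Proof.
move=> r0; rewrite mulrAC EFinM.
have -> : (4 ^+ n)%:E = leb n (polybox (nseq_tuple n (0 : R[i])) 1).
  by rewrite lebesgue_polybox// expr1n mulr1.
apply: lebesgue_Cn_le_head.
- exact: measurable_sqnorm_window.
- exact: measurable_polybox.
- by rewrite mulr_ge0 ?ltW.
- move=> x w /= /andP[_ w1]; apply: polybox_sqnormB => // j.
  rewrite tnth_nseq subr0 -(ler_pXn2r (n := 2))// ?nnegrE ?normc_ge0// expr1n.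
  apply: le_trans (sqr_normc_tnth_le w j) _.
  by move: w1; rewrite sqnorm_cons; have := sqr_ge0 (normc x); lra.
move=> w _; set E := mkset _.
have mE : measurable E by apply: measurable_section_head; exact: measurable_sqnorm_window.
pose M := 1 - sqnorm w.
have EM x : E x -> M - r <= normc x ^+ 2 < M.
  by rewrite /E/= sqnorm_cons /M; lra.
(* If M <= 2r the annulus may contain the origin, but the whole disc lies in a square of area 8r. *)
have [Mr|Mr] := leP M (2 * r).
  pose e := Num.sqrt (2 * r).
  have e2 : e ^+ 2 = 2 * r by rewrite sqr_sqrtr// mulr_ge0// ltW.
  have e0 : 0 <= e by exact: sqrtr_ge0.
  apply: (@le_trans _ _ (lebesgue_C (sqbox 0 e))).
    apply: le_measure; rewrite ?inE//; first exact: measurable_sqbox.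
    move=> x /EM h; apply/sqboxE => /=; rewrite !subr0.
    have xe : normc x <= e.
      by rewrite -(ler_pXn2r (n := 2))// ?nnegrE ?normc_ge0// e2; lra.
    by split; apply: le_trans xe; [exact: normr_Re_le|exact: normr_Im_le].
  by rewrite lebesgue_sqbox// e2 lee_fin; lra.
(* Now |x|^2 >= M - r >= (m/2)^2 and the diameter is at most 2m, so the annulus bound is 16 (2m) r /
   (m/2) = 64 r, whence the constant. *)
pose m := Num.sqrt M.
have M0 : 0 < M by lra.
have m0 : 0 < m by rewrite sqrtr_gt0.
have m2 : m ^+ 2 = M by rewrite sqr_sqrtr// ltW.
apply: (@le_trans _ _ (16 * (2 * m) * r / (m / 2))%:E); last first.
  rewrite lee_fin le_eqVlt; apply/orP; left; apply/eqP; field.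
  by rewrite gt_eqF.
apply: (@lebesgue_C_annulus_le _ _ M) => //.
- by rewrite divr_gt0.
- exact: ltW.
- by rewrite mulr_ge0// ltW.
- by move=> x /EM h; rewrite exprMn m2; lra.
- move=> x y /EM hx /EM hy; rewrite (le_trans (le_normcD _ _))// normcN.
  have xm : normc x <= m.
    by rewrite -(ler_pXn2r (n := 2))// ?nnegrE ?normc_ge0 ?ltW// m2; lra.
  have ym : normc y <= m.
    by rewrite -(ler_pXn2r (n := 2))// ?nnegrE ?normc_ge0 ?ltW// m2; lra.
  by lra.
Qed.

Lemma measurable_carleson n (z : Cn R n) (dl r : R) :
  measurable [set w | [/\ unit_ball R n w, normc (1 - inner z w) <= dl &
    1 - sqnorm w <= r]].
Proof.
rewrite (_ : mkset _ = unit_ball R n `&` ((setT `&`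
    (fun w => normc (1 - inner z w)) @^-1` `]-oo, dl]%classic) `&`
   (setT `&` (@sqnorm R n) @^-1` `[1 - r, +oo[%classic))); last first.
  apply/seteqP; split => w; rewrite !setTI /= !in_itv/= andbT.
    by case=> ? ? ?; split => //; split => //; lra.
  by case=> ? [? ?]; split => //; lra.
apply: measurableI; first exact: measurable_unit_ball.
apply: measurableI; last exact: measurable_sqnorm.
have mf : measurable_fun setT (fun w => normc (1 - inner z w)).
  apply: (measurableT_comp measurable_normc).
  exact: (measurableT_comp (@measurable_1Binner R n) (pair1_measurable z)).
exact: mf.
Qed.

(** For small [dl] the set lies in a [core] of half-side sqrt(2 dl) by [sqr_normcB_le]; for [dl]
    bounded below the shell estimate is enough. *)
Lemma lebesgue_carleson_le n : exists2 K : R, 0 < K &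
  forall (z : Cn R n.+1) (dl r : R), unit_ball R n.+1 z -> 0 < dl -> 0 < r ->
  (leb n.+1 [set w | [/\ unit_ball R n.+1 w, normc (1 - inner z w) <= dl &
    1 - sqnorm w <= r]%R] <= (K * dl ^+ n.+1 * r)%:E)%E.
Proof.
(* [h] is such that (n+1) (2h)^2 = h <= 1/4, which will force a coordinate of z of modulus at least
   2h; [d0] then ensures 2 sqrt(2 dl) <= h. *)
pose h : R := (4 * n.+1%:R)^-1.
have N1 : 1 <= n.+1%:R :> R by rewrite ler1n.
have h0 : 0 < h by rewrite invr_gt0 mulr_gt0 ?ltr0n.
have hN : h * n.+1%:R = 1 / 4.
  by rewrite /h invfM -mulrA mulVf ?gt_eqF ?ltr0n// mulr1 mul1r.
have h1 : h <= 1 by nra.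
pose d0 : R := h ^+ 2 / 8.
have d00 : 0 < d0 by rewrite divr_gt0// exprn_gt0.
pose K1 : R := 16 / h ^+ 2 * 8 ^+ n.
pose K2 : R := 64 * 4 ^+ n / d0 ^+ n.+1.
have K10 : 0 <= K1 by rewrite !(mulr_ge0, invr_ge0, exprn_ge0)// ltW.
have K20 : 0 < K2 by rewrite divr_gt0 ?exprn_gt0// mulr_gt0// exprn_gt0.
exists (K1 + K2); first by rewrite ltr_wpDl.
move=> z dl r z1 dl0 r0; have dln0 : 0 < dl ^+ n.+1 by rewrite exprn_gt0.
(* When dl > d0 the constraint on <z,w> is dropped; the power of [d0] in [K2] makes up for the
   factor dl^(n+1). *)
have [dld0|d0dl] := leP dl d0; last first.
  apply: (@le_trans _ _ (64 * 4 ^+ n * r)%:E).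
    apply: le_trans (lebesgue_shell_le n r0); apply: le_measure; rewrite ?inE.
    - exact: measurable_carleson.
    - exact: measurable_sqnorm_window.
    - by move=> w [w1 _ wr] /=; move: w1; rewrite /unit_ball /=; lra.
  rewrite lee_fin ler_wpM2r ?(ltW r0)//.
  apply: (@le_trans _ _ (K2 * dl ^+ n.+1)); last first.
    by rewrite ler_wpM2r ?(ltW dln0)// lerDr.
  rewrite /K2 -(mulrA (64 * 4 ^+ n)) ler_peMr ?mulr_ge0 ?exprn_ge0//.
  by rewrite mulrC ler_pdivlMr ?exprn_gt0// mul1r lerXn2r// ?nnegrE ltW.
pose e := Num.sqrt (2 * dl).
have e2 : e ^+ 2 = 2 * dl by rewrite sqr_sqrtr// mulr_ge0// ltW.
have e0 : 0 <= e by exact: sqrtr_ge0.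
have eh : 2 * e <= h.
  rewrite -(ler_pXn2r (n := 2))// ?nnegrE ?mulr_ge0 ?(ltW h0)// exprMn e2.
  by move: dld0; rewrite /d0; lra.
set E := mkset _.
have [->|/set0P[w0 [w01 w0d w0r]]] := eqVneq E set0.
  rewrite measure0 lee_fin; apply: mulr_ge0 (ltW r0); apply: mulr_ge0 (ltW dln0).
  by apply: addr_ge0 => //; exact: ltW.
(* The point [w0] gives |<z,w0>| >= 7/8, while the weight 2 in [normc_inner_le] gives |<z,w0>| <=
   |z|^2 + 1/4. *)
have zq : 1 / 4 < sqnorm z.
  have := ge_normc_1Binner z w0.
  have := @normc_inner_le R _ 2 z w0 (ltr0Sn _ 1).
  move: w01 z1; rewrite /unit_ball /= => ? ? ? ?.
  have : dl <= 1 / 8 by apply: le_trans dld0 _; rewrite /d0; nra.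
  by lra.
have [j hj] : exists j, 2 * h <= normc (tnth z j).
  apply/existsP; rewrite -[X in is_true X]negbK negb_exists; apply/negP => /forallP nz.
  suff : sqnorm z <= 1 / 4 by lra.
  rewrite /sqnorm; apply: (@le_trans _ _ (\sum_(j < n.+1) 4 * h ^+ 2)).
    apply: ler_sum => j _; have := nz j; rewrite -ltNge => hj.
    have := normc_ge0 (tnth z j); nra.
  rewrite sumr_const card_ord -mulr_natr; nra.
apply: (@le_trans _ _ (leb n.+1 (core z 1 e dl 1 r))).
  apply: le_measure; rewrite ?inE; [exact: measurable_carleson|exact: measurable_core|].
  move=> w [w1 wd wr]; split.
  - apply: polybox_sqnormB => // k.
    rewrite -(ler_pXn2r (n := 2))// ?nnegrE ?normc_ge0// e2.
    by apply: le_trans (sqr_normcB_le k z1 w1) _; rewrite ler_pM2l.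
  - by rewrite -normcN opprB.
  - by move: w1; rewrite /unit_ball /=; lra.
have := @lebesgue_core_le n z 1 e dl 1 r h h0 (ltW r0) (ltW dl0) e0 eh (ex_intro _ j hj).
move=> /le_trans; apply.
rewrite lee_fin e2.
apply: (@le_trans _ _ (K1 * dl ^+ n.+1 * r)).
  rewrite le_eqVlt; apply/orP; left; apply/eqP.
  rewrite /K1 (_ : 4 * (2 * dl) = 8 * dl); last by ring.
  rewrite exprMn [dl ^+ n.+1]exprS; move: (8 ^+ n) (dl ^+ n) => X Y; field.
  by rewrite gt_eqF.
by rewrite ler_wpM2r ?(ltW r0)// ler_wpM2r ?(ltW dln0)// lerDl ltW.
Qed.

End carleson_boxes.

(** * Lower volume bounds: shells, and boxes near e_1 *)

Section lower_bounds.
Context {R : realType}.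
Local Notation leb := (@lebesgue_Cn R).

Lemma polybox0_sqnorm n (e : R) (w : Cn R n) : 0 <= e ->
  polybox (nseq_tuple n 0) e w -> sqnorm w <= n%:R * (4 * e ^+ 2).
Proof.
move=> e0 /polybox_sqnorm => /(_ e0) h.
rewrite /sqnorm (_ : _ * _ = \sum_(j < n) (4 * e ^+ 2)).
  apply: ler_sum => j _; have := h j; rewrite tnth_nseq subr0.
  have := normc_ge0 (tnth w j); nra.
by rewrite sumr_const card_ord mulr_natl.
Qed.

(** Tails in a small cube have |w|^2 <= 1/4; for each of them and each imaginary part y in [0, 1/4]
    of the head, the admissible real parts contain an interval of length r/4. The shell stops at 1 -
    r/2, away from the sphere, so that shells at dyadic [r] are disjoint. *)
Lemma lebesgue_shell_ge n : exists2 K : R, 0 < K & forall r : R, 0 < r <= 1 / 4 ->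
  ((K * r)%:E <= leb n.+1 [set w | (1 - r / 2 - r / 2 <= sqnorm w < 1 - r / 2)%R])%E.
Proof.
pose e : R := (4 * n.+1%:R)^-1.
have N1 : 1 <= n.+1%:R :> R by rewrite ler1n.
have e0 : 0 < e by rewrite invr_gt0 mulr_gt0 ?ltr0n.
have eN : e * n.+1%:R = 1 / 4.
  by rewrite /e invfM -mulrA mulVf ?gt_eqF ?ltr0n// mulr1 mul1r.
exists (1 / 16 * (4 * e ^+ 2) ^+ n).
  by rewrite mulr_gt0// exprn_gt0// mulr_gt0// exprn_gt0.
move=> r /andP[r0 r4].
rewrite (_ : (_ * r)%:E = ((r / 16)%:E * leb n (polybox (nseq_tuple n (0%R : R[i])) e))%E); last first.
  by rewrite lebesgue_polybox ?ltW// -EFinM; congr EFin; ring.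
apply: lebesgue_Cn_ge_head.
- exact: measurable_sqnorm_window.
- exact: measurable_polybox.
- by rewrite divr_ge0 ?ltW.
move=> w /(polybox0_sqnorm (ltW e0)) wq.
have {wq}w4 : sqnorm w <= 1 / 4.
  apply: le_trans wq _; apply: (@le_trans _ _ (n.+1%:R * (4 * e ^+ 2))).
    by apply: ler_wpM2r; [rewrite mulr_ge0// sqr_ge0|rewrite ler_nat].
  nra.
have w0 := sqnorm_ge0 w.
rewrite (_ : r / 16 = r / 4 * (1 / 4)); last by lra.
rewrite EFinM (_ : (1 / 4)%:E = @lebesgue_measure R `[0, 1 / 4]%classic); last first.
  by rewrite lebesgue_measure_itv/= lte_fin ifT; [rewrite -EFinB subr0|lra].
apply: lebesgue_C_ge.
- by apply: measurable_section_head; exact: measurable_sqnorm_window.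
- exact: measurable_itv.
- by rewrite divr_ge0 ?ltW.
move=> y /=; rewrite in_itv/= => /andP[y0 y4].
pose m := 1 - sqnorm w - y ^+ 2.
have m1 : 1 / 2 <= m by rewrite /m; nra.
have m2 : m <= 1 by rewrite /m; nra.
(* (b - a)(b + a) = r/2 and a + b <= 2, so b - a >= r/4; the roots are genuine because r <= 1/4 <=
   m. *)
pose a := Num.sqrt (m - r); pose b := Num.sqrt (m - r / 2).
have a2 : a ^+ 2 = m - r by rewrite sqr_sqrtr//; lra.
have b2 : b ^+ 2 = m - r / 2 by rewrite sqr_sqrtr//; lra.
have a0 : 0 <= a by exact: sqrtr_ge0.
have b0 : 0 <= b by exact: sqrtr_ge0.
have ab : r / 4 <= b - a.
  have a1 : a <= 1 by nra.
  have b1 : b <= 1 by nra.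
  have : a < b by nra.
  nra.
apply: (@le_trans _ _ (@lebesgue_measure R `[a, b[%classic)).
  by rewrite lebesgue_measure_itv/= lte_fin ifT -?EFinD ?lee_fin//; lra.
apply: le_measure; rewrite ?inE.
- exact: measurable_itv.
- exact: (measurable_section_Im y
    (measurable_section_head w (@measurable_sqnorm_window R n.+1 (1 - r / 2) (r / 2)))).
- move=> x /=; rewrite in_itv/= sqnorm_cons sqr_normcE/= => /andP[ax xb].
  have : x ^+ 2 < b ^+ 2 by nra.
  have : a ^+ 2 <= x ^+ 2 by nra.
  by rewrite a2 b2 /m; lra.
Qed.

(* A neighbourhood of (1 - O(dl)) e_1 of volume comparable to dl^(n+1), on which
   1 - <z,w> has size dl and stays in a narrow sector around the positive axis. *)
Definition tentbox n (eta dl : R) : set (Cn R n.+1) :=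
  [set w | [set x | `[1 - 2 * dl, 1 - dl[%classic (complex.Re x) /\
                    `[0 - eta * dl, 0 + eta * dl]%classic (complex.Im x)] (uncons_Cn w).1 /\
           polybox (nseq_tuple n 0) (Num.sqrt (eta / (8 * n.+1%:R) * dl)) (uncons_Cn w).2].

Lemma measurable_tentbox n (eta dl : R) : measurable (@tentbox n eta dl).
Proof.
apply: measurable_Cn_prod; last exact: measurable_polybox.
by apply: measurable_C_rect; exact: measurable_itv.
Qed.

Lemma lebesgue_tentbox n (eta : R) : 0 < eta -> exists2 K : R, 0 < K & forall dl : R, 0 < dl ->
  leb n.+1 (@tentbox n eta dl) = (K * dl ^+ n.+2)%:E.
Proof.
move=> eta0; pose k := eta / (8 * n.+1%:R).
have k0 : 0 < k by rewrite divr_gt0// mulr_gt0// ltr0n.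
exists (2 * eta * (4 * k) ^+ n).
  by rewrite !mulr_gt0// exprn_gt0// mulr_gt0.
move=> dl dl0; rewrite lebesgue_Cn_prod; last 2 first.
- by apply: measurable_C_rect; exact: measurable_itv.
- exact: measurable_polybox.
rewrite lebesgue_C_rect; [|exact: measurable_itv|exact: measurable_itv].
rewrite lebesgue_polybox ?sqrtr_ge0// sqr_sqrtr; last by rewrite mulr_ge0 ?ltW.
rewrite lebesgue_measure_centered_itv; last by rewrite mulr_ge0 ?ltW.
rewrite lebesgue_measure_itv/= lte_fin ifT; last by lra.
rewrite -EFinB -!EFinM -/k; congr EFin.
rewrite mulrA [in LHS]exprMn [in RHS]exprMn exprMn !exprS; ring.
Qed.

(** The half-side of the cube in [tentbox] is tuned to the last bound: n times 4 eta dl / (8 (n+1))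
    is at most eta dl / 2. *)
Lemma tentboxE n (eta dl : R) (w : Cn R n.+1) : 0 < eta -> 0 < dl -> tentbox eta dl w ->
  exists x y w', [/\ w = cons_Cn ((x +i* y)%C, w'), 1 - 2 * dl <= x < 1 - dl,
    - (eta * dl) <= y <= eta * dl & sqnorm w' <= eta * dl / 2].
Proof.
move=> eta0 dl0; rewrite [w]cons_uncons_Cn; case: (uncons_Cn w) => -[x y] w'.
rewrite /tentbox /mkset cons_CnK /= !in_itv/= ?(add0r, sub0r).
move=> [[hx hy] /(polybox0_sqnorm (sqrtr_ge0 _)) hw]; exists x, y, w'; split => //.
apply: le_trans hw _; rewrite sqr_sqrtr; last first.
  by rewrite !(mulr_ge0, invr_ge0) ?ltW.
have N0 : 0 < n.+1%:R :> R by rewrite ltr0n.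
have nN : n%:R <= n.+1%:R :> R by rewrite ler_nat.
rewrite -(@ler_pM2r _ n.+1%:R)//.
rewrite (_ : _ * n.+1%:R = n%:R * (eta * dl / 2)); last by field; rewrite gt_eqF.
by rewrite [leRHS]mulrC ler_wpM2r// divr_ge0// mulr_ge0 ?ltW.
Qed.

Lemma tentbox_defect n (eta dl : R) (w : Cn R n.+1) : 0 < eta <= 1 / 8 -> 0 < dl <= 1 / 8 ->
  tentbox eta dl w -> unit_ball R n.+1 w /\ dl / 2 <= 1 - sqnorm w <= 4 * dl.
Proof.
move=> /andP[eta0 eta1] /andP[dl0 dl1] /(tentboxE eta0 dl0)[x [y [w' [-> hx hy hw]]]].
rewrite /unit_ball /mkset sqnorm_cons sqr_normcE/=.
have w0 := sqnorm_ge0 w'.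
have ed : eta * dl <= dl / 8 by nra.
have y2 : y ^+ 2 <= dl / 8 by nra.
have y0 := sqr_ge0 y.
have x1 : 1 - 4 * dl <= x ^+ 2 by nra.
have x2 : x ^+ 2 <= 1 - dl by nra.
by split; [lra|apply/andP; split; lra].
Qed.

(** The coarser scale [dl] dictates the size: the real part is 1 - x x' up to terms of order eta dl,
    hence at least dl/2, and the imaginary part is at most 3 eta dl, whence the slope 6 eta. Two
    different scales are allowed so that one fine box for z can face boxes of all coarser scales for
    w. *)
Lemma tentbox_inner n (eta dl dl' : R) (z w : Cn R n.+1) :
  0 < eta <= 1 / 8 -> 0 < dl <= 1 / 8 -> 0 < dl' <= dl ->
  tentbox eta dl' z -> tentbox eta dl w ->
  [/\ `|complex.Im (1 - inner z w)| <= 6 * eta * complex.Re (1 - inner z w),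
      dl / 2 <= normc (1 - inner z w) & normc (1 - inner z w) <= 6 * dl].
Proof.
move=> /andP[eta0 eta1] /andP[dl0 dl1] /andP[dl'0 dl'1].
move=> /(tentboxE eta0 dl'0)[x [y [z' [-> hx hy hz]]]].
move=> /(tentboxE eta0 dl0)[x' [y' [w' [-> hx' hy' hw]]]].
have ed : eta * dl <= dl / 8 by nra.
have ed' : eta * dl' <= eta * dl by nra.
have iw : normc (inner z' w') <= eta * dl.
  have := @normc_inner_le _ _ 1 z' w' ltr01.
  by have := sqnorm_ge0 z'; have := sqnorm_ge0 w'; lra.
have iR := le_trans (normr_Re_le _) iw.
have iI := le_trans (normr_Im_le _) iw.
rewrite !ler_norml in iR iI.
have yy : - (eta * dl) <= y * y' <= eta * dl.
  by apply/andP; split; nra.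
have xx1 : dl <= 1 - x * x' by nra.
have xx2 : 1 - x * x' <= 4 * dl by nra.
have xy : - (eta * dl) <= x * y' <= eta * dl by apply/andP; split; nra.
have yx : - (eta * dl) <= y * x' <= eta * dl by apply/andP; split; nra.
have ReE : complex.Re (1 - inner (cons_Cn ((x +i* y)%C, z')) (cons_Cn ((x' +i* y')%C, w'))) =
    1 - x * x' - y * y' - complex.Re (inner z' w').
  by rewrite Re_1Binner inner_cons; case: (inner z' w') => a b /=; ring.
have ImE : complex.Im (1 - inner (cons_Cn ((x +i* y)%C, z')) (cons_Cn ((x' +i* y')%C, w'))) =
    x * y' - y * x' - complex.Im (inner z' w').
  by rewrite Im_1Binner inner_cons; case: (inner z' w') => a b /=; ring.
have I3 : `|complex.Im (1 - inner (cons_Cn ((x +i* y)%C, z')) (cons_Cn ((x' +i* y')%C, w')))| <= 3 * (eta * dl).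
  by rewrite ImE ler_norml; apply/andP; split; lra.
have R1 : dl / 2 <= complex.Re (1 - inner (cons_Cn ((x +i* y)%C, z')) (cons_Cn ((x' +i* y')%C, w'))).
  by rewrite ReE; lra.
have R2 : complex.Re (1 - inner (cons_Cn ((x +i* y)%C, z')) (cons_Cn ((x' +i* y')%C, w'))) <= 5 * dl.
  by rewrite ReE; lra.
split.
- by apply: le_trans I3 _; nra.
- apply: le_trans (normr_Re_le _); exact: le_trans R1 (ler_norm _).
- apply: le_trans (normc_le_ReIm _) _; rewrite ger0_norm; lra.
Qed.

End lower_bounds.

(** * The Forelli-Rudin integral *)

Section Gamma_positive.
Context {R : realType}.
Local Notation leb := (@lebesgue_measure R).

Let f (x t : R) := t `^ (x - 1) * expR (- t).

Let mf x : measurable_fun setT (f x).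
Proof.
apply: measurable_funM; first exact: measurable_powR.
by apply: (measurableT_comp (@measurable_expR R)); exact: measurable_funN.
Qed.

Let mfE x (D : set R) : measurable_fun D (fun t => (f x t)%:E).
Proof. by apply/measurable_EFinP; exact: measurable_funTS (mf x). Qed.

Let f0 x t : 0 <= f x t. Proof. by rewrite mulr_ge0 ?powR_ge0 ?expR_ge0. Qed.

Let lebesgue_itv_le (D : set R) (r : R) : measurable D -> 0 < r ->
  D `<=` `]0, r]%classic -> (leb D <= (1 * r `^ 1)%:E)%E.
Proof.
move=> mD r0 Dr; apply: (@le_trans _ _ (leb `]0, r]%classic)).
  by apply: le_measure => //; rewrite inE//; exact: measurable_itv.
by rewrite lebesgue_measure_itv/= lte_fin r0 -EFinB subr0 mul1r powRr1// ltW.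
Qed.

(** Finiteness matters for positivity: [Gamma] is the [fine] of this integral, which would be 0 if
    it were infinite. Near 0 the integrand is at most t^(x-1), with x - 1 > -1. *)
Let Gamma_integral_lty x : 0 < x -> (\int[leb]_(t in `]0%R, +oo[) (f x t)%:E < +oo)%E.
Proof.
move=> x0; have -> : `]0%R, +oo[%classic = `]0%R, 1%R] `|` `]1%R, +oo[ :> set R.
  apply/seteqP; split => t /=; rewrite !in_itv/= !andbT.
    by move=> t0; case: (leP t 1) => ht; [left; rewrite t0|right].
  by case=> [/andP[]//|]; apply: lt_trans.
rewrite ge0_integral_setU//; first last.
- by apply/disj_setPS => t /=; rewrite !in_itv/=; lra.
- by move=> t _; rewrite lee_fin.
- exact: mfE.
rewrite lte_add_pinfty//.
- apply: (@le_lt_trans _ _ (\int[leb]_(t in `]0%R, 1%R]) (t `^ (- (1 - x)))%:E)%E).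
    apply: ge0_le_integral => //.
    + by move=> t _; rewrite lee_fin.
    + exact: mfE.
    + by apply/measurable_EFinP; apply: measurable_funTS; exact: measurable_powR.
    + move=> t; rewrite /= in_itv/= => /andP[t0 t1]; rewrite lee_fin /f opprB.
      by rewrite ler_piMr ?powR_ge0// -expR0 ler_expR; lra.
  apply: le_lt_trans (@integral_powR_small _ _ _ leb `]0%R, 1%R]%classic id 1 1 (1 - x) 1
    _ _ _ _ _ _ _) (ltry _) => //.
  + move=> r /andP[r0 r1]; apply: lebesgue_itv_le => //.
      apply: measurableI; first exact: measurable_itv.
      rewrite (_ : mkset _ = `]-oo, r]%classic); first exact: measurable_itv.
      by apply/seteqP; split => t /=; rewrite in_itv.
    by move=> t /= []; rewrite !in_itv/=; lra.
  + by lra.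
(* With k >= x + 1 and t >= 1, t^(x+1) <= t^k <= k! e^t, so the integrand is at most k! t^(-2). *)
- pose k := (Num.bound (x + 1)).+1.
  have xk : x + 1 <= k%:R.
    apply: le_trans (ltW (archi_boundP _)) _; first by lra.
    by rewrite ler_nat.
  apply: (@le_lt_trans _ _ (\int[leb]_(t in `]1%R, +oo[) ((k`!%:R)%:E * (t `^ (- 2))%:E))%E).
    apply: ge0_le_integral => //.
    + by move=> t _; rewrite lee_fin.
    + exact: mfE.
    + apply/measurable_EFinP; apply: measurable_funTS; apply: measurable_funM => //.
    + move=> t; rewrite /= in_itv/= andbT => t1; have t0 : 0 < t by lra.
      rewrite -EFinM lee_fin /f expRN ler_pdivrMr ?expR_gt0//.
      rewrite (_ : x - 1 = - 2 + (x + 1)); last by lra.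
      rewrite powRD_gt0// [_%:R * _]mulrC -mulrA ler_wpM2l ?powR_ge0//.
      apply: (@le_trans _ _ (t `^ k%:R)); first by apply: ler_powR => //; lra.
      rewrite powR_mulrn ?(ltW t0)// -ler_pdivrMl ?ltr0n ?fact_gt0// mulrC.
      by apply: le_trans (expR_ge1Dxn (Num.bound (x + 1)) (ltW t0)); rewrite ler_wpDl.
  rewrite ge0_integralZl//; last 2 first.
  - by apply/measurable_EFinP; apply: measurable_funTS; exact: measurable_powR.
  - by move=> t _; rewrite lee_fin powR_ge0.
  rewrite lte_mul_pinfty//.
  apply: le_lt_trans (@integral_powR_large _ _ _ leb `]1%R, +oo[%classic id 1 1 2 1
    _ _ _ _ _ _ _) (ltry _) => //.
  + by move=> t /=; rewrite in_itv/= andbT => /ltW.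
  + move=> r r0; apply: lebesgue_itv_le => //.
      apply: measurableI; first exact: measurable_itv.
      rewrite (_ : mkset _ = `]-oo, r]%classic); first exact: measurable_itv.
      by apply/seteqP; split => t /=; rewrite in_itv.
    by move=> t /= []; rewrite !in_itv/=; lra.
  + by lra.
Qed.

Lemma Gamma_gt0 (x : R) : 0 < x -> 0 < Gamma x.
Proof.
move=> x0; rewrite /Gamma /Rintegral; apply: fine_gt0; apply/andP; split; last first.
  exact: Gamma_integral_lty.
(* A lower bound of the integrand on [1, 2], where t is within a factor 2 of 1. *)
pose c : R := (2 `^ `|x - 1|)^-1 * expR (- 2).
have c0 : 0 < c by rewrite mulr_gt0 ?invr_gt0 ?powR_gt0 ?expR_gt0.
apply: (@lt_le_trans _ _ (\int[leb]_(t in `[1%R, 2%R]) (cst c%:E t))%E).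
  rewrite integral_cst; last exact: measurable_itv.
  suff : (0 < c%:E * leb `[1%R, 2%R]%classic)%E by [].
  rewrite lebesgue_measure_itv/= lte_fin ifT; last by lra.
  by rewrite -EFinB -EFinM lte_fin; lra.
apply: (@le_trans _ _ (\int[leb]_(t in `[1%R, 2%R]) (f x t)%:E)%E).
  apply: ge0_le_integral => //.
  - by move=> t _; rewrite lee_fin ltW.
  - exact: mfE.
  - move=> t; rewrite /= in_itv/= => /andP[t1 t2].
    rewrite lee_fin ler_pM ?invr_ge0 ?powR_ge0 ?expR_ge0//; last first.
      by rewrite ler_expR; lra.
    have := @powR_comparable R 2 t 1 (x - 1); rewrite powR1 => h.
    rewrite -[leLHS]mulr1 mulrC ler_pdivrMr ?powR_gt0// mulrC.
    by apply: h; lra.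
apply: ge0_subset_integral => //; first exact: mfE.
  by move=> t _; rewrite lee_fin.
by move=> t; rewrite /= !in_itv/= andbT; lra.
Qed.

Lemma c_gt0 n (s : R) : -1 < s -> 0 < c_ n s.
Proof.
move=> s1; have n0 : 0 <= n%:R :> R by [].
rewrite /c_ divr_gt0 ?mulr_gt0 ?ltr0n ?fact_gt0 ?Gamma_gt0//; lra.
Qed.

End Gamma_positive.

Section volume_bounds.
Context {R : realType}.
Local Notation leb := (@lebesgue_Cn R).
Local Notation ball n := (unit_ball R n).

(** The ball is inside a cube and contains a shell. Both facts are needed for [volume] to be a
    genuine normalization, since it inverts a [fine]. *)
Lemma unit_ball_lebesgue n : exists2 V : R, 0 < V & leb n.+1 (ball n.+1) = V%:E.
Proof.
have fin : (leb n.+1 (ball n.+1) <= (4 ^+ n.+1)%:E)%E.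
  have <- : leb n.+1 (polybox (nseq_tuple n.+1 (0 : R[i])) 1) = (4 ^+ n.+1)%:E.
    by rewrite lebesgue_polybox// expr1n mulr1.
  apply: le_measure; rewrite ?inE; [exact: measurable_unit_ball|exact: measurable_polybox|].
  move=> w; rewrite /unit_ball /= => w1; apply: polybox_sqnormB => // j.
  rewrite tnth_nseq subr0 -(ler_pXn2r (n := 2))// ?nnegrE ?normc_ge0// expr1n.
  by apply: le_trans (sqr_normc_tnth_le w j) _; exact: ltW.
have [K K0 /(_ (1 / 4))] := @lebesgue_shell_ge R n.
have -> : 0 < 1 / 4 :> R by lra.
move=> /(_ (lexx _)) Kle.
have pos : (0 < leb n.+1 (ball n.+1))%E.
  apply: lt_le_trans (le_trans Kle _); first by rewrite lte_fin; lra.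
  apply: le_measure; rewrite ?inE; [exact: measurable_sqnorm_window|exact: measurable_unit_ball|].
  by move=> w /=; rewrite /unit_ball /=; lra.
by case: (leb n.+1 (ball n.+1)) fin pos => [v| |]// _; rewrite lte_fin => v0; exists v.
Qed.

Let volumeE n (V : R) : leb n.+1 (ball n.+1) = V%:E -> forall A : set (Cn R n.+1),
  volume R n.+1 A = (V^-1%:E * leb n.+1 (A `&` ball n.+1))%E.
Proof. by move=> VE A; rewrite {1}/volume /= /mscale /mrestr /= VE. Qed.

Lemma volume_lebesgue n : exists2 K : R, 0 < K & forall A : set (Cn R n.+1),
  volume R n.+1 A = (K%:E * leb n.+1 (A `&` ball n.+1))%E.
Proof.
have [V V0 VE] := unit_ball_lebesgue n.
by exists V^-1; [rewrite invr_gt0|exact: volumeE].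
Qed.

Lemma volumeT n : volume R n.+1 setT = 1%E.
Proof.
have [V V0 VE] := unit_ball_lebesgue n.
have VV : (V^-1%:E * V%:E)%E = 1%E by rewrite -EFinM mulVf ?gt_eqF.
by have := volumeE VE setT; rewrite setTI; move: (leb _ _) VE => x ->; rewrite VV.
Qed.

Lemma measurable_defect_powR n (D : set (Cn R n)) (s : R) :
  measurable_fun D (fun w => (1 - sqnorm w) `^ s).
Proof.
apply: measurable_funTS; apply: (measurableT_comp (measurable_powR s)).
by apply: measurable_funB => //; exact: measurable_sqnorm.
Qed.

Lemma measurable_kernel_powR n (D : set (Cn R n)) (z : Cn R n) (s : R) :
  measurable_fun D (fun w => normc (1 - inner z w) `^ s).
Proof.
apply: measurable_funTS; apply: (measurableT_comp (measurable_powR s)).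
apply: (measurableT_comp measurable_normc).
exact: (measurableT_comp (@measurable_1Binner R n) (pair1_measurable z)).
Qed.

Lemma integral_weighted_volume n (s : R) (D : set (Cn R n)) (f : Cn R n -> R) :
  measurable D -> measurable_fun D f -> (forall w, D w -> 0 <= f w) ->
  (\int[weighted_volume s]_(w in D) (f w)%:E =
   \int[volume R n]_(w in D) (f w * (c_ n s * (1 - sqnorm w) `^ s))%:E)%E.
Proof.
move=> mD mf f0; rewrite integral_mkcond [RHS]integral_mkcond.
rewrite (ge0_integral_density (mu := volume R n)
  (g := fun w : Cn R n => c_ n s * (1 - sqnorm w) `^ s)).
- apply: eq_integral => w _; rewrite !patchE; case: ifPn => _; first by rewrite -EFinM.
  by rewrite mul0e.
- by apply: measurable_funM => //; exact: measurable_defect_powR.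
- by move=> w; rewrite mulr_ge0 ?powR_ge0 ?c_ge0.
- by move=> A mA.
- by apply/(measurable_restrictT _ mD)/measurable_EFinP.
- by move=> w; rewrite patchE; case: ifPn => // /set_mem Dw; rewrite lee_fin f0.
Qed.

(** [integral_powR_small] for the function 1 - |w|^2, whose sublevel sets have volume of order
    dl^(n+1) r: here q = 1, t = -s, and -1 < s is the condition t < q. The constraint 1 - |w|^2 <= 2
    dl follows from the previous one by [defect_le_w]; stating it provides the cutoff. *)
Lemma integral_defect_carleson_le n (s : R) : -1 < s -> exists2 K : R, 0 < K &
  forall (z : Cn R n.+1) (dl : R), ball n.+1 z -> 0 < dl ->
  (\int[volume R n.+1]_(w in [set w | [/\ ball n.+1 w, (normc (1 - inner z w) <= dl)%R &
      (1 - sqnorm w <= 2 * dl)%R]]) ((1 - sqnorm w) `^ s)%:E <=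
   (K * dl `^ (n.+1%:R + 1 + s))%:E)%E.
Proof.
move=> s1; have [K1 K10 K1P] := volume_lebesgue n.
have [K2 K20 K2P] := @lebesgue_carleson_le R n.
pose K3 : R := 2 `^ `|- s| / (1 - 2^-1 `^ (1 - - s)).
have r1 : 0 < 1 - 2^-1 `^ (1 - - s) :> R.
  rewrite subr_gt0 /powR gt_eqF// lnV ?posrE// expR_lt1 mulrN oppr_lt0.
  by rewrite mulr_gt0 ?ln_gt0 ?ltr1n//; lra.
have K30 : 0 < K3 by rewrite divr_gt0 ?powR_gt0.
exists (K3 * (K1 * K2) * 2 `^ (1 + s)).
  by apply: mulr_gt0; [apply: mulr_gt0 => //; exact: mulr_gt0|exact: powR_gt0].
move=> z dl z1 dl0.
set D := mkset _.
have := @integral_powR_small _ _ _ (volume R n.+1) D (fun w => 1 - sqnorm w)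
  (K1 * (K2 * dl ^+ n.+1)) 1 (- s) (2 * dl).
rewrite opprK => H; apply: le_trans (H _ _ _ _ _ _ _) _.
- exact: measurable_carleson.
- by apply: measurable_funTS; apply: measurable_funB => //; exact: measurable_sqnorm.
- by rewrite mulr_gt0.
- by rewrite !mulr_ge0 ?exprn_ge0 ?ltW.
- by move=> w [w1 _ ->]; rewrite andbT subr_gt0.
- move=> r /andP[r0 r2]; rewrite K1P powRr1 ?(ltW r0)// -mulrA EFinM.
  apply: lee_wpmul2l; first by rewrite lee_fin ltW.
  apply: le_trans (K2P z dl r z1 dl0 r0); apply: le_measure; rewrite ?inE.
  + have -> : D `&` [set x | 1 - sqnorm x <= r] `&` ball n.+1 =
       [set w | [/\ ball n.+1 w, normc (1 - inner z w) <= dl & 1 - sqnorm w <= r]].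
      apply/seteqP; split => w /=; first by case=> -[[]].
      by case=> w1 wd wr; do 2 split => //; split => //; exact: le_trans wr r2.
    exact: measurable_carleson.
  + exact: measurable_carleson.
  + by move=> w [[[w1 wd _]] /= wr _].
- by rewrite ltrNl.
rewrite lee_fin le_eqVlt; apply/orP; left; apply/eqP.
rewrite powRM ?ltW//.
rewrite -addrA (powRD_gt0 n.+1%:R (1 + s) dl0) powR_mulrn ?ltW// /K3 opprK.
move: (2 `^ `|- s|) (2 `^ (1 + s)) (dl `^ (1 + s)) (1 - 2^-1 `^ (1 + s)) (dl ^+ n.+1).
by move=> a b d e x; ring.
Qed.

(** The second dyadic sum, over |1 - <z,w>|. The sublevel sets have weighted mass of order dl^q with
    q = n + 2 + s, so for t < q the integral is bounded, and beyond q it is governed by the least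
    value (1 - |z|^2) / 2. *)
Lemma forelli_rudin_le n (s t A : R) : -1 < s ->
  (A = 0 /\ t < n.+1%:R + 1 + s) \/ (0 < A /\ t <= n.+1%:R + 1 + s + A) ->
  exists2 K : R, 0 < K & forall z : Cn R n.+1, ball n.+1 z ->
  (\int[volume R n.+1]_(w in ball n.+1)
     ((1 - sqnorm w) `^ s * normc (1 - inner z w) `^ (- t))%:E <=
   (K * (1 - sqnorm z) `^ (- A))%:E)%E.
Proof.
move=> s1 hA; have [K1 K10 K1P] := integral_defect_carleson_le n s1.
pose q : R := n.+1%:R + 1 + s.
have c0 := @c_gt0 R n.+1 s s1.
(* The weight is absorbed into the measure, with [s] in the role of alpha; [c0] allows dividing the
   normalization out again. *)
pose nu : {measure set (Cn R n.+1) -> \bar R} := @weighted_volume R n.+1 s.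
have q0 : 0 < q by rewrite /q; have := ler0n R n.+1; lra.
have nuD z (dl : R) : ball n.+1 z -> 0 < dl ->
    (nu (ball n.+1 `&` [set w | (normc (1 - inner z w) <= dl)%R]) <=
     (c_ n.+1 s * K1 * dl `^ q)%:E)%E.
  move=> z1 dl0; rewrite /nu /= /weighted_volume.
  have -> : ball n.+1 `&` [set w | (normc (1 - inner z w) <= dl)%R] =
      [set w | [/\ ball n.+1 w, normc (1 - inner z w) <= dl & 1 - sqnorm w <= 2 * dl]].
    apply/seteqP; split => w; first case=> w1 /= wd; last by case.
    by split => //; have := defect_le_w z1 w1; lra.
  under eq_integral do rewrite /weight EFinM.
  rewrite ge0_integralZl//; last 4 first.
  - exact: measurable_carleson.
  - by apply/measurable_EFinP; exact: measurable_defect_powR.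
  - by move=> w _; rewrite lee_fin powR_ge0.
  - by rewrite lee_fin ltW.
  rewrite [leRHS](_ : _ = ((c_ n.+1 s)%:E * (K1 * dl `^ q)%:E)%E); last first.
    by rewrite -EFinM mulrA.
  by apply: lee_wpmul2l; [rewrite lee_fin ltW|exact: K1P].
have mu_ (z : Cn R n.+1) : measurable_fun (ball n.+1) (fun w => normc (1 - inner z w)).
  apply: measurable_funTS; apply: (measurableT_comp measurable_normc).
  exact: (measurableT_comp (@measurable_1Binner R n.+1) (pair1_measurable z)).
have nuE z t' : (\int[volume R n.+1]_(w in ball n.+1)
     ((1 - sqnorm w) `^ s * normc (1 - inner z w) `^ (- t'))%:E =
     (c_ n.+1 s)^-1%:E * \int[nu]_(w in ball n.+1) (normc (1 - inner z w) `^ (- t'))%:E)%E.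
  rewrite /nu integral_weighted_volume; last 3 first.
  - exact: measurable_unit_ball.
  - exact: measurable_kernel_powR.
  - by move=> w _; exact: powR_ge0.
  rewrite -ge0_integralZl//; last 4 first.
  - exact: measurable_unit_ball.
  - apply/measurable_EFinP; apply: measurable_funM; first exact: measurable_kernel_powR.
    by apply: measurable_funM => //; exact: measurable_defect_powR.
  - by move=> w _; rewrite lee_fin mulr_ge0 ?powR_ge0// mulr_ge0 ?powR_ge0// ltW.
  - by rewrite lee_fin invr_ge0 ltW.
  apply: eq_integral => w _; rewrite -EFinM; congr EFin.
  rewrite [X in _ = _ * X]mulrCA mulKf ?gt_eqF// mulrC //.
case: hA => [[-> tq]|[A0 tq]].
  pose K2 : R := 2 `^ `|t| * (c_ n.+1 s * K1) * 2 `^ (q - t) / (1 - 2^-1 `^ (q - t)).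
  exists ((c_ n.+1 s)^-1 * (`|K2| + 1)).
    by rewrite mulr_gt0 ?invr_gt0// ltr_wpDl.
  move=> z z1; rewrite oppr0 powRr0 mulr1 nuE EFinM.
  apply: lee_wpmul2l; first by rewrite lee_fin invr_ge0 ltW.
  apply: le_trans (@integral_powR_small _ _ _ nu (ball n.+1)
    (fun w => normc (1 - inner z w)) (c_ n.+1 s * K1) q t 2 _ _ _ _ _ _ _) _ => //.
  - exact: measurable_unit_ball.
  - by rewrite mulr_ge0 ?ltW.
  - by move=> w w1; rewrite (normc_1Binner_gt0 z1 w1) ltW// normc_1Binner_lt2.
  - by move=> r /andP[r0 _]; exact: nuD.
  - by rewrite lee_fin -/K2 (le_trans (ler_norm _))// lerDl.
(* As |1 - <z,w>| < 2 and t <= t', passing to the exponent t' costs 2^(t'-t). Then t' > q, and q -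
   t' is exactly the power -A of 1 - |z|^2 that is wanted. *)
pose t' := q + A.
pose K2 : R := 2 `^ `|t'| * (c_ n.+1 s * K1) / (1 - 2 `^ (q - t')).
exists ((c_ n.+1 s)^-1 * (2 `^ (t' - t) * (`|K2| + 1))).
  by rewrite mulr_gt0 ?invr_gt0// mulr_gt0 ?powR_gt0// ltr_wpDl.
move=> z z1.
have tz : 0 < 1 - sqnorm z by move: z1; rewrite /unit_ball /=; lra.
rewrite nuE -mulrA EFinM.
apply: lee_wpmul2l; first by rewrite lee_fin invr_ge0 ltW.
apply: (@le_trans _ _ ((2 `^ (t' - t))%:E *
    \int[nu]_(w in ball n.+1) (normc (1 - inner z w) `^ (- t'))%:E)%E).
  rewrite -ge0_integralZl//; last 3 first.
  - exact: measurable_unit_ball.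
  - by apply/measurable_EFinP; exact: measurable_kernel_powR.
  - by move=> w _; rewrite lee_fin powR_ge0.
  apply: ge0_le_integral => //.
  - exact: measurable_unit_ball.
  - by move=> w _; rewrite lee_fin powR_ge0.
  - by apply/measurable_EFinP; exact: measurable_kernel_powR.
  - apply/measurable_EFinP; apply: measurable_funM => //; exact: measurable_kernel_powR.
  - move=> w w1; have u0 := normc_1Binner_gt0 z1 w1.
    rewrite -EFinM lee_fin -[leLHS](_ : normc (1 - inner z w) `^ (t' - t) *
      normc (1 - inner z w) `^ (- t') = _); last first.
      by rewrite -powRD_gt0//; congr (_ `^ _); ring.
    rewrite ler_wpM2r ?powR_ge0//.
    apply: ge0_ler_powR; [by rewrite subr_ge0|by rewrite nnegrE ltW|by rewrite nnegrE|].
    exact: ltW (normc_1Binner_lt2 z1 w1).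
rewrite -mulrA EFinM; apply: lee_wpmul2l; first by rewrite lee_fin powR_ge0.
apply: le_trans (@integral_powR_large _ _ _ nu (ball n.+1)
    (fun w => normc (1 - inner z w)) (c_ n.+1 s * K1) q t' ((1 - sqnorm z) / 2)
     _ _ _ _ _ _ _) _ => //.
- exact: measurable_unit_ball.
- by rewrite divr_gt0.
- by rewrite mulr_ge0 ?ltW.
- by move=> w w1; exact: defect_le_z.
- by move=> r r0; exact: nuD.
- by rewrite /t'; lra.
rewrite lee_fin (_ : 2 * ((1 - sqnorm z) / 2) = 1 - sqnorm z); last by lra.
rewrite (_ : - A = q - t'); last by rewrite /t'; lra.
rewrite mulrAC ler_wpM2r ?powR_ge0//.
by rewrite -/K2 (le_trans (ler_norm _))// lerDl.
Qed.

End volume_bounds.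

(** * Sufficiency *)

(* The reciprocal 1/p' of the conjugate exponent, with 1/oo = 0. *)
Definition dual_inv (R : realType) (p : \bar R) : R :=
  1 - (if p is q%:E then q^-1 else 0).

Lemma dual_inv_gt0 (R : realType) (p : \bar R) : (1 < p)%E -> 0 < dual_inv p.
Proof.
case: p => [q|_|//]; last by rewrite /dual_inv subr0.
rewrite lte_fin => q1; have q0 : 0 < q by lra.
by rewrite /dual_inv subr_gt0 invf_lt1.
Qed.

(** The factor of Hoelder's inequality that carries the kernel, with T = 1 - |w|^2, u = |1 - <z,w>|,
    k = c_alpha and conjugate exponent 1/om. The exponents s and t of the Forelli-Rudin integral
    arise here. *)
Lemma powR_hoelder_weight (R : realType) (T u k b c al r om : R) :
  0 < T -> 0 < u -> 0 < k -> 1 - om = r ->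
  (T `^ b * u `^ (- c) * (k * T `^ al) `^ (- r)) `^ om^-1 =
  k `^ (- (r / om)) * (T `^ ((b - (1 - om) * al) / om) * u `^ (- (c / om))).
Proof.
move=> T0 u0 k0 ->.
have Tal : 0 <= T `^ al by exact: powR_ge0.
rewrite (powRM (- r) (ltW k0) Tal) !powRM ?mulr_ge0 ?powR_ge0// -!powRrM.
rewrite (_ : (b - r * al) / om = b / om + al * (- r / om)); last by ring.
rewrite powRD_gt0//.
rewrite (_ : - (r / om) = - r / om); last by ring.
rewrite (_ : - (c / om) = - c / om); last by ring.
move: (T `^ (b / om)) (u `^ (- c / om)) (k `^ (- r / om)) (T `^ (al * (- r / om))) => X1 X2 X3 X4.
ring.
Qed.

Section hoelder_on.
Context d (T : measurableType d) (R : realType).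
Local Open Scope ereal_scope.

Lemma ge0_hoelder_on (mu : {measure set T -> \bar R}) (D : set T) (f g : T -> R) (p q : R) :
  measurable D -> measurable_fun D f -> measurable_fun D g ->
  (forall x, D x -> (0 <= f x)%R) -> (forall x, D x -> (0 <= g x)%R) ->
  (0 < p)%R -> (0 < q)%R -> (p^-1 + q^-1 = 1)%R ->
  \int[mu]_(x in D) (f x * g x)%:E <=
    (\int[mu]_(x in D) (f x `^ p)%:E) `^ p^-1 * (\int[mu]_(x in D) (g x `^ q)%:E) `^ q^-1.
Proof.
move=> mD mf mg f0 g0 p0 q0 pq.
have powE (h : T -> R) (r : R) : (0 < r)%R -> (forall x, D x -> (0 <= h x)%R) ->
    'N[mu]_r%:E[EFin \o (h \_ D)] = (\int[mu]_(x in D) (h x `^ r)%:E) `^ r^-1.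
  move=> r0 h0; rewrite Lnorm.unlock; apply: (congr1 (fun X => X `^ r^-1)).
  rewrite [RHS]integral_mkcond; apply: eq_integral => x _ /=.
  rewrite !patchE; case: ifPn => [/set_mem Dx|_].
    by rewrite ger0_norm ?h0.
  by transitivity ((`|0 : R| `^ r)%:E : \bar R) => //; rewrite normr0 powR0// gt_eqF.
have := @hoelder _ _ _ mu (f \_ D) (g \_ D) p q
  (proj1 (measurable_restrictT _ mD) mf) (proj1 (measurable_restrictT _ mD) mg) p0 q0 pq.
rewrite !powE//; apply: le_trans.
rewrite Lnorm1 integral_mkcond le_eqVlt; apply/orP; left; apply/eqP.
apply: eq_integral => x _ /=; rewrite !patchE; case: ifPn => [/set_mem Dx|_] /=.
  by rewrite ger0_norm// mulr_ge0 ?f0 ?g0.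
by transitivity ((`|0 * 0 : R|)%:E : \bar R) => //; rewrite mul0r normr0.
Qed.

End hoelder_on.

Section Lp_norms.
Context {R : realType} (n : nat).
Local Notation ball := (unit_ball R n.+1).
Local Notation vol := (volume R n.+1).
Implicit Types f : Cn R n.+1 -> R[i].

Lemma Lp_normE (alpha q : R) f : 0 < q -> measurable_fun ball f ->
  Lp_norm alpha q%:E f =
  ((\int[vol]_(w in ball) (normc (f w) `^ q * (c_ n.+1 alpha * (1 - sqnorm w) `^ alpha))%:E)
    `^ q^-1)%E.
Proof.
move=> q0 mf; rewrite /Lp_norm /ball_Lnorm Lnorm.unlock; apply: (congr1 (fun X => X `^ q^-1)%E).
have mfq : measurable_fun ball (fun w => normc (f w) `^ q).
  apply: (measurableT_comp (measurable_powR q)).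
  exact: (measurableT_comp measurable_normc mf).
rewrite -integral_weighted_volume; last 3 first.
- exact: measurable_unit_ball.
- exact: mfq.
- by move=> w _; exact: powR_ge0.
rewrite [RHS]integral_mkcond; apply: eq_integral => w _ /=.
rewrite !patchE; case: ifPn => _ /=.
  by rewrite ger0_norm ?normc_ge0.
by transitivity ((`|0 : R| `^ q)%:E : \bar R) => //; rewrite normr0 powR0// gt_eqF.
Qed.

Lemma Linfty_norm_ae f : {ae vol, forall w, ball w -> ((normc (f w))%:E <= Linfty_norm f)%E}.
Proof.
(* At +oo, [Lnorm] is the essential supremum only if the total mass is positive; here it is 1. *)
rewrite /Linfty_norm /ball_Lnorm unlock volumeT lte01.
have := ess_sup_inf.ess_sup_ge vol
  (abse \o ((fun z => (normc (f z))%:E) \_ ball)).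
apply: filterS => w /= h bw; apply: le_trans h.
by rewrite patchE mem_set//= ger0_norm// normc_ge0.
Qed.

Lemma Linfty_norm_le f (M : \bar R) : (0 <= M)%E ->
  (forall w, ball w -> ((normc (f w))%:E <= M)%E) -> (Linfty_norm f <= M)%E.
Proof.
move=> M0 fM; rewrite /Linfty_norm /ball_Lnorm unlock volumeT lte01.
apply/ess_sup_inf.ess_supP; apply: nearW => w /=.
rewrite patchE; case: ifPn => [/set_mem bw|_] /=; last by rewrite normr0.
by rewrite ger0_norm ?normc_ge0// fM.
Qed.

Lemma Lp_norm_ge0 (alpha : R) (p : \bar R) f : (0 <= Lp_norm alpha p f)%E.
Proof. by case: p => [q| |]; exact: Lnorm_ge0. Qed.

End Lp_norms.

Section sufficiency.
Context {R : realType} (n : nat) (b c : R) (K : Cn R n.+1 -> Cn R n.+1 -> R[i]).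
Local Notation ball := (unit_ball R n.+1).
Local Notation vol := (volume R n.+1).
Local Notation leb := (@lebesgue_Cn R n.+1).
Context (Kmeas : measurable_fun (ball `*` ball) (fun x => K x.1 x.2)).
Context (Kabs : forall z w, ball z -> ball w ->
  normc (K z w) = (1 - sqnorm w) `^ b * normc (1 - inner z w) `^ (- c)).

Lemma measurable_kernel_mul (z : Cn R n.+1) (f : Cn R n.+1 -> R[i]) : ball z ->
  measurable_fun ball f -> measurable_fun ball (fun w => K z w * f w).
Proof.
move=> bz mf; apply: measurable_fun_mulC => //; first exact: measurable_unit_ball.
move=> _ B mB; have mBB : measurable (ball `*` ball : set (Cn R n.+1 * Cn R n.+1)).
  by apply: measurableX; exact: measurable_unit_ball.
have := measurable_xsection z (Kmeas mBB mB).
congr measurable; apply/seteqP; split => w; rewrite /xsection /= inE /=.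
  by case=> -[].
by case.
Qed.

(** For finite p, Hoelder's inequality pairs f times the p-th root of the density of dv_alpha with
    the kernel divided by that root. For p = oo, om = 1 and the almost everywhere bound of f by its
    norm replaces it. *)
Lemma kernel_integral_le (a alpha : R) (p : \bar R) (C : R) :
  -1 < alpha -> (1 < p)%E -> 0 < C ->
  let om := dual_inv p in
  (forall z, ball z ->
    (\int[vol]_(w in ball) ((1 - sqnorm w) `^ ((b - (1 - om) * alpha) / om) *
       normc (1 - inner z w) `^ (- (c / om)))%:E <=
     (C * (1 - sqnorm z) `^ (- (a / om)))%:E)%E) ->
  exists2 C' : R, 0 < C' & forall (f : Cn R n.+1 -> R[i]) z, measurable_fun ball f -> ball z ->
    (\int[vol]_(w in ball) (normc (K z w * f w))%:E <=
     (C' * (1 - sqnorm z) `^ (- a))%:E * Lp_norm alpha p f)%E.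
Proof.
move=> alpha1 p1 C0; case: p p1 => [q q1|_|//] om; last first.
  rewrite /om /dual_inv subr0 subrr mul0r subr0 !divr1 => H.
  exists C => // f z mf bz.
  have mK : measurable_fun ball (fun w => normc (K z w)).
    rewrite (_ : (fun w => normc (K z w)) = (fun w => normc (K z w * 1))).
      by apply: (measurableT_comp measurable_normc); exact: measurable_kernel_mul.
    by apply/funext => w; rewrite mulr1.
  apply: (@le_trans _ _ (\int[vol]_(w in ball)
     ((normc (K z w))%:E * Linfty_norm f))%E).
    apply: ae_ge0_le_integral => //.
    - exact: measurable_unit_ball.
    - by move=> w _; rewrite lee_fin normc_ge0.
    - apply/measurable_EFinP; apply: (measurableT_comp measurable_normc).
      exact: measurable_kernel_mul.
    - move=> w _; apply: mule_ge0; first by rewrite lee_fin normc_ge0.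
      exact: (Lp_norm_ge0 0 +oo).
    - by apply: emeasurable_funM => //; exact/measurable_EFinP.
    - apply: filterS (Linfty_norm_ae f) => w h bw; rewrite normcM EFinM.
      by apply: lee_wpmul2l; [rewrite lee_fin normc_ge0|exact: h].
  rewrite ge0_integralZr//; last 4 first.
  - exact: measurable_unit_ball.
  - exact/measurable_EFinP.
  - by move=> w _; rewrite lee_fin normc_ge0.
  - exact: (Lp_norm_ge0 0 +oo).
  apply: lee_wpmul2r; first exact: (Lp_norm_ge0 0 +oo).
  apply: le_trans (H z bz); rewrite le_eqVlt; apply/orP; left; apply/eqP.
  by apply: eq_integral => w /set_mem bw; rewrite Kabs.
rewrite lte_fin in q1.
have q0 : 0 < q by lra.
have om0 : 0 < om by rewrite /om /dual_inv subr_gt0 invf_lt1.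
have oq : 1 - om = q^-1 by rewrite /om /dual_inv; ring.
move=> H.
have cq := @c_gt0 R n.+1 alpha alpha1.
pose k := c_ n.+1 alpha.
exists ((k `^ (- (q^-1 / om)) * C) `^ om).
  by rewrite powR_gt0// mulr_gt0// powR_gt0.
move=> f z mf bz.
pose F w := normc (f w) * (k * (1 - sqnorm w) `^ alpha) `^ q^-1.
pose G w := normc (K z w) * (k * (1 - sqnorm w) `^ alpha) `^ (- q^-1).
have d0 w : ball w -> 0 < 1 - sqnorm w by rewrite /unit_ball /=; lra.
have kw0 w : ball w -> 0 < k * (1 - sqnorm w) `^ alpha.
  by move=> /d0 ?; rewrite mulr_gt0// powR_gt0.
have mkw (s : R) : measurable_fun ball (fun w => (k * (1 - sqnorm w) `^ alpha) `^ s).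
  apply: (measurableT_comp (measurable_powR s)).
  by apply: measurable_funM => //; exact: measurable_defect_powR.
have mF : measurable_fun ball F.
  by apply: measurable_funM => //; exact: (measurableT_comp measurable_normc mf).
have mK : measurable_fun ball (fun w => normc (K z w)).
  rewrite (_ : (fun w => normc (K z w)) = (fun w => normc (K z w * 1))).
    by apply: (measurableT_comp measurable_normc); exact: measurable_kernel_mul.
  by apply/funext => w; rewrite mulr1.
have mG : measurable_fun ball G by exact: measurable_funM.
rewrite (eq_integral (fun w => (F w * G w)%:E)); last first.
  move=> w /set_mem /kw0 w0; rewrite /F /G; congr EFin; rewrite normcM powRN.
  have := powR_gt0 q^-1 w0; move: (_ `^ q^-1) => X X0; field.
  by rewrite gt_eqF.
have Hold : (\int[vol]_(w in ball) (F w * G w)%:E <=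
    (\int[vol]_(w in ball) (F w `^ q)%:E) `^ q^-1 *
    (\int[vol]_(w in ball) (G w `^ om^-1)%:E) `^ om^-1^-1)%E.
  apply: ge0_hoelder_on => //.
  - exact: measurable_unit_ball.
  - by move=> w _; rewrite mulr_ge0 ?normc_ge0 ?powR_ge0.
  - by move=> w _; rewrite mulr_ge0 ?normc_ge0 ?powR_ge0.
  - by rewrite invr_gt0.
  - by rewrite invrK /om /dual_inv; ring.
apply: le_trans Hold _.
have Fle : ((\int[vol]_(w in ball) (F w `^ q)%:E) `^ q^-1 <= Lp_norm alpha q%:E f)%E.
  rewrite Lp_normE// le_eqVlt; apply/orP; left; apply/eqP.
  apply: (congr1 (fun X => X `^ q^-1)%E).
  apply: eq_integral => w /set_mem /kw0 w0.
  congr EFin; rewrite /F (powRM _ (normc_ge0 (f w)) (powR_ge0 _ _)).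
  by rewrite -(powRrM _ q^-1 q) mulVf ?gt_eqF// powRr1 ?(ltW w0).
rewrite [leRHS]muleC; apply: lee_pmul Fle _; [exact: poweR_ge0|exact: poweR_ge0|].
rewrite invrK; have Gle : (\int[vol]_(w in ball) (G w `^ om^-1)%:E <=
    (k `^ (- (q^-1 / om)) * C * (1 - sqnorm z) `^ (- (a / om)))%:E)%E.
  rewrite -mulrA EFinM.
  apply: (@le_trans _ _ ((k `^ (- (q^-1 / om)))%:E * \int[vol]_(w in ball)
     ((1 - sqnorm w) `^ ((b - (1 - om) * alpha) / om) *
       normc (1 - inner z w) `^ (- (c / om)))%:E)%E); last first.
    by apply: lee_wpmul2l; [rewrite lee_fin powR_ge0|exact: H].
  rewrite -ge0_integralZl//; last 4 first.
  - exact: measurable_unit_ball.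
  - apply/measurable_EFinP; apply: measurable_funM;
      [exact: measurable_defect_powR|exact: measurable_kernel_powR].
  - by move=> w _; rewrite lee_fin mulr_ge0 ?powR_ge0.
  - by rewrite lee_fin powR_ge0.
  rewrite le_eqVlt; apply/orP; left; apply/eqP; apply: eq_integral => w /set_mem bw.
  have w0 := d0 _ bw; have u0 := normc_1Binner_gt0 bz bw.
  rewrite -EFinM; congr EFin; rewrite /G (Kabs bz bw).
  exact: powR_hoelder_weight.
(* The outer exponent om turns the power -a/om of 1 - |z|^2 into -a. *)
apply: (@le_trans _ _ ((k `^ (- (q^-1 / om)) * C * (1 - sqnorm z) `^ (- (a / om)))%:E `^ om)%E).
  apply: (gt0_ler_poweR (ltW om0)) Gle; rewrite in_itv/= leey andbT.
    by apply: integral_ge0 => w _; rewrite lee_fin powR_ge0.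
  by rewrite lee_fin mulr_ge0 ?powR_ge0// mulr_ge0 ?powR_ge0// ltW.
rewrite poweR_EFin lee_fin powRM; last 2 first.
- by rewrite mulr_ge0 ?powR_ge0// ltW.
- exact: powR_ge0.
by rewrite -powRrM mulNr divfK// gt_eqF.
Qed.

(** Tonelli's theorem asks for a sigma-finite measure, while [volume] is declared only as a measure;
    it is therefore written as a density against [lebesgue_Cn]. *)
Lemma measurable_integral_volume (h : Cn R n.+1 * Cn R n.+1 -> \bar R) :
  measurable_fun setT h -> (forall x, 0 <= h x)%E ->
  measurable_fun setT (fun z => \int[vol]_w h (z, w))%E.
Proof.
move=> mh h0; have [V V0 VE] := @volume_lebesgue R n.
have mi : measurable_fun setT (fun w : Cn R n.+1 => V * \1_ball w).
  by apply: measurable_funM => //; apply: measurable_indic; exact: measurable_unit_ball.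
have i0 (w : Cn R n.+1) : 0 <= V * \1_ball w by rewrite mulr_ge0// ltW.
have volE A : measurable A -> (vol A = \int[leb]_(w in A) (V * \1_ball w)%:E)%E.
  move=> mA; rewrite VE; under eq_integral do rewrite EFinM.
  rewrite ge0_integralZl//; last 2 first.
  - by apply/measurable_EFinP; apply: measurable_indic; exact: measurable_unit_ball.
  - by rewrite lee_fin ltW.
  by rewrite integral_indic//; [rewrite setIC|exact: measurable_unit_ball].
rewrite (_ : (fun _ => _) = (fun z => \int[leb]_w (h (z, w) * (V * \1_ball w)%:E))%E); last first.
  apply/funext => z; apply: ge0_integral_density => //.
  exact: (measurableT_comp mh (pair1_measurable z)).
pose hV (x : Cn R n.+1 * Cn R n.+1) := (h x * (V * \1_ball x.2)%:E)%E.
have mhV : measurable_fun setT hV.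
  apply: emeasurable_funM => //; apply/measurable_EFinP.
  exact: (measurableT_comp mi measurable_snd).
have hV0 x : (0 <= hV x)%E by rewrite mule_ge0// lee_fin.
exact: (@measurable_fun_fubini_tonelli_F _ _ _ _ _ leb hV mhV hV0).
Qed.

(** The real integral is [fine] of the difference of the integrals of the positive and negative
    parts, each of them measurable in z by Tonelli. *)
Lemma measurable_Rintegral_kernel (g : Cn R n.+1 * Cn R n.+1 -> R) :
  measurable_fun (ball `*` ball) g ->
  measurable_fun ball (fun z => \int[vol]_(w in ball) g (z, w)).
Proof.
have mB := measurable_unit_ball R n.+1.
have mBB : measurable (ball `*` ball : set (Cn R n.+1 * Cn R n.+1)) by exact: measurableX.
move=> /(measurable_restrictT _ mBB) mg.
pose G : Cn R n.+1 * Cn R n.+1 -> \bar R := EFin \o (g \_ (ball `*` ball)).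
have mG : measurable_fun setT G by exact/measurable_EFinP.
have mGp : measurable_fun setT (fun z => \int[vol]_w (G^\+%E (z, w)))%E.
  by apply: measurable_integral_volume => //; exact: measurable_funepos.
have mGn : measurable_fun setT (fun z => \int[vol]_w (G^\-%E (z, w)))%E.
  by apply: measurable_integral_volume => //; exact: measurable_funeneg.
apply: (eq_measurable_fun (fun z => fine (\int[vol]_w (G^\+%E (z, w)) -
    \int[vol]_w (G^\-%E (z, w))))%E); last first.
  by apply: measurable_funTS; apply: measurableT_comp => //; exact: emeasurable_funB.
move=> z /set_mem bz; rewrite /Rintegral; congr fine.
have GE w : G (z, w) = ((fun x => (g (z, x))%:E) \_ ball) w.
  rewrite /G /= !patchE; case: ifPn => [/set_mem [_ bw]|]; first by rewrite mem_set.
  by case: ifPn => // /set_mem bw /negP[]; rewrite inE.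
by rewrite integral_mkcond integralE; congr (_ - _)%E; apply: eq_integral => w _;
  rewrite ?funeposE ?funenegE GE.
Qed.

(** Real and imaginary parts are bounded separately, which costs the factor 2; the value of the
    constant is irrelevant for boundedness. *)
Lemma normc_cintegral_le (g : Cn R n.+1 -> R[i]) : cintegrable vol ball g ->
  ((normc (cintegral vol ball g))%:E <= 2%:E * \int[vol]_(w in ball) (normc (g w))%:E)%E.
Proof.
move=> [mg fing]; have mB := measurable_unit_ball R n.+1.
have mn : measurable_fun ball (fun w => normc (g w)).
  exact: (measurableT_comp measurable_normc mg).
have ing : vol.-integrable ball (EFin \o (fun w => normc (g w))).
  apply/integrableP; split; first exact/measurable_EFinP.
  rewrite (eq_integral (fun w => (normc (g w))%:E))// => w _ /=.
  by rewrite ger0_norm// normc_ge0.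
have part (h : Cn R n.+1 -> R) : measurable_fun ball h ->
    (forall w, `|h w| <= normc (g w)) ->
    (`|\int[vol]_(w in ball) h w|%:E <= \int[vol]_(w in ball) (normc (g w))%:E)%E.
  move=> mh hg.
  have inh : vol.-integrable ball (EFin \o h).
    apply: le_integrable ing => //; first exact/measurable_EFinP.
    by move=> w _ /=; rewrite lee_fin (ger0_norm (normc_ge0 _)).
  apply: (@le_trans _ _ (\int[vol]_(w in ball) `|(h w)%:E|)%E).
    rewrite EFin_normr_Rintegral//; apply: le_abse_integral => //.
    exact/measurable_EFinP.
  apply: ge0_le_integral => //.
  - by apply/measurable_EFinP; exact: measurableT_comp.
  - exact/measurable_EFinP.
  - by move=> w _ /=; rewrite lee_fin.
apply: (@le_trans _ _ (`|\int[vol]_(w in ball) complex.Re (g w)|%:E +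
  `|\int[vol]_(w in ball) complex.Im (g w)|%:E)%E).
  by rewrite -EFinD lee_fin; exact: (normc_le_ReIm (cintegral vol ball g)).
rewrite (_ : 2%:E = 1 + 1)%E; last by rewrite -EFinD.
rewrite ge0_muleDl// mul1e; apply: leeD; apply: part.
- exact: measurable_fun_Re.
- by move=> w; exact: normr_Re_le.
- exact: measurable_fun_Im.
- by move=> w; exact: normr_Im_le.
Qed.

(** The estimate gives absolute convergence at every z of the ball, and (1 - |z|^2)^a cancels the
    growth (1 - |z|^2)^(-a). The image must also be shown measurable, being required to lie in
    L^oo. *)
Lemma bounded_of_kernel_integral_le (a alpha : R) (p : \bar R) (C : R) : 0 < C ->
  (forall (f : Cn R n.+1 -> R[i]) z, measurable_fun ball f -> ball z ->
    (\int[vol]_(w in ball) (normc (K z w * f w))%:E <=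
     (C * (1 - sqnorm z) `^ (- a))%:E * Lp_norm alpha p f)%E) ->
  bounded_Lp_Linfty alpha p K (weighted_integral_op a K).
Proof.
move=> C0 H.
have ci f z : in_Lp alpha p f -> ball z -> cintegrable vol ball (fun w => K z w * f w).
  move=> [mf finf] bz; split; first exact: measurable_kernel_mul.
  apply: le_lt_trans (H f z mf bz) _; rewrite lte_mul_pinfty// lee_fin.
  by rewrite mulr_ge0 ?powR_ge0// ltW.
split; first by move=> f Lf z bz; exact: ci.
exists (2 * C) => f Lf; have [mf finf] := Lf.
have est : (Linfty_norm (weighted_integral_op a K f) <= (2 * C)%:E * Lp_norm alpha p f)%E.
  apply: Linfty_norm_le.
    by apply: mule_ge0; [rewrite lee_fin mulr_ge0// ltW|exact: Lp_norm_ge0].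
  move=> z bz; rewrite /weighted_integral_op normcM.
  have tz : 0 < 1 - sqnorm z by rewrite subr_gt0.
  have -> : normc ((1 - sqnorm z) `^ a)%:C%C = (1 - sqnorm z) `^ a.
    by rewrite /normc /= expr0n/= addr0 sqrtr_sqr ger0_norm// powR_ge0.
  rewrite EFinM; apply: le_trans (lee_wpmul2l _ (normc_cintegral_le (ci f z Lf bz))) _.
    by rewrite lee_fin powR_ge0.
  apply: (@le_trans _ _ (((1 - sqnorm z) `^ a)%:E * (2%:E *
     ((C * (1 - sqnorm z) `^ (- a))%:E * Lp_norm alpha p f)))%E).
    apply: lee_wpmul2l; first by rewrite lee_fin powR_ge0.
    by apply: lee_wpmul2l => //; exact: H.
  rewrite !muleA -!EFinM le_eqVlt; apply/orP; left; apply/eqP.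
  congr (_%:E * _)%E; rewrite powRN.
  have := powR_gt0 a tz; move: (_ `^ a) => X X0; field.
  by rewrite gt_eqF.
split => //; split; last first.
  by apply: le_lt_trans est _; rewrite lte_mul_pinfty// lee_fin mulr_ge0// ltW.
have mB := measurable_unit_ball R n.+1.
have mBB : measurable (ball `*` ball : set (Cn R n.+1 * Cn R n.+1)) by exact: measurableX.
have mKf : measurable_fun (ball `*` ball) (fun x => K x.1 x.2 * f x.2).
  apply: measurable_fun_mulC => //.
  move=> _ B mB'; rewrite (_ : _ `&` _ = ball `*` (ball `&` f @^-1` B)).
    by apply: measurableX => //; exact: mf.
  by apply/seteqP; split => -[x y] /=; [case=> -[? ?] ?|case=> ? [? ?]].
apply: measurable_fun_mulC => //.
  apply: measurable_fun_complex => //=; first exact: measurable_defect_powR.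
apply: measurable_fun_complex => //=.
- exact: (measurable_Rintegral_kernel (measurable_fun_Re mKf)).
- exact: (measurable_Rintegral_kernel (measurable_fun_Im mKf)).
Qed.

End sufficiency.

(** * Necessity *)

Lemma integral_sub_indic d (T : measurableType d) (R : realType)
    (mu : {measure set T -> \bar R}) (W D : set T) (h : T -> \bar R) : W `<=` D ->
  (\int[mu]_(x in W) h x = \int[mu]_(x in D) (h x * (\1_W x)%:E))%E.
Proof.
move=> WD; rewrite -{1}(setIidr WD) integral_mkcondr.
by under eq_integral do rewrite epatch_indic.
Qed.

Section test_functions.
Context {R : realType} (n : nat).
Local Notation ball := (unit_ball R n.+1).
Local Notation vol := (volume R n.+1).
Implicit Types W Z : set (Cn R n.+1).

Definition test_fun (W : set (Cn R n.+1)) (g : R) (w : Cn R n.+1) : R[i] :=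
  ((1 - sqnorm w) `^ g * \1_W w)%:C%C.

Lemma normc_real (x : R) : normc x%:C%C = `|x|.
Proof. by rewrite /normc /= expr0n/= addr0 sqrtr_sqr. Qed.

Lemma normc_test_fun W g w : normc (test_fun W g w) = (1 - sqnorm w) `^ g * \1_W w.
Proof. by rewrite /test_fun normc_real ger0_norm// mulr_ge0// powR_ge0. Qed.

Lemma measurable_test_fun W g : measurable W -> measurable_fun ball (test_fun W g).
Proof.
move=> mW; apply: measurable_fun_complex => //=; first exact: measurable_unit_ball.
by apply: measurable_funM; [exact: measurable_defect_powR|exact: measurable_indic].
Qed.

(** On [W] the base lies between [rho] and 1, so any real power of it is bounded, and the volume is
    finite. *)
Lemma integral_defect_powR_lty W (rho s : R) : measurable W -> 0 < rho ->
  (forall w, W w -> rho <= 1 - sqnorm w) ->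
  (\int[vol]_(w in W) ((1 - sqnorm w) `^ s)%:E < +oo)%E.
Proof.
move=> mW rho0 Wr.
pose k : R := Num.max 1 rho^-1.
have k1 : 1 <= k by rewrite le_max lexx.
have k2 : rho^-1 <= k by rewrite le_max lexx orbT.
apply: (@le_lt_trans _ _ (\int[vol]_(w in W) (cst (k `^ `|s|)%:E w))%E).
  apply: ge0_le_integral => //.
  - by move=> w _; rewrite lee_fin powR_ge0.
  - by apply/measurable_EFinP; exact: measurable_defect_powR.
  - move=> w Ww; rewrite lee_fin.
    have w1 : 1 - sqnorm w <= 1 by rewrite gerBl sqnorm_ge0.
    have w0 := lt_le_trans rho0 (Wr w Ww).
    have e1 : (1 : R) `^ s = 1 by rewrite powR1.
    rewrite -[leRHS]mulr1 -[X in _ <= _ * X]e1.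
    apply: powR_comparable => //; last by rewrite mulr1 (le_trans w1).
    apply: (@le_trans _ _ (rho^-1 * (1 - sqnorm w))); last by rewrite ler_wpM2r// ltW.
    by rewrite mulrC ler_pdivlMr// mul1r Wr.
rewrite integral_cst// lte_mul_pinfty//; first by rewrite lee_fin powR_ge0.
apply: (@le_lt_trans _ _ (vol setT)); last by rewrite volumeT ltry.
by apply: le_measure; rewrite ?inE.
Qed.

(** Write g for the exponent of the test function. Since p (1 - om) = 1, p g + alpha = (beta - (1 -
    om) alpha) / om, so the p-th power of the norm is c_alpha times the displayed integral. *)
Lemma Lp_norm_test_fun_le (alpha beta : R) (p : \bar R) W (rho : R) :
  -1 < alpha -> (1 < p)%E -> measurable W -> W `<=` ball -> 0 < rho ->
  (forall w, W w -> rho <= 1 - sqnorm w) ->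
  (Lp_norm alpha p (test_fun W ((1 - dual_inv p) * (beta - alpha) / dual_inv p)) <=
    (c_ n.+1 alpha `^ (1 - dual_inv p) *
     fine (\int[vol]_(w in W)
       ((1 - sqnorm w) `^ ((beta - (1 - dual_inv p) * alpha) / dual_inv p))%:E)
       `^ (1 - dual_inv p))%:E)%E.
Proof.
move=> alpha1 p1 mW Wb rho0 Wr; set om := dual_inv p.
set I := (\int[vol]_(w in W) _)%E.
have om0 : 0 < om by exact: dual_inv_gt0.
have Ifin : (I < +oo)%E by exact: integral_defect_powR_lty Wr.
have I0 : (0 <= I)%E by apply: integral_ge0 => w _; rewrite lee_fin powR_ge0.
have c0 := @c_gt0 R n.+1 alpha alpha1.
case: p p1 @om @I om0 Ifin I0 => [q q1|_|//] om I om0 Ifin I0; last first.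
  (* For p = oo the test function is the indicator of [W] on the ball, and the bound is 1, since x^0
     = 1 even for x = 0. *)
  have om1 : 1 - om = 0 by rewrite /om /dual_inv; ring.
  rewrite om1 !powRr0 mulr1 mul0r mul0r.
  apply: Linfty_norm_le => // w bw.
  by rewrite normc_test_fun powRr0 mul1r lee_fin indicE; case: (_ \in _).
rewrite lte_fin in q1; have q0 : 0 < q by lra.
have oq : 1 - om = q^-1 by rewrite /om /dual_inv; ring.
rewrite Lp_normE//; last exact: measurable_test_fun.
rewrite (_ : (\int[vol]_(w in ball) _)%E = ((c_ n.+1 alpha)%:E * I)%E).
  rewrite oq -(fineK (x := I)) ?ge0_fin_numE// -EFinM poweR_EFin lee_fin.
  by rewrite (powRM _ (ltW c0)) ?fine_ge0.
rewrite /I -ge0_integralZl//; last 3 first.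
- by apply/measurable_EFinP; exact: measurable_defect_powR.
- by move=> w _; rewrite lee_fin powR_ge0.
- by rewrite lee_fin ltW.
rewrite [RHS](integral_sub_indic _ _ Wb).
apply: eq_integral => w /set_mem bw.
have w0 : 0 < 1 - sqnorm w by rewrite subr_gt0.
rewrite normc_test_fun -!EFinM; congr EFin; rewrite indicE; case: (_ \in _); last first.
  by rewrite !mulr0 powR0 ?mul0r ?gt_eqF.
rewrite !mulr1 -powRrM mulrCA -powRD_gt0//; congr (_ * _ `^ _).
have qom : q * (1 - om) = 1 by rewrite oq divff// gt_eqF.
have -> : (1 - om) * (beta - alpha) / om * q = q * (1 - om) * ((beta - alpha) / om) by ring.
by rewrite qom; field; rewrite gt_eqF.
Qed.

End test_functions.

Section necessity.
Context {R : realType} (n : nat) (a alpha : R) (p : \bar R).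
Context (K : Cn R n.+1 -> Cn R n.+1 -> R[i]).
Local Notation ball := (unit_ball R n.+1).
Local Notation vol := (volume R n.+1).
Context (alpha1 : -1 < alpha) (p1 : (1 < p)%E).
Context (Kbnd : bounded_Lp_Linfty alpha p K (weighted_integral_op a K)).

Let om := dual_inv p.
Let om0 : 0 < om. Proof. exact: dual_inv_gt0. Qed.

(** This provides a point of [Z] at which the essential bound is an actual inequality. *)
Lemma ae_meets (Z : set (Cn R n.+1)) (P : Cn R n.+1 -> Prop) :
  measurable Z -> (0 < vol Z)%E -> {ae vol, forall w, P w} -> exists2 z, Z z & P z.
Proof.
move=> mZ Z0 [N [mN N0 PN]].
apply: contrapT => nex; move: Z0; apply/negP; rewrite -leNgt -N0.
apply: le_measure; rewrite ?inE// => z Zz; apply: PN => Pz.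
by apply: nex; exists z.
Qed.

(* With p' = 1 / om, the test function (1 - |w|^2)^g on W is the equality case of
   Hoelder's inequality: its p-th power against dv_alpha and its product with
   (1 - |w|^2)^beta have the same integrand up to the constant c_alpha. *)
Lemma test_bound : exists2 C' : R, 0 <= C' &
  forall (W Z : set (Cn R n.+1)) (beta rho k0 tau : R),
  measurable W -> W `<=` ball -> 0 < rho -> (forall w, W w -> rho <= 1 - sqnorm w) ->
  measurable Z -> Z `<=` ball -> (0 < vol Z)%E -> 0 <= k0 -> 0 <= tau ->
  (forall z w, Z z -> W w -> k0 * (1 - sqnorm w) `^ beta <= complex.Re (K z w)) ->
  (forall z, Z z -> tau <= (1 - sqnorm z) `^ a) ->
  tau * k0 * fine (\int[vol]_(w in W)
     ((1 - sqnorm w) `^ ((beta - (1 - om) * alpha) / om))%:E) `^ om <= C'.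
Proof.
have [Kint [C HC]] := Kbnd.
have c0 := @c_gt0 R n.+1 alpha alpha1.
exists (`|C| * c_ n.+1 alpha `^ (1 - om)); first by rewrite mulr_ge0 ?powR_ge0.
move=> W Z beta rho k0 tau mW Wb rho0 Wr mZ Zb Z0 k00 tau0 Kk Zt.
set I := (\int[vol]_(w in W) _)%E.
have Ifin : (I < +oo)%E by exact: integral_defect_powR_lty Wr.
have I0 : (0 <= I)%E by apply: integral_ge0 => w _; rewrite lee_fin powR_ge0.
pose g := (1 - om) * (beta - alpha) / om.
pose f := test_fun W g.
have fle := Lp_norm_test_fun_le beta alpha1 p1 mW Wb rho0 Wr.
have mf : measurable_fun ball f by exact: measurable_test_fun.
have Lf : in_Lp alpha p f by split => //; apply: le_lt_trans fle (ltry _).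
have [_ Tf] := HC f Lf.
have [z Zz Pz] := ae_meets mZ Z0 (Linfty_norm_ae (weighted_integral_op a K f)).
have {}Pz := le_trans (Pz (Zb z Zz)) Tf.
have bz := Zb z Zz.
have [mKf finKf] := Kint f Lf z bz.
have t0 : 0 < 1 - sqnorm z by rewrite subr_gt0.
have mB := measurable_unit_ball R n.+1.
have inR : vol.-integrable ball (EFin \o (fun w => complex.Re (K z w * f w))).
  apply/integrableP; split; first by apply/measurable_EFinP; exact: measurable_fun_Re.
  apply: le_lt_trans finKf; apply: ge0_le_integral => //.
  - apply/measurable_EFinP; apply: measurableT_comp => //; exact: measurable_fun_Re.
  - by apply/measurable_EFinP; exact: (measurableT_comp measurable_normc mKf).
  - by move=> w _ /=; rewrite lee_fin normr_Re_le.
have lower : ((k0 * fine I)%:E <= (\int[vol]_(w in ball) complex.Re (K z w * f w))%:E)%E.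
  rewrite EFinM fineK ?ge0_fin_numE// /Rintegral fineK; last exact: integrable_fin_num.
  have ReE w : complex.Re (K z w * f w) = complex.Re (K z w) * ((1 - sqnorm w) `^ g * \1_W w).
    by rewrite /f /test_fun; case: (K z w) => x y /=; rewrite mulr0 subr0.
  have ptw w : ball w ->
      (k0 * (1 - sqnorm w) `^ ((beta - (1 - om) * alpha) / om)) * \1_W w <=
      complex.Re (K z w) * ((1 - sqnorm w) `^ g * \1_W w).
    move=> bw; rewrite indicE; case: (boolP (w \in W)) => [/set_mem Ww|_]; last by rewrite !mulr0.
    have w0 : 0 < 1 - sqnorm w by rewrite subr_gt0.
    rewrite !mulr1; have -> : (beta - (1 - om) * alpha) / om = beta + g.
      by rewrite /g; field; rewrite gt_eqF.
    by rewrite powRD_gt0// mulrA ler_wpM2r ?powR_ge0// Kk.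
  have ptw0 w : 0 <= (k0 * (1 - sqnorm w) `^ ((beta - (1 - om) * alpha) / om)) * \1_W w.
    by rewrite mulr_ge0// mulr_ge0// powR_ge0.
  rewrite /I -ge0_integralZl//; last 2 first.
  - by apply/measurable_EFinP; exact: measurable_defect_powR.
  - by move=> w _; rewrite lee_fin powR_ge0.
  rewrite (integral_sub_indic _ _ Wb); apply: ge0_le_integral => //.
  - by move=> w _; rewrite -!EFinM lee_fin.
  - apply/measurable_EFinP; apply: measurable_funM; last exact: measurable_indic.
    by apply: measurable_funM => //; exact: measurable_defect_powR.
  - by apply/measurable_EFinP; exact: measurable_fun_Re.
  - by move=> w bw; rewrite -!EFinM lee_fin ReE; exact: ptw.
(* The left side bounds the operator from below at [z], through the real part; the right side is C
   times the norm of [f]. Dividing by I^(1-om) leaves the claim. *)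
have : tau * k0 * fine I <= `|C| * (c_ n.+1 alpha `^ (1 - om) * fine I `^ (1 - om)).
  rewrite -lee_fin; apply: (@le_trans _ _ (C%:E * Lp_norm alpha p f)%E); last first.
    apply: (@le_trans _ _ (`|C|%:E * Lp_norm alpha p f)%E).
      by apply: lee_wpmul2r; [exact: Lp_norm_ge0|rewrite lee_fin ler_norm].
    by rewrite EFinM; apply: lee_wpmul2l.
  apply: le_trans Pz; rewrite lee_fin /weighted_integral_op.
  apply: le_trans (le_trans (ler_norm _) (normr_Re_le _)).
  rewrite lee_fin in lower.
  set X := \int[vol]_(w in ball) complex.Re (K z w * f w) in lower.
  rewrite (_ : complex.Re _ = (1 - sqnorm z) `^ a * X); last by rewrite /= mul0r subr0.
  rewrite -mulrA; apply: ler_pM => //; last exact: Zt.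
  by rewrite mulr_ge0// fine_ge0.
(* Division is impossible for I = 0, but then I^om = 0 because om > 0. *)
have [->|In0] := eqVneq (fine I) 0.
  have -> : (0 : R) `^ om = 0 by rewrite powR0// gt_eqF.
  by move=> _; rewrite mulr0 mulr_ge0 ?powR_ge0.
have {}In0 : 0 < fine I by rewrite lt0r In0 fine_ge0.
have IE : fine I = fine I `^ om * fine I `^ (1 - om).
  by rewrite -powRD_gt0// subrKC powRr1// ltW.
rewrite {1}IE !mulrA ler_pM2r// powR_gt0//.
Qed.

End necessity.

Section power_bounds.
Context {R : realType}.

Lemma powR_bounded_ge0 (x C d0 : R) : 0 < d0 ->
  (forall dl, 0 < dl <= d0 -> dl `^ x <= C) -> 0 <= x.
Proof.
move=> d00 H; rewrite leNgt; apply/negP => x0.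
(* [y] solves y^x = |C| + 1; since x < 0, any [dl] below [y] violates the bound. *)
pose y := (`|C| + 1) `^ x^-1; have C1 : 0 < `|C| + 1 by rewrite ltr_wpDl.
have y0 : 0 < y by rewrite powR_gt0.
have yx : y `^ x = `|C| + 1 by rewrite /y -powRrM mulVf ?lt_eqF// powRr1// ltW.
pose dl := Num.min d0 y; have dl0 : 0 < dl by rewrite lt_min d00.
have dly : dl <= y by rewrite ge_min lexx orbT.
have := H dl; rewrite dl0 ge_min lexx => /(_ isT).
apply/negP; rewrite -ltNge; apply: (@lt_le_trans _ _ (y `^ x)).
  by rewrite yx (le_lt_trans (ler_norm C))// ltrDl.
rewrite -(opprK x) !(powRN _ (- x)) lef_pV2 ?posrE ?powR_gt0//.
by apply: ge0_ler_powR; rewrite ?nnegrE ?(ltW dl0) ?(ltW y0)// oppr_ge0 ltW.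
Qed.

Lemma linear_powR_unbounded (c0 om C : R) : 0 < c0 -> 0 < om ->
  ~ (forall m : nat, (m%:R * c0) `^ om <= C).
Proof.
move=> c00 om0 H.
pose y := (`|C| + 1) `^ om^-1; have C1 : 0 < `|C| + 1 by rewrite ltr_wpDl.
have y0 : 0 < y by rewrite powR_gt0.
have yx : y `^ om = `|C| + 1 by rewrite /y -powRrM mulVf ?gt_eqF// powRr1// ltW.
have := H (Num.bound (y / c0)); apply/negP; rewrite -ltNge.
apply: (@lt_le_trans _ _ (y `^ om)).
  by rewrite yx (le_lt_trans (ler_norm C))// ltrDl.
have h : y <= (Num.bound (y / c0))%:R * c0.
  by rewrite -ler_pdivrMr// ltW// archi_boundP// divr_ge0// ltW.
by apply: ge0_ler_powR h; rewrite ?nnegrE ?(ltW om0) ?(ltW y0)// mulr_ge0// ltW.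
Qed.

End power_bounds.

(** * The test sets *)

Section small_ball.
Context {R : realType} (n : nat).
Local Notation ball := (unit_ball R n.+1).
Local Notation vol := (volume R n.+1).

Lemma volume_gt0 (A : set (Cn R n.+1)) : A `<=` ball ->
  (0 < @lebesgue_Cn R n.+1 A)%E -> (0 < vol A)%E.
Proof.
move=> AB A0; have [V V0 ->] := @volume_lebesgue R n.
by rewrite (setIidl AB) mule_gt0.
Qed.

(* The lower bound is 0, in the shape required by measurable_sqnorm_window. *)
Definition small_ball (e : R) : set (Cn R n.+1) :=
  [set w | e ^+ 2 - e ^+ 2 <= sqnorm w < e ^+ 2].

Lemma measurable_small_ball e : measurable (small_ball e).
Proof. exact: measurable_sqnorm_window. Qed.

Lemma small_ball_sub e : 0 < e <= 1 / 2 -> small_ball e `<=` ball.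
Proof. by move=> e1 w; rewrite /small_ball /unit_ball /=; nra. Qed.

Lemma small_ball_defect e w : 0 < e <= 1 / 2 -> small_ball e w ->
  1 / 2 <= 1 - sqnorm w <= 1.
Proof. by move=> e1; rewrite /small_ball /=; nra. Qed.

Lemma small_ball_volume e : 0 < e <= 1 / 2 -> (0 < vol (small_ball e))%E.
Proof.
move=> e1; apply: volume_gt0; first exact: small_ball_sub.
have N1 : 1 <= n.+1%:R :> R by rewrite ler1n.
pose r : R := e / (4 * n.+1%:R).
have r0 : 0 < r by rewrite divr_gt0 ?mulr_gt0//; lra.
have rN : r * n.+1%:R = e / 4.
  by rewrite /r; field; rewrite gt_eqF//; lra.
apply: (@lt_le_trans _ _ (@lebesgue_Cn R n.+1 (polybox (nseq_tuple n.+1 (0%R : R[i])) r))).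
  by rewrite lebesgue_polybox ?(ltW r0)// lte_fin exprn_gt0// mulr_gt0// exprn_gt0.
apply: le_measure; rewrite ?inE; [exact: measurable_polybox|exact: measurable_small_ball|].
move=> w /(polybox0_sqnorm (ltW r0)) h; rewrite /small_ball /= subrr sqnorm_ge0/=.
by apply: le_lt_trans h _; nra.
Qed.

(** 1 - <z,w> is within [e] of 1, hence inside the sector. The form [2 * 1] matches [K_ge] with L =
    2 and x = 1. *)
Lemma small_inner (e eta0 : R) (z w : Cn R n.+1) : 0 < e <= 1 / 2 -> e <= eta0 / 2 ->
  normc (inner z w) <= e ->
  [/\ `|complex.Im (1 - inner z w)| <= eta0 * complex.Re (1 - inner z w),
      normc (1 - inner z w) <= 2 * 1 & 1 <= 2 * normc (1 - inner z w)].
Proof.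
move=> e1 e2 h; rewrite Re_1Binner Im_1Binner normrN.
have h1 := le_trans (normr_Im_le _) h.
have h2 := le_trans (le_trans (ler_norm _) (normr_Re_le _)) h.
split.
- by apply: le_trans h1 _; nra.
- by have := le_normcD 1 (- inner z w); rewrite normc1 normcN; lra.
- by have := ge_normc_1Binner z w; lra.
Qed.

(** The weighted inequality with l = 1/e gives (|z|^2 / e + e |w|^2) / 2 <= e. *)
Lemma small_inner_l (e : R) (z w : Cn R n.+1) : 0 < e <= 1 / 2 ->
  small_ball e z -> ball w -> normc (inner z w) <= e.
Proof.
move=> /andP[e0 e1]; rewrite /small_ball /unit_ball /= => zs bw.
have ei : 0 < e^-1 by rewrite invr_gt0.
apply: le_trans (normc_inner_le z w ei) _; rewrite invrK ler_pdivrMr//.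
have : e^-1 * sqnorm z <= e by rewrite ler_pdivrMl//; nra.
nra.
Qed.

Lemma small_inner_r (e : R) (z w : Cn R n.+1) : 0 < e <= 1 / 2 ->
  ball z -> small_ball e w -> normc (inner z w) <= e.
Proof.
move=> /andP[e0 e1]; rewrite /small_ball /unit_ball /= => bz ws.
apply: le_trans (normc_inner_le z w e0) _; rewrite ler_pdivrMr//.
have : sqnorm w / e <= e by rewrite ler_pdivrMr//; nra.
nra.
Qed.

Lemma tentbox_volume_gt0 (eta dl : R) : 0 < eta <= 1 / 8 -> 0 < dl <= 1 / 8 ->
  (0 < vol (@tentbox R n eta dl))%E.
Proof.
move=> he hd; apply: volume_gt0; first by move=> w /(tentbox_defect he hd)[].
have [k k0 ->] := @lebesgue_tentbox R n eta (proj1 (andP he)).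
  by rewrite lte_fin mulr_gt0// exprn_gt0//; case/andP: hd.
by case/andP: hd.
Qed.

Lemma integral_tentbox_ge (eta s : R) : 0 < eta <= 1 / 8 -> exists2 k : R, 0 < k &
  forall dl, 0 < dl <= 1 / 8 ->
  ((k * dl `^ (s + n.+1%:R + 1))%:E <=
   \int[vol]_(w in @tentbox R n eta dl) ((1 - sqnorm w) `^ s)%:E)%E.
Proof.
move=> he; have [k k0 kE] := @lebesgue_tentbox R n eta (proj1 (andP he)).
have [V V0 VE] := @volume_lebesgue R n.
exists ((4 `^ `|s|)^-1 * (V * k)).
  by rewrite mulr_gt0 ?invr_gt0 ?powR_gt0// mulr_gt0.
move=> dl hd; have dl0 : 0 < dl by case/andP: hd.
apply: (@le_trans _ _ (\int[vol]_(w in @tentbox R n eta dl)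
    (cst ((4 `^ `|s|)^-1 * dl `^ s)%:E w))%E).
  rewrite integral_cst; last exact: measurable_tentbox.
  rewrite VE (setIidl _); last by move=> w /(tentbox_defect he hd)[].
  rewrite kE// -!EFinM lee_fin le_eqVlt; apply/orP; left; apply/eqP.
  rewrite -addrA [n.+1%:R + 1](_ : _ = n.+2%:R); last by rewrite -[in RHS]natr1.
  rewrite powRD_gt0// powR_mulrn ?(ltW dl0)//.
  move: (4 `^ `|s|)^-1 (dl `^ s) (dl ^+ n.+2) => x y u; ring.
apply: ge0_le_integral => //.
- exact: measurable_tentbox.
- by move=> w _; rewrite lee_fin mulr_ge0 ?invr_ge0 ?powR_ge0.
- by apply/measurable_EFinP; exact: measurable_defect_powR.
- move=> w /(tentbox_defect he hd)[bw /andP[h1 h2]]; rewrite lee_fin.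
  rewrite mulrC ler_pdivrMr ?powR_gt0// mulrC.
  apply: powR_comparable => //; [by rewrite subr_gt0|by rewrite ler1n|lra].
Qed.

End small_ball.

Lemma dyadic_trivIset {R : realType} {T : Type} (A : nat -> set T) (f : T -> R) (r : R) :
  0 < r -> (forall k w, A k w -> r / 2 ^+ k.+1 < f w <= r / 2 ^+ k) -> trivIset setT A.
Proof.
move=> r0 H; apply/trivIsetP => i j _ _ neq; rewrite -subset0 => w [].
wlog ij : i j neq / (i < j)%N => [W Ai Aj|].
  by case: (ltngtP i j) neq => // h _; [apply: (W i j)|apply: (W j i)]; rewrite // ?ltn_eqF.
move=> /H/andP[h1 _] /H/andP[_ h2].
have := lt_le_trans h1 h2; apply/negP; rewrite -leNgt.
apply: ler_wpM2l; first exact: ltW.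
by rewrite lef_pV2 ?posrE ?exprn_gt0//; apply: ler_weXn2l; rewrite ?ler1n.
Qed.

(** * The four necessary conditions *)

Section necessary_conditions.
Context {R : realType} (n : nat) (b c a alpha : R) (p : \bar R).
Context (K : Cn R n.+1 -> Cn R n.+1 -> R[i]) (eta0 : R).
Local Notation ball := (unit_ball R n.+1).
Local Notation vol := (volume R n.+1).
Context (alpha1 : -1 < alpha) (p1 : (1 < p)%E) (eta0_gt0 : 0 < eta0).
Context (Kabs : forall z w, ball z -> ball w ->
  normc (K z w) = (1 - sqnorm w) `^ b * normc (1 - inner z w) `^ (- c)).
Context (Kpos : forall z w, ball z -> ball w ->
  `|complex.Im (1 - inner z w)| <= eta0 * complex.Re (1 - inner z w) ->
  normc (K z w) / 2 <= complex.Re (K z w)).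
Context (Kbnd : bounded_Lp_Linfty alpha p K (weighted_integral_op a K)).

Let om := dual_inv p.
Let om0 : 0 < om. Proof. exact: dual_inv_gt0. Qed.
Let S (beta : R) := (beta - (1 - om) * alpha) / om.

(** [test_bound] on the union of [m] disjoint sets, each contributing at least [c0] to the integral.
    One constant serves every [m], and [m] being finite leaves room for a common distance [rho] to
    the sphere. With m = 1 it tests a single set. *)
Let test_family : exists2 C' : R, 0 <= C' &
  forall (A : nat -> set (Cn R n.+1)) (m : nat) (Z : set (Cn R n.+1)) (beta rho k0 tau c0 : R),
  (forall k, measurable (A k)) -> trivIset setT A ->
  (forall k, (k < m)%N -> A k `<=` ball) -> 0 < rho ->
  (forall k w, (k < m)%N -> A k w -> rho <= 1 - sqnorm w) ->
  measurable Z -> Z `<=` ball -> (0 < vol Z)%E -> 0 <= k0 -> 0 <= tau -> 0 <= c0 ->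
  (forall k z w, (k < m)%N -> Z z -> A k w ->
    k0 * (1 - sqnorm w) `^ beta <= complex.Re (K z w)) ->
  (forall z, Z z -> tau <= (1 - sqnorm z) `^ a) ->
  (forall k, (k < m)%N ->
    (c0%:E <= \int[vol]_(w in A k) ((1 - sqnorm w) `^ S beta)%:E)%E) ->
  tau * k0 * (m%:R * c0) `^ om <= C'.
Proof.
have [C' C'0 H] := test_bound alpha1 p1 Kbnd; exists C' => // A m Z beta rho k0 tau c0.
move=> mA tA Ab rho0 Ar mZ Zb Z0 k00 tau0 c00 Kk Zt cI.
pose W := \big[setU/set0]_(k <- iota 0 m) A k.
have WE w : W w -> exists2 k, (k < m)%N & A k w.
  rewrite /W -bigcup_seq => -[k /=]; rewrite mem_iota add0n => km Akw.
  by exists k.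
have mW : measurable W by apply: bigsetU_measurable => k _.
have Wb : W `<=` ball by move=> w /WE[k km]; exact: Ab.
have Wr w : W w -> rho <= 1 - sqnorm w by move=> /WE[k km]; exact: Ar.
apply: le_trans (H W Z beta rho k0 tau mW Wb rho0 Wr mZ Zb Z0 k00 tau0 _ Zt); last first.
  by move=> z w Zz /WE[k km]; exact: Kk.
rewrite -/om -/(S beta).
have If : (\int[vol]_(w in W) ((1 - sqnorm w) `^ S beta)%:E < +oo)%E.
  exact: integral_defect_powR_lty Wr.
apply: ler_wpM2l; first by rewrite mulr_ge0.
apply: ge0_ler_powR; rewrite ?nnegrE ?(ltW om0) ?mulr_ge0//.
  by rewrite fine_ge0// integral_ge0// => w _; rewrite lee_fin powR_ge0.
rewrite -lee_fin fineK; last first.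
  by rewrite ge0_fin_numE// integral_ge0// => w _; rewrite lee_fin powR_ge0.
rewrite /W ge0_integral_bigsetU//=; last 4 first.
- exact: iota_uniq.
- exact: sub_trivIset tA.
- by apply/measurable_EFinP; exact: measurable_defect_powR.
- by move=> w _; rewrite lee_fin powR_ge0.
apply: (@le_trans _ _ (\sum_(k <- iota 0 m) c0%:E)%E).
  by rewrite sumEFin big_const_seq count_predT size_iota iter_addr_0 mulr_natl.
rewrite big_seq [leRHS]big_seq; apply: lee_sum => k.
by rewrite mem_iota add0n; exact: cI.
Qed.

(** Inside the sector Re K >= |K|/2, and |1 - <z,w>| may be replaced by any comparable [x]; the
    power |c| covers both signs of [c]. *)
Let K_ge (L x : R) z w : ball z -> ball w -> 0 < x -> 1 <= L ->
  `|complex.Im (1 - inner z w)| <= eta0 * complex.Re (1 - inner z w) ->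
  normc (1 - inner z w) <= L * x -> x <= L * normc (1 - inner z w) ->
  (2 * L `^ `|c|)^-1 * ((1 - sqnorm w) `^ b * x `^ (- c)) <= complex.Re (K z w).
Proof.
move=> bz bw x0 L1 cone h1 h2; apply: le_trans (Kpos bz bw cone).
rewrite Kabs// -(normrN c).
have Lp : 0 < L `^ `|- c| by rewrite powR_gt0// (lt_le_trans ltr01).
have := @powR_comparable R L _ x (- c) (normc_1Binner_gt0 bz bw) x0 L1 h1 h2.
have := powR_ge0 (1 - sqnorm w) b.
move: ((1 - sqnorm w) `^ b) (x `^ (- c)) (normc _ `^ (- c)) (L `^ _) Lp => T X U P P0 T0 h.
rewrite invfM -mulrA mulrC ler_pM2r// ler_pdivrMl//.
by rewrite mulrCA; apply: ler_wpM2l.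
Qed.

(** With e0 <= eta0/2 and e0 <= 1/2, |Im| <= e0 is at most eta0 (1 - e0), as the sector requires. *)
Let e0 : R := Num.min (1 / 2) (eta0 / 2).
Let e0P : 0 < e0 <= 1 / 2.
Proof. by rewrite /e0 lt_min ge_min lexx andbT divr_gt0//= divr_gt0. Qed.
Let e0_eta : e0 <= eta0 / 2. Proof. by rewrite /e0 ge_min lexx orbT. Qed.

(** The bound eta0/6 answers the slope 6 eta of [tentbox_inner]. *)
Let eta : R := Num.min (1 / 8) (eta0 / 6).
Let etaP : 0 < eta <= 1 / 8.
Proof. by rewrite /eta lt_min ge_min lexx andbT divr_gt0//= divr_gt0. Qed.
Let eta_eta0 : 6 * eta <= eta0.
Proof.
have : eta <= eta0 / 6 by rewrite /eta ge_min lexx orbT.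
by lra.
Qed.

Let tentbox_weight_ge (s dl : R) (z : Cn R n.+1) : 0 < dl <= 1 / 8 -> tentbox eta dl z ->
  (4 `^ `|s|)^-1 * dl `^ s <= (1 - sqnorm z) `^ s.
Proof.
move=> hd /(tentbox_defect etaP hd)[bz /andP[h1 h2]].
have dl0 : 0 < dl by case/andP: hd.
rewrite mulrC ler_pdivrMr ?powR_gt0// mulrC.
by apply: powR_comparable => //; [rewrite subr_gt0|rewrite ler1n|lra].
Qed.

Let small_weight_ge (s : R) (z : Cn R n.+1) : small_ball e0 z ->
  (2 `^ `|s|)^-1 <= (1 - sqnorm z) `^ s.
Proof.
move=> /(small_ball_defect e0P)/andP[h1 h2].
rewrite -[leLHS]mulr1 mulrC ler_pdivrMr ?powR_gt0// mulrC.
have e1 : (1 : R) `^ s = 1 by rewrite powR1.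
by rewrite -{1}e1; apply: powR_comparable => //; lra.
Qed.

(** The boundary points are represented by a tentbox of scale [dl], where (1 - |z|^2)^a is at least
    a multiple of dl^a; everything else is independent of [dl], so dl^a stays bounded. *)
Lemma bounded_a_ge0 : 0 <= a.
Proof.
have [C' C'0 H] := test_family.
pose I0 := (\int[vol]_(w in small_ball e0) ((1 - sqnorm w) `^ S 0)%:E)%E.
have rho (w : Cn R n.+1) : small_ball e0 w -> 1 / 2 <= 1 - sqnorm w.
  by move=> /(small_ball_defect e0P)/andP[].
have half0 : 0 < 1 / 2 :> R by rewrite divr_gt0.
have If : (I0 < +oo)%E.
  exact: integral_defect_powR_lty (S 0) (measurable_small_ball e0) half0 rho.
have I0_gt0 : (0 < I0)%E.
  apply: (@lt_le_trans _ _ (\int[vol]_(w in small_ball e0) (cst ((2 `^ `|S 0|)^-1)%:E w))%E).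
    rewrite integral_cst; last exact: measurable_small_ball.
    apply: mule_gt0; first by rewrite lte_fin invr_gt0 powR_gt0.
    exact: small_ball_volume.
  apply: ge0_le_integral => //.
  - exact: measurable_small_ball.
  - by move=> w _; rewrite lee_fin invr_ge0 powR_ge0.
  - by apply/measurable_EFinP; exact: measurable_defect_powR.
  - by move=> w Zw; rewrite lee_fin; exact: small_weight_ge.
pose i0 := fine I0; have i00 : 0 < i0 by rewrite fine_gt0// I0_gt0.
(* Here beta = 0: on the small ball the weight (1 - |w|^2)^b is bounded below by the second
   factor. *)
pose k0 : R := (2 * 2 `^ `|c|)^-1 * (2 `^ `|b|)^-1.
have k00 : 0 < k0 by rewrite mulr_gt0 ?invr_gt0 ?mulr_gt0 ?powR_gt0.
pose t0 : R := (4 `^ `|a|)^-1.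
have t00 : 0 < t0 by rewrite invr_gt0 powR_gt0.
have io : 0 < i0 `^ om by rewrite powR_gt0.
apply: (@powR_bounded_ge0 R a (C' / (t0 * k0 * i0 `^ om)) (1 / 8)) => // dl hd.
rewrite ler_pdivlMr ?mulr_gt0//.
pose A (k : nat) : set (Cn R n.+1) := if k == 0%N then small_ball e0 else set0.
have := H A 1%N (tentbox eta dl) 0 (1 / 2) k0 (t0 * dl `^ a) i0.
rewrite (mul1r i0) => H1; rewrite mulrC mulrAC.
rewrite [X in X <= _](_ : _ = t0 * dl `^ a * k0 * i0 `^ om); last by ring.
apply: H1 => //.
- by move=> k; rewrite /A; case: ifP => // _; exact: measurable_small_ball.
- move=> i j _ _; rewrite /A; case: ifP => [/eqP->|_]; case: ifP => [/eqP->//|_] [x []] //.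
- by move=> [|k]// _; exact: small_ball_sub.
- by move=> [|k]// w _; exact: rho.
- exact: measurable_tentbox.
- by move=> w /(tentbox_defect etaP hd)[].
- exact: tentbox_volume_gt0.
- exact: ltW.
- by rewrite mulr_ge0 ?powR_ge0// ltW.
- exact: ltW.
- move=> [|k]// z w _ /(tentbox_defect etaP hd)[bz _] Aw.
  have bw := small_ball_sub e0P Aw.
  have [h1 h2 h3] := small_inner e0P e0_eta (small_inner_r e0P bz Aw).
  apply: le_trans (K_ge bz bw ltr01 _ h1 h2 h3); last by rewrite ler1n.
  rewrite powRr0 mulr1 powR1 mulr1 /k0.
  rewrite ler_wpM2l ?invr_ge0 ?mulr_ge0 ?powR_ge0//.
  exact: small_weight_ge.
- by move=> z; exact: tentbox_weight_ge.
- by move=> [|k]// _; rewrite /A/= -/I0 fineK// ge0_fin_numE// ltW.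
Qed.

(* Otherwise the integral of (1 - |w|^2)^(S b) diverges: each of the disjoint
   dyadic shells contributes at least a fixed constant. *)
Lemma bounded_b_gt : -1 < (b - (1 - om) * alpha) / om.
Proof.
rewrite -/(S b) ltNge; apply/negP => Sb.
have [C' C'0 H] := test_family.
have [kap kap0 HK] := @lebesgue_shell_ge R n.
have [V V0 VE] := @volume_lebesgue R n.
pose r (k : nat) : R := 1 / 4 / 2 ^+ k.
have r0 k : 0 < r k by rewrite divr_gt0// exprn_gt0.
have rS k : r k.+1 = r k / 2 by rewrite /r exprS invfM mulrA mulrAC.
have rle k : r k <= 1 / 4.
  rewrite /r ler_pdivrMr ?exprn_gt0// ler_peMr//.
  by rewrite exprn_ege1// ler1n.
pose A k : set (Cn R n.+1) := [set w | 1 - r k / 2 - r k / 2 <= sqnorm w < 1 - r k / 2].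
have AE k w : A k w -> r k / 2 < 1 - sqnorm w <= r k by rewrite /A /=; lra.
have Ab k : A k `<=` ball by move=> w /AE; rewrite /unit_ball /=; have := r0 k; lra.
have mA k : measurable (A k) by exact: measurable_sqnorm_window.
have t00 : 0 < (2 `^ `|a|)^-1 :> R by rewrite invr_gt0 powR_gt0.
have k00 : 0 < (2 * 2 `^ `|c|)^-1 :> R by rewrite invr_gt0 mulr_gt0// powR_gt0.
apply: (@linear_powR_unbounded R (V * kap) om (C' / ((2 `^ `|a|)^-1 * (2 * 2 `^ `|c|)^-1))).
- by rewrite mulr_gt0.
- exact: om0.
move=> m; rewrite ler_pdivlMr ?mulr_gt0// mulrC.
(* The first m shells all have 1 - |w|^2 >= r_m / 2, so the truncation is legitimate. *)
apply: (H A m (small_ball e0) b (r m / 2)) => //.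
- apply: (@dyadic_trivIset R _ A (fun w => 1 - sqnorm w) (1 / 4)) => //.
  by move=> k w /AE; rewrite -!/(r _) rS.
- by rewrite divr_gt0.
- move=> k w km /AE/andP[h _]; apply: le_trans (ltW h).
  rewrite ler_pM2r// /r ler_pM2l// lef_pV2 ?posrE ?exprn_gt0//.
  by apply: ler_weXn2l; rewrite ?ler1n// ltnW.
- exact: measurable_small_ball.
- exact: small_ball_sub.
- exact: small_ball_volume.
- by rewrite mulr_ge0// ltW.
- move=> k z w _ Zz Aw; have bz := small_ball_sub e0P Zz; have bw := Ab _ _ Aw.
  have [h1 h2 h3] := small_inner e0P e0_eta (small_inner_l e0P Zz bw).
  have l12 : 1 <= 2 :> R by rewrite ler1n.
  have := K_ge bz bw ltr01 l12 h1 h2 h3.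
  by rewrite powR1 mulr1.
- by move=> z; exact: small_weight_ge.
move=> k _.
(* As S b <= -1 and 1 - |w|^2 <= r_k <= 1, the integrand is at least 1/r_k, which compensates a
   volume of order r_k. *)
apply: (@le_trans _ _ (\int[vol]_(w in A k) (cst ((r k)^-1)%:E w))%E).
  rewrite integral_cst// VE (setIidl (@Ab k)).
  apply: (@le_trans _ _ ((r k)^-1%:E * (V%:E * (kap * r k)%:E))%E).
    rewrite -!EFinM lee_fin; move: (r0 k) => rk.
    by rewrite le_eqVlt; apply/orP; left; apply/eqP; field; rewrite gt_eqF.
  apply: lee_wpmul2l; first by rewrite lee_fin invr_ge0 ltW.
  apply: lee_wpmul2l; first by rewrite lee_fin ltW.
  by apply: HK; rewrite r0 rle.
apply: ge0_le_integral => //.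
- by move=> w _; rewrite lee_fin invr_ge0 ltW.
- by apply/measurable_EFinP; exact: measurable_defect_powR.
move=> w /AE/andP[h1 h2]; rewrite lee_fin.
have t0 : 0 < 1 - sqnorm w by apply: le_lt_trans h1; rewrite divr_ge0// ltW.
apply: (@le_trans _ _ ((1 - sqnorm w) `^ (- 1))).
  by rewrite powR_inv1 ?(ltW t0)// lef_pV2 ?posrE.
apply: ger_powR => //; rewrite t0/=; apply: le_trans h2 _.
by apply: le_trans (rle k) _; rewrite ler_pdivrMr// mul1r ler1n.
Qed.

(** On tentboxes |1 - <z,w>| is comparable to 1 - |w|^2, so the kernel is a pure power of the
    latter, with beta = b - c. The factor 12 comes from |1 - <z,w>| <= 6 dl and dl/2 <= 1 -
    |w|^2. *)
Let tentbox_K_ge (dl dl' : R) (z w : Cn R n.+1) : 0 < dl <= 1 / 8 -> 0 < dl' <= dl ->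
  tentbox eta dl' z -> tentbox eta dl w ->
  (2 * 12 `^ `|c|)^-1 * (1 - sqnorm w) `^ (b - c) <= complex.Re (K z w).
Proof.
move=> hd hd' tz tw.
have hd'8 : 0 < dl' <= 1 / 8 by lra.
have [bz _] := tentbox_defect etaP hd'8 tz.
have [bw /andP[w1 w2]] := tentbox_defect etaP hd tw.
have [h1 h2 h3] := tentbox_inner etaP hd hd' tz tw.
have w0 : 0 < 1 - sqnorm w by rewrite subr_gt0.
rewrite powRD_gt0//; apply: K_ge => //.
- by rewrite ler1n.
- apply: le_trans h1 _; apply: ler_wpM2r; first exact: ltW (Re_1Binner_gt0 bz bw).
  exact: eta_eta0.
- by apply: le_trans h3 _; lra.
- by lra.
Qed.

(** With z and w in one box of scale [dl], the tested quantity is a multiple of dl^a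
    (dl^(S(b-c)+n+2))^om. It stays bounded as dl tends to 0, so its exponent cannot be negative. *)
Lemma bounded_c_le : 0 <= a + om * ((b - c - (1 - om) * alpha) / om + n.+1%:R + 1).
Proof.
rewrite -/(S (b - c)).
have [C' C'0 H] := test_family.
have [k k0 HI] := @integral_tentbox_ge R n eta (S (b - c)) etaP.
pose t0 : R := (4 `^ `|a|)^-1; pose k1 : R := (2 * 12 `^ `|c|)^-1.
have t00 : 0 < t0 by rewrite invr_gt0 powR_gt0.
have k10 : 0 < k1 by rewrite invr_gt0 mulr_gt0// powR_gt0.
have ko : 0 < k `^ om by rewrite powR_gt0.
apply: (@powR_bounded_ge0 R _ (C' / (t0 * k1 * k `^ om)) (1 / 8)) => // dl hd.
have dl0 : 0 < dl by case/andP: hd.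
rewrite ler_pdivlMr ?mulr_gt0//.
pose A (j : nat) : set (Cn R n.+1) := if j == 0%N then @tentbox R n eta dl else set0.
have := H A 1%N (tentbox eta dl) (b - c) (dl / 2) k1 (t0 * dl `^ a)
  (k * dl `^ (S (b - c) + n.+1%:R + 1)).
rewrite (mul1r (k * _)) => H1.
rewrite powRD_gt0// (mulrC om) powRrM.
rewrite [X in X <= _](_ : _ = t0 * dl `^ a * k1 *
  (k * dl `^ (S (b - c) + n.+1%:R + 1)) `^ om); last first.
  by rewrite [in RHS]powRM ?powR_ge0 ?(ltW k0)//; ring.
apply: H1 => //.
- by move=> j; rewrite /A; case: ifP => // _; exact: measurable_tentbox.
- move=> i j _ _; rewrite /A; case: ifP => [/eqP->|_]; case: ifP => [/eqP->//|_] [x []] //.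
- by move=> [|j]// _ w /(tentbox_defect etaP hd)[].
- by rewrite divr_gt0.
- by move=> [|j]// w _ /(tentbox_defect etaP hd)[_ /andP[]].
- exact: measurable_tentbox.
- by move=> w /(tentbox_defect etaP hd)[].
- exact: tentbox_volume_gt0.
- exact: ltW.
- by rewrite mulr_ge0 ?powR_ge0// ltW.
- by rewrite mulr_ge0 ?powR_ge0// ltW.
- by move=> [|j]// z w _ tz tw; apply: tentbox_K_ge tz tw; rewrite // dl0 lexx.
- by move=> z; exact: tentbox_weight_ge.
- by move=> [|j]// _; exact: HI.
Qed.

(* In the equality case the disjoint boxes at the dyadic scales 2^-k all
   contribute equally, so their number would be bounded. *)
Lemma bounded_c_lt : a = 0 -> 0 < om * ((b - c - (1 - om) * alpha) / om + n.+1%:R + 1).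
Proof.
rewrite -/(S (b - c)) => a0; have := bounded_c_le; rewrite -/(S (b - c)) a0.
rewrite add0r le_eqVlt => /orP[/eqP/esym E|//].
have {}E : S (b - c) + n.+1%:R + 1 = 0.
  by move/eqP: E; rewrite mulf_eq0 (gt_eqF om0)/= => /eqP.
exfalso.
have [C' C'0 H] := test_family.
have [kap kap0 HI] := @integral_tentbox_ge R n eta (S (b - c)) etaP.
pose k1 : R := (2 * 12 `^ `|c|)^-1.
have k10 : 0 < k1 by rewrite invr_gt0 mulr_gt0// powR_gt0.
pose r (k : nat) : R := 1 / 8 / 2 ^+ k.
have r0 k : 0 < r k by rewrite divr_gt0// exprn_gt0.
have rmono k m : (k <= m)%N -> r m <= r k.
  move=> km; rewrite /r ler_pM2l// lef_pV2 ?posrE ?exprn_gt0//.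
  by apply: ler_weXn2l; rewrite ?ler1n.
have r8 k : 0 < r k <= 1 / 8.
  by rewrite r0/= (le_trans (rmono 0%N k _))// /r expr0 divr1.
pose A k := @tentbox R n eta (r k).
have Ab k : A k `<=` ball by move=> w /(tentbox_defect etaP (r8 k))[].
apply: (@linear_powR_unbounded R kap om (C' / k1)) => //.
move=> m; rewrite ler_pdivlMr// mulrC -(mul1r k1).
(* z ranges over the finest box, w over the m coarser ones; as a = 0, the factor in z is 1. *)
apply: (H A m (A m) (b - c) (r m / 2)) => //.
- by move=> k; exact: measurable_tentbox.
(* The first coordinate separates the boxes: r_k < 1 - Re w_1 <= 2 r_k, half-open by the definition
   of [tentbox]. *)
- apply: (@dyadic_trivIset R _ A (fun w => 1 - complex.Re (uncons_Cn w).1) (1 / 4)) => //.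
  move=> k w /(tentboxE (proj1 (andP etaP)) (r0 k))[x [y [w' [-> hx _ _]]]].
  rewrite cons_CnK/=.
  have -> : 1 / 4 / 2 ^+ k = 2 * r k by rewrite /r; field; rewrite gt_eqF// exprn_gt0.
  have -> : 1 / 4 / 2 ^+ k.+1 = r k by rewrite /r exprS; field; rewrite gt_eqF// exprn_gt0.
  by move: hx; lra.
- by rewrite divr_gt0.
- move=> k w km /(tentbox_defect etaP (r8 k))[_ /andP[h _]]; apply: le_trans h.
  by rewrite ler_pM2r// rmono// ltnW.
- exact: measurable_tentbox.
- exact: tentbox_volume_gt0.
- exact: ltW.
- exact: ltW.
- move=> k z w km tz tw; apply: tentbox_K_ge tz tw => //.
  by rewrite r0/= rmono// ltnW.
- by move=> z _; rewrite a0 powRr0.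
- by move=> k _; have := HI _ (r8 k); rewrite E powRr0 mulr1.
Qed.

End necessary_conditions.

(** * The two kernels *)

Section principal_power.
Context {R : realType}.
Implicit Types (u : R[i]) (c : R).

Lemma normc_Re_sqrt u : 0 < complex.Re u ->
  normc u = complex.Re u * Num.sqrt (1 + (complex.Im u / complex.Re u) ^+ 2).
Proof.
case: u => x y /= x0; rewrite -{2}(gtr0_norm x0) -sqrtr_sqr -sqrtrM ?sqr_ge0//.
by congr Num.sqrt; field; rewrite gt_eqF.
Qed.

(** The cosine of atan v is 1 / sqrt(1 + v^2), which is Re u / |u|; the sign of Im u selects the
    branch. The arctangent makes continuity and measurability accessible. *)
Lemma ArgE u : 0 < complex.Re u -> Arg u = atan (complex.Im u / complex.Re u).
Proof.
move=> u0; rewrite /Arg.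
have -> : complex.Re u / normc u = cos (atan (complex.Im u / complex.Re u)).
  rewrite cos_atan normc_Re_sqrt// invfM mulrA divff ?mul1r// gt_eqF//.
have pi2 := pihalf_ge1 R.
case: ifPn => [I0|]; last rewrite -ltNge => I0.
  rewrite cosK// in_itv/=; apply/andP; split.
    by rewrite -atan0; apply: le_atan; rewrite divr_ge0// ltW.
  by have := atan_ltpi2 (complex.Im u / complex.Re u); lra.
rewrite cosKN ?opprK//; apply/andP; split.
  by have := atan_gtNpi2 (complex.Im u / complex.Re u); lra.
by rewrite -atan0; apply: le_atan; rewrite mulr_le0_ge0 ?invr_ge0 ?ltW.
Qed.

Lemma cpowrV u c : 0 < complex.Re u ->
  let th := c * atan (complex.Im u / complex.Re u) in
  (cpowr u c)^-1 = (normc u `^ (- c) * cos th +i* - (normc u `^ (- c) * sin th))%C.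
Proof.
move=> u0 th; apply: mulr1_eq; rewrite /cpowr ArgE// -/th powRN.
have nu : 0 < normc u.
  by apply: lt_le_trans u0 (le_trans (ler_norm _) (normr_Re_le u)).
have : normc u `^ c != 0 by rewrite gt_eqF// powR_gt0.
have := cos2Dsin2 th.
move: (normc u `^ c) (cos th) (sin th) => P C S h P0.
apply/eqP; rewrite eq_complex /=; apply/andP; split; apply/eqP; last by field.
rewrite (_ : _ - _ = C ^+ 2 + S ^+ 2)//; by field.
Qed.

(** This fixes the aperture of the sector where the kernel of T has large real part, by continuity
    at v = 0. *)
Lemma cos_atan_near0 c : exists2 eta0 : R, 0 < eta0 &
  forall v : R, `|v| <= eta0 -> 1 / 2 <= cos (c * atan v).
Proof.
have cc : {for (0 : R), continuous (fun v : R => cos (c * atan v))}.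
  apply: continuous_comp; last exact: continuous_cos.
  by apply: cvgM; [exact: cvg_cst|exact: continuous_atan].
have half0 : 0 < 1 / 2 :> R by rewrite divr_gt0.
have := cc; rewrite /prop_for/continuous_at => /cvgrPdist_le/(_ _ half0).
rewrite atan0 mulr0 cos0 => -[e /= e0 H]; exists (e / 2); first by rewrite divr_gt0.
move=> v hv; have : `|1 - cos (c * atan v)| <= 1 / 2.
  apply: H; rewrite /ball/= sub0r normrN; apply: le_lt_trans hv _.
  by rewrite ltr_pdivrMr// ltr_pMr// ltr1n.
by rewrite ler_norml => /andP[]; lra.
Qed.

End principal_power.

Section kernels.
Context {R : realType} (n : nat) (b c : R).
Local Notation ball := (unit_ball R n).

Lemma S_kernel_abs (z w : Cn R n) :
  normc (S_kernel b c z w) = (1 - sqnorm w) `^ b * normc (1 - inner z w) `^ (- c).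
Proof.
rewrite /S_kernel /= expr0n/= addr0 sqrtr_sqr ger0_norm ?powRN//.
by rewrite divr_ge0 ?powR_ge0.
Qed.

Lemma S_kernel_Re (z w : Cn R n) :
  normc (S_kernel b c z w) / 2 <= complex.Re (S_kernel b c z w).
Proof.
rewrite S_kernel_abs /S_kernel /= powRN.
have : 0 <= (1 - sqnorm w) `^ b / normc (1 - inner z w) `^ c.
  by rewrite divr_ge0 ?powR_ge0.
by lra.
Qed.

Lemma T_kernelE (z w : Cn R n) : ball z -> ball w ->
  let u := 1 - inner z w in let th := c * atan (complex.Im u / complex.Re u) in
  let k := (1 - sqnorm w) `^ b * normc u `^ (- c) in
  T_kernel b c z w = (k * cos th +i* - (k * sin th))%C.
Proof.
move=> bz bw u th k; rewrite /T_kernel cpowrV ?Re_1Binner_gt0// -/u -/th /k.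
by apply/eqP; rewrite eq_complex /=; apply/andP; split; apply/eqP; ring.
Qed.

Lemma T_kernel_abs (z w : Cn R n) : ball z -> ball w ->
  normc (T_kernel b c z w) = (1 - sqnorm w) `^ b * normc (1 - inner z w) `^ (- c).
Proof.
move=> bz bw; rewrite T_kernelE//.
set th := c * _; set k := (1 - sqnorm w) `^ b * _.
have k0 : 0 <= k by rewrite mulr_ge0 ?powR_ge0.
have := cos2Dsin2 th; move: (cos th) (sin th) => C S h.
rewrite /= (_ : _ + _ = k ^+ 2 * (C ^+ 2 + S ^+ 2)); last by ring.
by rewrite h mulr1 sqrtr_sqr ger0_norm.
Qed.

Lemma measurable_S_kernel (D : set (Cn R n * Cn R n)) :
  measurable D -> measurable_fun D (fun x => S_kernel b c x.1 x.2).
Proof.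
move=> mD; apply: measurable_fun_complex => //=.
apply: measurable_funTS; apply: measurable_funM.
  apply: (measurableT_comp (measurable_powR b)); apply: measurable_funB => //.
  exact: (measurableT_comp measurable_sqnorm measurable_snd).
under eq_fun do rewrite -powRN.
apply: (measurableT_comp (measurable_powR (- c))).
exact: (measurableT_comp measurable_normc (@measurable_1Binner R n)).
Qed.

Lemma measurable_T_kernel :
  measurable_fun (ball `*` ball) (fun x => T_kernel b c x.1 x.2).
Proof.
have mB := measurableX (measurable_unit_ball R n) (measurable_unit_ball R n).
have mu := @measurable_1Binner R n.
pose k (x : Cn R n * Cn R n) := (1 - sqnorm x.2) `^ b * normc (1 - inner x.1 x.2) `^ (- c).
(* The quotient is written with the power -1, which is measurable everywhere and agrees with the
   inverse where Re (1 - <z,w>) > 0. *)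
pose th (x : Cn R n * Cn R n) :=
  c * atan (complex.Im (1 - inner x.1 x.2) * complex.Re (1 - inner x.1 x.2) `^ (- 1)).
have mk : measurable_fun setT k.
  apply: measurable_funM.
    apply: (measurableT_comp (measurable_powR b)); apply: measurable_funB => //.
    exact: (measurableT_comp measurable_sqnorm measurable_snd).
  apply: (measurableT_comp (measurable_powR (- c))).
  exact: (measurableT_comp measurable_normc mu).
have mth : measurable_fun setT th.
  apply: measurable_funM => //.
  apply: measurableT_comp.
    by apply: continuous_measurable_fun => x; exact: continuous_atan.
  apply: measurable_funM; first exact: measurable_fun_Im.
  apply: (measurableT_comp (measurable_powR (- 1))); exact: measurable_fun_Re.
apply: (eq_measurable_fun (fun x => (k x * cos (th x) +i* - (k x * sin (th x)))%C)).
  by move=> x; rewrite inE => -[bz bw]; rewrite T_kernelE// /th powR_inv1// ltW// Re_1Binner_gt0.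
apply: measurable_fun_complex => //=; apply: measurable_funTS.
  apply: measurable_funM => //; apply: measurableT_comp => //.
  by apply: continuous_measurable_fun; exact: continuous_cos.
apply: measurable_funN.
apply: measurable_funM => //; apply: measurableT_comp => //.
by apply: continuous_measurable_fun; exact: continuous_sin.
Qed.

End kernels.

(** The real part is |K| cos(c Arg u), and the hypothesis bounds |tan(Arg u)| by [eta0], chosen in
    terms of [c] alone. *)
Lemma T_kernel_Re {R : realType} (c : R) : exists2 eta0 : R, 0 < eta0 &
  forall n b (z w : Cn R n), unit_ball R n z -> unit_ball R n w ->
  `|complex.Im (1 - inner z w)| <= eta0 * complex.Re (1 - inner z w) ->
  normc (T_kernel b c z w) / 2 <= complex.Re (T_kernel b c z w).
Proof.
have [e e0 he] := cos_atan_near0 c; exists e => // n b z w bz bw h.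
have u0 := Re_1Binner_gt0 bz bw.
rewrite T_kernel_abs// T_kernelE//=.
apply: ler_wpM2l; first by rewrite mulr_ge0 ?powR_ge0.
rewrite -[leLHS]mul1r; apply: he.
by rewrite normrM normrV ?unitfE ?gt_eqF// (gtr0_norm u0) ler_pdivrMr.
Qed.

(** Boundedness depends on the kernel only through its modulus and its real part in the sector, so
    both operators obey one criterion, which yields their equivalence. With r = 1/p, and r = 0 for p
    = oo, it covers all p > 1. *)
Lemma bounded_Lp_Linfty_iff {R : realType} (n : nat) (b c a alpha : R) (p : \bar R)
    (K : Cn R n.+1 -> Cn R n.+1 -> R[i]) (eta0 : R) :
  -1 < alpha -> (1 < p)%E -> 0 < eta0 ->
  measurable_fun (unit_ball R n.+1 `*` unit_ball R n.+1) (fun x => K x.1 x.2) ->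
  (forall z w, unit_ball R n.+1 z -> unit_ball R n.+1 w ->
    normc (K z w) = (1 - sqnorm w) `^ b * normc (1 - inner z w) `^ (- c)) ->
  (forall z w, unit_ball R n.+1 z -> unit_ball R n.+1 w ->
    `|complex.Im (1 - inner z w)| <= eta0 * complex.Re (1 - inner z w) ->
    normc (K z w) / 2 <= complex.Re (K z w)) ->
  let r := 1 - dual_inv p in
  bounded_Lp_Linfty alpha p K (weighted_integral_op a K) <->
  r * (alpha + 1) < b + 1 /\
  (a = 0 /\ c < n.+1%:R + 1 + b - r * (n.+1%:R + 1 + alpha) \/
   0 < a /\ c <= n.+1%:R + 1 + a + b - r * (n.+1%:R + 1 + alpha)).
Proof.
move=> alpha1 p1 eta00 Kmeas Kabs Kpos r.
have om0 := dual_inv_gt0 p1.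
split=> [Kbnd|[hb hc]].
- have ha := bounded_a_ge0 alpha1 p1 eta00 Kabs Kpos Kbnd.
  have hs := bounded_b_gt alpha1 p1 eta00 Kabs Kpos Kbnd.
  have hc := bounded_c_le alpha1 p1 eta00 Kabs Kpos Kbnd.
  have hc0 := bounded_c_lt alpha1 p1 eta00 Kabs Kpos Kbnd.
  move: om0 ha hs hc hc0; rewrite {}/r; move: (dual_inv p) => om om0 ha hs hc hc0.
  have E : om * ((b - c - (1 - om) * alpha) / om + n.+1%:R + 1) =
      b - c - (1 - om) * alpha + om * (n.+1%:R + 1).
    by move: (n.+1%:R : R) => N; field; rewrite gt_eqF.
  rewrite {}E in hc hc0; split; first by move: hs; rewrite ltr_pdivlMr//; lra.
  move: hc hc0; move: (n.+1%:R : R) => N hc hc0.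
  move: ha; rewrite le_eqVlt => /orP[/eqP/esym a0|a0]; [left|right]; split => //.
    by have := hc0 a0; lra.
  by lra.
have s1 : -1 < (b - r * alpha) / dual_inv p.
  by rewrite ltr_pdivlMr//; move: hb; rewrite /r; lra.
(* The conditions on a and c, divided by om, are those of [forelli_rudin_le] for A = a/om and t =
   c/om. *)
have hst : a / dual_inv p = 0 /\ c / dual_inv p < n.+1%:R + 1 + (b - r * alpha) / dual_inv p \/
    0 < a / dual_inv p /\
    c / dual_inv p <= n.+1%:R + 1 + (b - r * alpha) / dual_inv p + a / dual_inv p.
  move: hc; rewrite /r {s1 hb r}; move: (dual_inv p) (n.+1%:R : R) om0 => om N om0 hc.
  case: hc => -[ha hc]; [left|right]; split.
  - by rewrite ha mul0r.
  - rewrite ltr_pdivrMr// (_ : _ * om = om * (N + 1) + (b - (1 - om) * alpha)); first by lra.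
    by field; rewrite gt_eqF.
  - by rewrite divr_gt0.
  - rewrite ler_pdivrMr// (_ : _ * om = om * (N + 1) + (b - (1 - om) * alpha) + a); first by lra.
    by field; rewrite gt_eqF.
have [C C0 HC] := @forelli_rudin_le R n _ _ _ s1 hst.
have [C' C'0 HC'] := kernel_integral_le Kmeas Kabs alpha1 p1 C0 HC.
by have := bounded_of_kernel_integral_le Kmeas C'0 HC'; apply.
Qed.

Theorem theorem1p3 (R : realType) (n : nat) (hn : (0 < n)%N)
    (a b c alpha : R) (halpha : -1 < alpha) (p : \bar R) (hp : (1 < p)%E) :
  let S_bounded :=
    bounded_Lp_Linfty alpha p (@S_kernel R n b c) (@S_op R n a b c) in
  let T_bounded :=
    bounded_Lp_Linfty alpha p (@T_kernel R n b c) (@T_op R n a b c) in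
  let parameters :=
    match p with
    | EFin q =>
        [/\ a = 0, alpha + 1 < q * (b + 1)
          & c < n%:R + 1 + b - (n%:R + 1 + alpha) / q]
        \/
        [/\ 0 < a, alpha + 1 < q * (b + 1)
          & c <= n%:R + 1 + a + b - (n%:R + 1 + alpha) / q]
    | +oo%E =>
        [/\ a = 0, -1 < b & c < n%:R + 1 + b]
        \/
        [/\ 0 < a, -1 < b & c <= n%:R + 1 + a + b]
    | -oo%E => False
    end in
  (S_bounded <-> T_bounded) /\ (T_bounded <-> parameters).
Proof.
case: n hn => // n _ S_bounded T_bounded parameters.
have [eta0 eta00 Tre] := T_kernel_Re c.
have mB := measurableX (measurable_unit_ball R n.+1) (measurable_unit_ball R n.+1).
(* The kernel of S is its own modulus, so any aperture serves, here 1; that of T takes the one given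
   by the cosine. *)
have Sb := bounded_Lp_Linfty_iff a halpha hp ltr01 (measurable_S_kernel b c mB)
  (fun z w _ _ => S_kernel_abs b c z w) (fun z w _ _ _ => S_kernel_Re b c z w).
have Tb := bounded_Lp_Linfty_iff a halpha hp eta00 (@measurable_T_kernel R n.+1 b c)
  (@T_kernel_abs R n.+1 b c) (@Tre n.+1 b).
split; first by split=> [/Sb/Tb|/Tb/Sb].
apply: iff_trans Tb _; rewrite /parameters {Sb S_bounded T_bounded parameters}.
have and3_or (A B C D E : Prop) : B /\ (A /\ C \/ D /\ E) <-> [/\ A, B & C] \/ [/\ D, B & E].
  by split=> [[h [[h1 h2]|[h1 h2]]]|[[h1 h h2]|[h1 h h2]]];
    [left|right|split=> //; left|split=> //; right].
case: p hp => [q| |]; rewrite /dual_inv //= => hq.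
- rewrite opprB addrCA subrr addr0 ![q^-1 * _]mulrC.
  have q0 : 0 < q by move: hq; rewrite lte_fin; lra.
  by rewrite ltr_pdivrMr// (mulrC _ q).
- by rewrite !subr0 subrr !mul0r !subr0 -ltrBlDr sub0r.
Qed.
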